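(* Let $m,n,p,q$ be positive integers. Consider Bayesian error-in-variable regression with classical errors in the features: for $i=1,\ldots,n$, independently, $$Y_i\mid\mathcal{A}_i,\theta,\beta,\Sigma\sim N_m(\Theta^TZ_i+\mathcal{B}^T\mathcal{A}_i,\Sigma),\qquad X_i\mid\mathcal{A}_i\sim N_p(\mathcal{A}_i,V_i),$$ with known symmetric positive-definite (SPD) $V_i\in\mathbb{R}^{p\times p}$ and fixed known $Z_i\in\mathbb{R}^q$, and independent priors $\mathcal{A}_i\sim N_p(k_i,K_i)$, $\Sigma\sim\mathcal{W}^{-1}(a_0,B_0)$, $(\theta,\beta)^T\sim N_{m(q+p)}(j_0,J_0)$, where $k_i\in\mathbb{R}^p$, $K_i\in\mathbb{R}^{p\times p}$ is SPD, $a_0\ge m$ is an integer, $B_0\in\mathbb{R}^{m\times m}$ is SPD, $j_0\in\mathbb{R}^{m(q+p)}$ and $J_0\in\mathbb{R}^{m(q+p)\times m(q+p)}$ is SPD. Given any observed data $y_i\in\mathbb{R}^m$, $x_i\in\mathbb{R}^p$, $i=1,\ldots,n$, the posterior density is $$\pi_n(\mathcal{A},\theta,\beta,\Sigma)\propto\det(\Sigma)^{-(n+a_0+m+1)/2}\exp\Big[-\tfrac12\mathrm{tr}(\Sigma^{-1}B_0)-\tfrac12\sum_{i=1}^n(y_i-\Theta^TZ_i-\mathcal{B}^T\mathcal{A}_i)^T\Sigma^{-1}(y_i-\Theta^TZ_i-\mathcal{B}^T\mathcal{A}_i)\Big]$$ $$\times\exp\Big[-\tfrac12\sum_{i=1}^n(\mathcal{A}_i-k_i')^T(V_i^{-1}+K_i^{-1})(\mathcal{A}_i-k_i')-\tfrac12((\theta,\beta)^T-j_0)^TJ_0^{-1}((\theta,\beta)^T-j_0)\Big],$$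 where $k_i'=(V_i^{-1}+K_i^{-1})^{-1}[V_i^{-1}x_i+K_i^{-1}k_i]$. Then the 3-variable deterministic scan Gibbs sampler $(\mathcal{A}_t,\theta_t,\beta_t,\Sigma_t)_{t\ge0}$ for this posterior, which at each step $t\ge1$ generates $\Sigma_t\sim\pi_n(\cdot\mid\mathcal{A}_{t-1},\theta_{t-1},\beta_{t-1})$, then $(\theta_t,\beta_t)\sim\pi_n(\cdot\mid\mathcal{A}_{t-1},\Sigma_t)$, then $\mathcal{A}_t\sim\pi_n(\cdot\mid\theta_t,\beta_t,\Sigma_t)$, is geometrically ergodic.
   Context: Here $\mathcal{A}=(\mathcal{A}_1,\ldots,\mathcal{A}_n)^T\in\mathbb{R}^{n\times p}$, $\theta=\mathrm{vec}(\Theta)$ with $\Theta\in\mathbb{R}^{q\times m}$, $\beta=\mathrm{vec}(\mathcal{B})$ with $\mathcal{B}\in\mathbb{R}^{p\times m}$, $\Sigma\in\mathbb{R}^{m\times m}$ is SPD, $\mathrm{vec}$ stacks the columns of a matrix, and $(\theta,\beta)^T$ is the concatenated column vector. $N_d(\mu,C)$ is the $d$-dimensional normal distribution; $\mathcal{W}^{-1}(\nu,S)$ is the inverse-Wishart distribution on SPD $m\times m$ matrices with density proportional to $\det(\Sigma)^{-(\nu+m+1)/2}\exp(-\tfrac12\mathrm{tr}(\Sigma^{-1}S))$. Densities are with respect to Lebesgue measure (for $\Sigma$: on the open cone of SPD matrices in the symmetric matrices). The conditional densities $\pi_n(\cdot\mid\cdot)$ are the full conditionals obtained by normalizing $\pi_n$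 in the indicated block with the other variables fixed (inverse-Wishart for $\Sigma$, Gaussian for the other two blocks). Let $P$ be the Markov transition kernel of the chain, $P^t$ its $t$-step iterate, and $\Pi_n$ the probability measure with density $\pi_n$. The chain is called geometrically ergodic if there are $\rho\in(0,1)$ and a function $M$ from the state space to $[0,\infty)$ such that for every initial state $s=(\mathcal{A},\theta,\beta,\Sigma)$ and every $t\ge1$, $\sup_B|P^t(s,B)-\Pi_n(B)|\le M(s)\rho^t$, the supremum being over Borel sets $B$. *)

(* Defs.v *)
From HB Require Import structures.
From mathcomp Require Import all_boot all_order all_algebra.
From mathcomp Require Import all_classical all_reals all_analysis.
From mathcomp Require Import measurable_realfun lebesgue_measure ring.

Set Implicit Arguments.
Unset Strict Implicit.
Unset Printing Implicit Defensive.

Import Order.TTheory GRing.Theory Num.Theory.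
Import numFieldNormedType.Exports.

Local Open Scope classical_set_scope.
Local Open Scope ring_scope.

Section borel_matrix.
Context {R : realType} (m n : nat).

HB.instance Definition _ := @isMeasurable.Build
  (sigma_display (@open 'M[R]_(m, n))) 'M[R]_(m, n) <<s @open 'M[R]_(m, n) >>
  (@sigma_algebra0 _ setT _) (@sigma_algebraC _ _)
  (@sigma_algebra_bigcup _ setT _).

Lemma measurable_coord i j :
  measurable_fun [set: 'M[R]_(m, n)] (fun M : 'M[R]_(m, n) => M i j).
Proof.
apply: (measurability _ (RGenOpens.measurableE R)) => _ [_ [a [b ->]] <-].
rewrite setTI; apply: sub_sigma_algebra.
move: (@coord_continuous R m n i j) => /continuousP; apply.
exact: interval_open.
Qed.

Lemma dense_rat_mx (x : 'M[R]_(m, n)) (U : set 'M[R]_(m, n)) :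
  nbhs x U -> exists q : 'M[rat]_(m, n), U (map_mx ratr q).
Proof.
move=> /nbhs_ballP[e /= e0 xeU].
have rx i j : exists q : rat, `|x i j - ratr q| < e.
  have [] := @rat_in_itvoo R (x i j - e) (x i j + e).
    by rewrite ltrD2l gtrN.
  by move=> q; rewrite in_itv/= => qx; exists q; rewrite distrC ltr_distl.
exists (\matrix_(i, j) sval (cid (rx i j))); apply: xeU; split => // i j.
by rewrite /ball/= !mxE; exact: svalP (cid (rx i j)).
Qed.

Lemma measurable_fun_mxP d (T : measurableType d) (f : T -> 'M[R]_(m, n)) :
  measurable_fun setT f <->
  forall i j, measurable_fun setT (fun x => f x i j).
Proof.
split=> [mf i j|mf]; first exact: measurableT_comp (measurable_coord i j) mf.
apply: (@measurability _ _ _ _ _ f (@open 'M[R]_(m, n))) => // _ [U oU <-].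
rewrite setTI.
pose B (c : 'M[rat]_(m, n) * nat) : set 'M[R]_(m, n) :=
  ball (map_mx ratr c.1 : 'M[R]_(m, n)) (c.2.+1%:R^-1).
have UE : U = \bigcup_(c in [set c | B c `<=` U]) B c.
  apply/seteqP; split=> [x Ux|x [c cU]]; last exact: cU.
  have /nbhs_ballP[e /= e0 xeU] : nbhs x U by move: oU; rewrite openE; apply.
  have [k] : exists k : nat, (k.+1%:R^-1 : R) < e / 2.
    have [k _ /(_ k (leqnn k))] := near_infty_natSinv_lt (PosNum (divr_gt0 e0 (ltr0Sn R 1))).
    by exists k.
  move=> ke.
  have k0 : (0 : R) < k.+1%:R^-1 by rewrite invr_gt0.
  have [q qx] := dense_rat_mx (nbhsx_ballx x _ k0).
  exists (q, k) => [/= y qy|]; last exact: ball_sym.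
  apply: xeU.
  apply: (@le_ball _ _ _ (k.+1%:R^-1 + k.+1%:R^-1)).
    by rewrite (le_trans (lerD (ltW ke) (ltW ke)))// -splitr.
  by apply: ball_triangle qy; exact: qx.
rewrite UE preimage_bigcup bigcup_mkcond.
apply: countable_bigcupT_measurable => // c; case: ifPn => // _.
have -> : f @^-1` B c = \bigcap_(i in [set: 'I_m]) \bigcap_(j in [set: 'I_n])
    ((fun x => f x i j) @^-1` ball (ratr (c.1 i j) : R) c.2.+1%:R^-1).
  apply/seteqP; split => [x [_ h] i _ j _|x h].
    by have := h i j; rewrite mxE.
  by split => [|i j]; [rewrite invr_gt0|rewrite mxE; exact: h].
apply: fin_bigcap_measurable => // i _; apply: fin_bigcap_measurable => // j _.
by rewrite -[X in measurable X]setTI; apply: mf => //; exact: measurable_ball.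
Qed.

End borel_matrix.

(* The left inverse g of f only serves to make the image measure sigma-finite. *)
Section push_measure.
Context d1 d2 (T1 : measurableType d1) (T2 : measurableType d2) (R : realType).
Variables (mu : {sigma_finite_measure set T1 -> \bar R}).
Variables (f : T1 -> T2) (g : T2 -> T1).

Definition push_measure (mf : measurable_fun setT f) (mg : measurable_fun setT g)
  (fK : cancel f g) : set T2 -> \bar R := pushforward mu f.

Variables (mf : measurable_fun setT f) (mg : measurable_fun setT g).
Variable fK : cancel f g.

Local Notation nu := (push_measure mf mg fK).

Let nu0 : nu set0 = 0%E. Proof. exact: measure0. Qed.

Let nu_ge0 A : (0 <= nu A)%E. Proof. exact: measure_ge0. Qed.

Let nu_sigma_additive : semi_sigma_additive nu.
Proof.
move=> F mF tF mUF; rewrite /push_measure /pushforward preimage_bigcup.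
apply: measure_semi_sigma_additive.
- by move=> n; rewrite -[X in measurable X]setTI; exact: mf.
- apply/trivIsetP => /= i j _ _ ij; rewrite -preimage_setI.
  by move/trivIsetP : tF => /(_ _ _ _ _ ij) ->//; rewrite preimage_set0.
- by rewrite -preimage_bigcup -[X in measurable X]setTI; exact: mf.
Qed.

HB.instance Definition _ :=
  isMeasure.Build _ _ _ nu nu0 nu_ge0 nu_sigma_additive.

Let nu_sigma_finite : sigma_finite setT nu.
Proof.
have [F TF mF] := sigma_finiteT mu.
exists (fun i => g @^-1` F i); first by rewrite -preimage_bigcup -TF.
move=> i; have [mFi Fioo] := mF i; split.
  by rewrite -[X in measurable X]setTI; exact: mg.
rewrite /push_measure /pushforward (_ : f @^-1` _ = F i)//.
by apply/seteqP; split=> x /=; rewrite fK.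
Qed.

HB.instance Definition _ :=
  Measure_isSigmaFinite.Build _ _ _ nu nu_sigma_finite.

End push_measure.

(* The product measure mu \x nu of the library, repackaged because canonical
   structure inference does not find its sigma-finiteness. *)
Section prod_measure.
Context d1 d2 (T1 : measurableType d1) (T2 : measurableType d2) (R : realType).
Variable mu : {sigma_finite_measure set T1 -> \bar R}.
Variable nu : {sigma_finite_measure set T2 -> \bar R}.

Definition prod_measure : set (T1 * T2) -> \bar R := (mu \x nu)%E.

HB.instance Definition _ := Measure.on prod_measure.

Let prod_measure_sigma_finite : sigma_finite setT prod_measure.
Proof.
have /sigma_finiteP[F [TF ndF Foo]] := sigma_finiteT mu.
have /sigma_finiteP[G [TG ndG Goo]] := sigma_finiteT nu.
exists (fun n => F n `*` G n).
  rewrite -setXTT TF TG predeqE => -[x y]; split.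
    move=> [/= [n _ Fnx] [k _ Gky]]; exists (maxn n k) => //; split.
    - by move: x Fnx; exact/subsetPset/ndF/leq_maxl.
    - by move: y Gky; exact/subsetPset/ndG/leq_maxr.
  by move=> [n _ []/= ? ?]; split; exists n.
move=> k; have [? ?] := Foo k; have [? ?] := Goo k.
split; first exact: measurableX.
by rewrite /prod_measure product_measure1E// lte_mul_pinfty// ge0_fin_numE.
Qed.

HB.instance Definition _ :=
  Measure_isSigmaFinite.Build _ _ _ prod_measure prod_measure_sigma_finite.

End prod_measure.

Section lebesgue_tuple.
Context {R : realType}.
Local Notation RR := (measurableTypeR R).

Let cons_uncurry n (z : RR * n.-tuple RR) : n.+1.-tuple RR :=
  [tuple of z.1 :: z.2].
Let uncons n (t : n.+1.-tuple RR) : RR * n.-tuple RR :=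
  (thead t, [tuple of behead t]).

Let measurable_cons_uncurry n : measurable_fun setT (@cons_uncurry n).
Proof. exact: measurable_cons. Qed.

Let measurable_uncons n : measurable_fun setT (@uncons n).
Proof.
by apply: measurable_fun_pair; [exact: measurable_tnth|exact: measurable_behead].
Qed.

Let cons_uncurryK n : cancel (@cons_uncurry n) (@uncons n).
Proof. by case=> x t; rewrite /uncons theadE; congr pair; apply: val_inj. Qed.

Fixpoint lebesgue_tuple (n : nat) :
    {sigma_finite_measure set (n.-tuple RR) -> \bar R} :=
  match n with
  | 0%N => \d_[tuple]
  | n'.+1 => push_measure (prod_measure lebesgue_measure (lebesgue_tuple n'))
      (@measurable_cons_uncurry n') (@measurable_uncons n') (@cons_uncurryK n')
  end.

End lebesgue_tuple.

Section lebesgue_mx.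
Context {R : realType} (m n : nat).
Local Notation RR := (measurableTypeR R).

Let mx_of_tuple (t : #|{: 'I_m * 'I_n}|.-tuple RR) : 'M[R]_(m, n) :=
  \matrix_(i, j) tnth t (enum_rank (i, j)).

Let tuple_of_mx (M : 'M[R]_(m, n)) : #|{: 'I_m * 'I_n}|.-tuple RR :=
  [tuple M (enum_val k).1 (enum_val k).2 | k < #|{: 'I_m * 'I_n}|].

Let measurable_mx_of_tuple : measurable_fun setT mx_of_tuple.
Proof.
apply/measurable_fun_mxP => i j.
under eq_fun do rewrite mxE.
exact: measurable_tnth.
Qed.

Let measurable_tuple_of_mx : measurable_fun setT tuple_of_mx.
Proof.
apply/measurable_fun_tnthP => k.
rewrite [X in measurable_fun _ X](_ : _ = fun M : 'M[R]_(m, n) => M (enum_val k).1 (enum_val k).2).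
  exact: measurable_coord.
by apply/funext => M /=; rewrite tnth_mktuple.
Qed.

Let mx_of_tupleK : cancel mx_of_tuple tuple_of_mx.
Proof.
move=> t; apply: eq_from_tnth => k; rewrite tnth_mktuple mxE.
by rewrite -surjective_pairing enum_valK.
Qed.

Definition lebesgue_mx : {sigma_finite_measure set 'M[R]_(m, n) -> \bar R} :=
  push_measure (lebesgue_tuple #|{: 'I_m * 'I_n}|)
    measurable_mx_of_tuple measurable_tuple_of_mx mx_of_tupleK.

End lebesgue_mx.
Arguments lebesgue_mx {R}.

(* Lebesgue measure of the symmetric matrices in the coordinates (S i j), i <= j,
   as a measure on all square matrices concentrated on the symmetric ones. *)
Section lebesgue_sym.
Context {R : realType} (m : nat).
Local Notation RR := (measurableTypeR R).

Definition upper_index := {ij : 'I_m * 'I_m | (ij.1 <= ij.2)%N}.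

Let sort_index (i j : 'I_m) : upper_index :=
  insubd (exist _ (i, i) (leqnn i) : upper_index)
    (if (i <= j)%N then (i, j) else (j, i)).

Let sort_indexE i j :
  val (sort_index i j) = if (i <= j)%N then (i, j) else (j, i).
Proof.
rewrite val_insubd; case: (leqP i j) => [->//|/ltnW ->//].
Qed.

Let sym_of_tuple (t : #|{: upper_index}|.-tuple RR) : 'M[R]_m :=
  \matrix_(i, j) tnth t (enum_rank (sort_index i j)).

Let tuple_of_sym (S : 'M[R]_m) : #|{: upper_index}|.-tuple RR :=
  [tuple S (val (enum_val k)).1 (val (enum_val k)).2 | k < #|{: upper_index}|].

Let measurable_sym_of_tuple : measurable_fun setT sym_of_tuple.
Proof.
apply/measurable_fun_mxP => i j.
rewrite [X in measurable_fun _ X](_ : _ = fun t : #|{: upper_index}|.-tuple RR =>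
    tnth t (enum_rank (sort_index i j))); first exact: measurable_tnth.
by apply/funext => t; rewrite mxE.
Qed.

Let measurable_tuple_of_sym : measurable_fun setT tuple_of_sym.
Proof.
apply/measurable_fun_tnthP => k.
rewrite [X in measurable_fun _ X](_ : _ = fun S : 'M[R]_m => S (val (enum_val k)).1 (val (enum_val k)).2).
  exact: measurable_coord.
by apply/funext => M /=; rewrite tnth_mktuple.
Qed.

Let sym_of_tupleK : cancel sym_of_tuple tuple_of_sym.
Proof.
move=> t; apply: eq_from_tnth => k; rewrite tnth_mktuple mxE.
suff -> : sort_index (val (enum_val k)).1 (val (enum_val k)).2 = enum_val k.
  by rewrite enum_valK.
apply: val_inj; rewrite sort_indexE (svalP (enum_val k)).
by rewrite -surjective_pairing.
Qed.

Definition lebesgue_sym : {sigma_finite_measure set 'M[R]_m -> \bar R} :=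
  push_measure (lebesgue_tuple #|{: upper_index}|)
    measurable_sym_of_tuple measurable_tuple_of_sym sym_of_tupleK.

End lebesgue_sym.

Section measurable_mx.
Context d (T : measurableType d) (R : realType).

Lemma measurable_mx_entry m n (f : T -> 'M[R]_(m, n)) i j :
  measurable_fun setT f -> measurable_fun setT (fun x => f x i j).
Proof. by move=> mf; exact: (measurable_fun_mxP _).1. Qed.

Lemma measurable_trmx m n (f : T -> 'M[R]_(m, n)) :
  measurable_fun setT f -> measurable_fun setT (fun x => (f x)^T).
Proof.
move=> mf; apply/measurable_fun_mxP => i j.
by under eq_fun do rewrite mxE; exact: measurable_mx_entry.
Qed.

Lemma measurable_addmx m n (f g : T -> 'M[R]_(m, n)) :
  measurable_fun setT f -> measurable_fun setT g ->
  measurable_fun setT (fun x => f x + g x).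
Proof.
move=> mf mg; apply/measurable_fun_mxP => i j.
under eq_fun do rewrite mxE.
by apply: measurable_funD; exact: measurable_mx_entry.
Qed.

Lemma measurable_oppmx m n (f : T -> 'M[R]_(m, n)) :
  measurable_fun setT f -> measurable_fun setT (fun x => - f x).
Proof.
move=> mf; apply/measurable_fun_mxP => i j.
under eq_fun do rewrite mxE.
by apply: measurable_funN; exact: measurable_mx_entry.
Qed.

Lemma measurable_submx m n (f g : T -> 'M[R]_(m, n)) :
  measurable_fun setT f -> measurable_fun setT g ->
  measurable_fun setT (fun x => f x - g x).
Proof. by move=> mf mg; apply: measurable_addmx => //; exact: measurable_oppmx. Qed.

Lemma measurable_mulmx m n p (f : T -> 'M[R]_(m, n)) (g : T -> 'M[R]_(n, p)) :
  measurable_fun setT f -> measurable_fun setT g ->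
  measurable_fun setT (fun x => f x *m g x).
Proof.
move=> mf mg; apply/measurable_fun_mxP => i j.
under eq_fun do rewrite mxE.
by apply: measurable_sum => k; apply: measurable_funM; exact: measurable_mx_entry.
Qed.

Lemma measurable_row m n i (f : T -> 'M[R]_(m, n)) :
  measurable_fun setT f -> measurable_fun setT (fun x => row i (f x)).
Proof.
move=> mf; apply/measurable_fun_mxP => i' j.
by under eq_fun do rewrite mxE; exact: measurable_mx_entry.
Qed.

Lemma measurable_vec_mx m n (f : T -> 'rV[R]_(m * n)) :
  measurable_fun setT f -> measurable_fun setT (fun x => vec_mx (f x)).
Proof.
move=> mf; apply/measurable_fun_mxP => i j.
by under eq_fun do rewrite mxE; exact: measurable_mx_entry.
Qed.

Lemma measurable_col_mx m1 m2 n (f : T -> 'M[R]_(m1, n)) (g : T -> 'M[R]_(m2, n)) :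
  measurable_fun setT f -> measurable_fun setT g ->
  measurable_fun setT (fun x => col_mx (f x) (g x)).
Proof.
move=> mf mg; apply/measurable_fun_mxP => i j.
under eq_fun do rewrite mxE.
by case: splitP => k _; exact: measurable_mx_entry.
Qed.

Lemma measurable_mxtrace n (f : T -> 'M[R]_n) :
  measurable_fun setT f -> measurable_fun setT (fun x => \tr (f x)).
Proof. by move=> mf; apply: measurable_sum => i; exact: measurable_mx_entry. Qed.

Lemma measurable_det n (f : T -> 'M[R]_n) :
  measurable_fun setT f -> measurable_fun setT (fun x => \det (f x)).
Proof.
move=> mf; rewrite /determinant; apply: measurable_sum => s.
apply: measurable_funM => //.
by apply: measurable_prod => i _; exact: measurable_mx_entry.
Qed.

Lemma measurable_inv (f : T -> R) :
  measurable_fun setT f -> measurable_fun setT (fun x => (f x)^-1).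
Proof.
move=> mf; have -> : (fun x => (f x)^-1) =
    (fun x => if f x == 0 then 0 else (f x)^-1).
  by apply/funext => x; case: eqP => // ->; rewrite invr0.
apply: measurable_fun_if => //.
- by apply: measurable_fun_eqr => //; exact: measurable_cst.
- apply: (@measurable_comp _ _ _ _ _ _ [set r : R | r != 0]) => //.
  + exact: open_measurable.
  + by move=> _ [x [_ /= /eqP fx0] <-]; exact/eqP.
  + apply: open_continuous_measurable_fun => //; apply/in_setP => x /= x0.
    exact: inv_continuous.
  + exact: measurable_funTS.
Qed.

Lemma measurable_invmx n (f : T -> 'M[R]_n) :
  measurable_fun setT f -> measurable_fun setT (fun x => invmx (f x)).
Proof.
move=> mf; apply/measurable_fun_mxP => i j.
have -> : (fun x => invmx (f x) i j) = (fun x => if \det (f x) == 0 then f x i j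
    else (\det (f x))^-1 * \adj (f x) i j).
  apply/funext => x; rewrite /invmx unitmxE unitfE.
  by case: eqP => //= _; rewrite mxE.
have mdet := measurable_det mf.
apply: measurable_fun_if => //.
- by apply: measurable_fun_eqr => //; exact: measurable_cst.
- by apply: measurable_funTS; exact: measurable_mx_entry.
- apply: measurable_funTS; apply: measurable_funM; first exact: measurable_inv.
  under eq_fun do rewrite mxE.
  rewrite /cofactor; apply: measurable_funM => //.
  apply: measurable_det; apply/measurable_fun_mxP => k l.
  by under eq_fun do rewrite !mxE; exact: measurable_mx_entry.
Qed.

End measurable_mx.

Lemma measurable_bool_set d (T : measurableType d) (b : T -> bool) :
  measurable_fun setT b -> measurable [set x | b x].
Proof. by move=> /(_ measurableT [set true]); rewrite setTI; exact. Qed.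

Definition is_spd {R : realType} m (S : 'M[R]_m) : Prop :=
  S^T = S /\ forall x : 'cV[R]_m, x != 0 -> 0 < (x^T *m S *m x) 0 0.

Record spd (R : realType) (m : nat) :=
  SPD { spd_mx :> 'M[R]_m; spd_mxP : is_spd spd_mx }.

Section spd_type.
Context {R : realType} (m : nat).

Lemma is_spd1 : is_spd (1%:M : 'M[R]_m).
Proof.
split=> [|x x0]; first exact: trmx1.
rewrite mulmx1 mxE; under eq_bigr do rewrite mxE -expr2.
rewrite lt_def sumr_ge0 ?andbT// => [|i _]; last exact: sqr_ge0.
apply: contra_neq x0 => /eqP; rewrite psumr_eq0 => [/allP h|i _]; last first.
  exact: sqr_ge0.
apply/matrixP => i j; rewrite (ord1 j) mxE.
by apply/eqP; rewrite -sqrf_eq0; apply: h; rewrite mem_index_enum.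
Qed.

Lemma spd_mx_inj : injective (@spd_mx R m).
Proof.
by move=> [S pS] [S' pS'] /= SS'; subst S'; congr SPD; exact: Prop_irrelevance.
Qed.

HB.instance Definition _ := gen_eqMixin (spd R m).
HB.instance Definition _ := gen_choiceMixin (spd R m).
HB.instance Definition _ := isPointed.Build (spd R m) (SPD is_spd1).

Let E := g_sigma_algebra_preimageType (@spd_mx R m).

HB.instance Definition _ :=
  @isMeasurable.Build (preimage_display (@spd_mx R m)) (spd R m)
    (g_sigma_algebra_preimage (@spd_mx R m))
    (@measurable0 _ E) (@measurableC _ E) (@bigcupT_measurable _ E).

Lemma measurable_spd_mx : measurable_fun setT (@spd_mx R m).
Proof. by move=> _ Y mY; exists Y. Qed.

Let quad (x : 'cV[R]_m) (S : 'M[R]_m) := (x^T *m S *m x) 0 0.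

Let quad_continuous S : continuous (quad ^~ S).
Proof.
rewrite (_ : quad ^~ S = \sum_j \sum_i
    (fun x : 'cV[R]_m => x i 0 * S i j * x j 0)); last first.
  apply/funext => x; rewrite /quad mxE fct_sumE; apply: eq_bigr => j _.
  rewrite mxE fct_sumE mulr_suml; apply: eq_bigr => i _.
  by rewrite mxE.
have cD (f g : 'cV[R]_m -> R) : continuous f -> continuous g ->
    continuous (f + g).
  move=> cf cg x; exact (@continuousD _ _ _ f g x (cf x) (cg x)).
have c0 : continuous (0 : 'cV[R]_m -> R) by exact: (@cst_continuous _ _ (0 : R)).
apply: (big_ind (fun f : 'cV[R]_m -> R => continuous f)) => // j _.
apply: (big_ind (fun f : 'cV[R]_m -> R => continuous f)) => // i _ x.
apply: (@continuousM _ _ (fun x : 'cV[R]_m => x i 0 * S i j) (fun x => x j 0)).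
  apply: (@continuousM _ _ (fun x : 'cV[R]_m => x i 0) (fun=> S i j)).
    exact: coord_continuous.
  exact: cst_continuous.
exact: coord_continuous.
Qed.

Let psd_det_neq0_spd S : S^T = S -> (forall x, 0 <= quad x S) ->
  \det S != 0 -> is_spd S.
Proof.
move=> St Sp Sd; split => // x x0.
rewrite lt_def (Sp x) andbT; apply: contra_neqN x0 => /eqP; rewrite -/(quad x S).
move=> qx0.
pose y := S *m x.
have yE : \sum_i y i 0 ^+ 2 = (y^T *m S *m x) 0 0.
  rewrite -mulmxA -/y mxE.
  by apply: eq_bigr => i _; rewrite [y^T _ _]mxE expr2.
have qE t : quad (x + t *: y) S =
    2 * t * (\sum_i y i 0 ^+ 2) + t ^+ 2 * quad y S.
  have yxE : (x^T *m S *m y) 0 0 = \sum_i y i 0 ^+ 2.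
    rewrite yE -[in LHS](trmxK (x^T *m S *m y)) mxE !trmx_mul trmxK St.
    by rewrite mulmxA.
  have eD (A B : 'M[R]_1) : (A + B) 0 0 = A 0 0 + B 0 0 by rewrite mxE.
  have eZ a (A : 'M[R]_1) : (a *: A) 0 0 = a * A 0 0 by rewrite mxE.
  rewrite /quad (_ : (x + t *: y)^T = x^T + t *: y^T); last first.
    by rewrite linearD linearZ.
  rewrite !mulmxDl !mulmxDr -!scalemxAl -!scalemxAr !eD !eZ -yE yxE.
  by rewrite -!/(quad _ S) qx0; ring.
have b0 : 0 <= \sum_i y i 0 ^+ 2 by apply: sumr_ge0 => i _; exact: sqr_ge0.
move: b0; rewrite le_eqVlt => /orP[/eqP/esym/eqP|b0].
  rewrite psumr_eq0 => [/allP y0|i _]; last exact: sqr_ge0.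
  have {}y0 : S *m x = 0.
    apply/matrixP => i j; rewrite (ord1 j) [RHS]mxE; apply/eqP.
    by rewrite -sqrf_eq0; apply: y0; rewrite mem_index_enum.
  have Su : S \in unitmx by rewrite unitmxE unitfE.
  by rewrite -(mulKmx Su x) y0 mulmx0.
exfalso; move: b0; set b := \sum_i _ => b0.
have c1 : 0 < quad y S + 1 by rewrite ltr_wpDl.
have := Sp (x + (- b / (quad y S + 1)) *: y); rewrite qE -/b.
have -> : 2 * (- b / (quad y S + 1)) * b + (- b / (quad y S + 1)) ^+ 2 * quad y S =
    - (b ^+ 2 * (quad y S + 2) / (quad y S + 1) ^+ 2).
  by field; rewrite gt_eqF.
rewrite oppr_ge0 leNgt => /negP; apply.
by rewrite divr_gt0 ?exprn_gt0// mulr_gt0 ?exprn_gt0// ltr_wpDl.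
Qed.

Lemma measurable_is_spd : measurable [set S : 'M[R]_m | is_spd S].
Proof.
have mid : measurable_fun setT (@id 'M[R]_m) by exact: measurable_id.
have mquad x : measurable_fun setT (quad x).
  apply: measurable_mx_entry; apply: measurable_mulmx; last exact: measurable_cst.
  by apply: measurable_mulmx => //; exact: measurable_cst.
have -> : [set S : 'M[R]_m | is_spd S] =
    [set S : 'M[R]_m | S^T = S] `&`
    (\bigcap_(x in [set: 'cV[rat]_m]) [set S | 0 <= quad (map_mx ratr x) S]) `&`
    [set S | \det S != 0].
  apply/seteqP; split=> [S [St Sp]|S [[St Sq] Sd]].
    split; first split => //.
      move=> x _ /=; have [->|x0] := eqVneq (map_mx ratr x : 'cV[R]_m) 0.
        by rewrite /quad trmx0 !mul0mx mxE.
      exact/ltW/Sp.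
    apply/negP => /det0P[v v0 vS0].
    have := Sp v^T; rewrite trmxK vS0 mul0mx mxE ltxx trmx_eq0 => /(_ v0).
    by [].
  apply: psd_det_neq0_spd => // x; rewrite leNgt; apply/negP => qx.
  have [q /=] : exists q : 'cV[rat]_m, [set y | quad y S < 0] (map_mx ratr q).
    apply: (@dense_rat_mx _ _ _ x).
    have /(_ [set z | z < 0]) := @quad_continuous S x; apply.
    exact: lt_nbhsl.
  by rewrite ltNge => /negP; apply; exact: Sq.
apply: measurableI; first apply: measurableI.
- rewrite [X in measurable X](_ : _ = \bigcap_(i in [set: 'I_m]) \bigcap_(j in [set: 'I_m])
      [set S : 'M[R]_m | S j i == S i j]); last first.
    apply/seteqP; split=> [S St i _ j _ /=|S h].
      by move: St => /= /matrixP/(_ i j); rewrite mxE => ->.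
    by apply/matrixP => i j; rewrite mxE; apply/eqP; exact: h.
  apply: fin_bigcap_measurable => // i _; apply: fin_bigcap_measurable => // j _.
  apply: measurable_bool_set.
  exact: (measurable_fun_eqr (measurable_coord j i) (measurable_coord i j)).
- rewrite -[X in measurable X]setCK setC_bigcap; apply: measurableC.
  rewrite bigcup_mkcond; apply: countable_bigcupT_measurable => // x.
  rewrite in_setT; apply: measurableC; apply: measurable_bool_set.
  by apply: measurable_fun_ler => //; exact: measurable_cst.
- apply: measurable_bool_set; apply: measurable_neg.
  apply: measurable_fun_eqr; first exact: measurable_det.
  exact: measurable_cst.
Qed.

End spd_type.

Section lebesgue_spd.
Context {R : realType} (m : nat).

(* Restriction of lebesgue_sym to the cone of SPD matrices. *)
Definition lebesgue_spd (B : set (spd R m)) : \bar R :=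
  lebesgue_sym m ((@spd_mx R m) @` B).

Lemma measurable_image_spd (B : set (spd R m)) :
  measurable B -> measurable ((@spd_mx R m) @` B).
Proof.
move=> [C mC <-]; rewrite setTI.
have -> : (@spd_mx R m) @` ((@spd_mx R m) @^-1` C) = C `&` [set S | is_spd S].
  apply/seteqP; split=> [_ [S CS <-]|S [CS pS]]; first by split=> //; exact: spd_mxP.
  by exists (SPD pS).
by apply: measurableI => //; exact: measurable_is_spd.
Qed.

Let lebesgue_spd0 : lebesgue_spd set0 = 0%E.
Proof. by rewrite /lebesgue_spd image_set0 measure0. Qed.

Let lebesgue_spd_ge0 B : (0 <= lebesgue_spd B)%E.
Proof. exact: measure_ge0. Qed.

Let lebesgue_spd_sigma_additive : semi_sigma_additive lebesgue_spd.
Proof.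
move=> F mF tF mUF; rewrite /lebesgue_spd image_bigcup.
apply: measure_semi_sigma_additive.
- by move=> k; exact: measurable_image_spd.
- apply/trivIsetP => i j _ _ ij.
  rewrite -subset0 => _ [[a Fa <-] [b Fb /spd_mx_inj ba]].
  move/trivIsetP : tF => /(_ _ _ I I ij); rewrite -subset0; apply.
  by split; [exact: Fa|rewrite -ba].
- by rewrite -image_bigcup; exact: measurable_image_spd.
Qed.

HB.instance Definition _ := isMeasure.Build _ _ _ lebesgue_spd
  lebesgue_spd0 lebesgue_spd_ge0 lebesgue_spd_sigma_additive.

Let lebesgue_spd_sigma_finite : sigma_finite setT lebesgue_spd.
Proof.
have [F TF mF] := sigma_finiteT (@lebesgue_sym R m).
exists (fun i => (@spd_mx R m) @^-1` F i); first by rewrite -preimage_bigcup -TF.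
move=> i; have [mFi Fioo] := mF i.
have mpF : measurable ((@spd_mx R m) @^-1` F i).
  by rewrite -[X in measurable X]setTI; exact: measurable_spd_mx.
split => //; apply: le_lt_trans Fioo; apply: le_measure; rewrite ?inE//.
  exact: measurable_image_spd.
exact: image_preimage_subset.
Qed.

HB.instance Definition _ :=
  Measure_isSigmaFinite.Build _ _ _ lebesgue_spd lebesgue_spd_sigma_finite.

End lebesgue_spd.
Arguments lebesgue_spd {R} m.

Section density_kernel.
Context d d' (X : measurableType d) (Y : measurableType d') (R : realType).
Variables (mu : {sigma_finite_measure set Y -> \bar R}) (f : X * Y -> R).

Definition density_kernel (mf : measurable_fun setT f) (f0 : forall z, 0 <= f z)
  (x : X) (B : set Y) : \bar R := (\int[mu]_(y in B) (f (x, y))%:E)%E.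

Variables (mf : measurable_fun setT f) (f0 : forall z, 0 <= f z).
Local Notation k := (density_kernel mf f0).

Let mfx x : measurable_fun setT (fun y => (f (x, y))%:E).
Proof. by apply/measurable_EFinP; exact: measurableT_comp. Qed.

Let k0 x : k x set0 = 0%E. Proof. exact: integral_set0. Qed.

Let k_ge0 x B : (0 <= k x B)%E.
Proof. by apply: integral_ge0 => y _; rewrite lee_fin. Qed.

Let k_sigma_additive x : semi_sigma_additive (k x).
Proof.
by apply: semi_sigma_additive_nng_induced => // y; rewrite lee_fin.
Qed.

HB.instance Definition _ x :=
  isMeasure.Build _ _ _ (k x) (k0 x) (k_ge0 x) (@k_sigma_additive x).

Definition mdensity_kernel : X -> {measure set Y -> \bar R} := k.

Let measurable_k U : measurable U -> measurable_fun setT (mdensity_kernel ^~ U).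
Proof.
move=> mU; rewrite /mdensity_kernel/= /density_kernel.
under eq_fun do rewrite integral_mkcond.
apply: (@measurable_fun_fubini_tonelli_F _ _ _ _ _ mu
  (fun z => (EFin \o (fun y => f (z.1, y))) \_ U z.2)).
  rewrite (_ : (fun z => _) = (fun z => ((f z)%:E * (\1_U z.2)%:E)%E)).
    apply: emeasurable_funM; first exact/measurable_EFinP.
    by apply/measurable_EFinP; apply: measurableT_comp => //.
  apply/funext => -[x y]/=; rewrite patchE indicE.
  by case: ifPn => _; rewrite ?mule1 ?mule0.
by move=> [x y]; rewrite /= patchE; case: ifPn => //; rewrite lee_fin.
Qed.

HB.instance Definition _ :=
  isKernel.Build _ _ _ _ _ mdensity_kernel measurable_k.

(* mnormalize needs a default probability for the case where the total mass is 0
   or +oo; the Dirac mass at point is that default. *)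
Definition full_conditional : R.-pker X ~> Y :=
  knormalize mdensity_kernel \d_point.

End density_kernel.

Section precomp_kernel.
Context d0 d1 d2 (T0 : measurableType d0) (T1 : measurableType d1)
  (T2 : measurableType d2) (R : realType).
Variables (k : R.-pker T1 ~> T2) (g : T0 -> T1).

Definition precomp_kernel (mg : measurable_fun setT g) :
  T0 -> {measure set T2 -> \bar R} := k \o g.

Variable mg : measurable_fun setT g.

Let measurable_precomp U :
  measurable U -> measurable_fun setT (precomp_kernel mg ^~ U).
Proof. by move=> mU; exact: (measurableT_comp (measurable_kernel k _ mU) mg). Qed.

HB.instance Definition _ :=
  isKernel.Build _ _ _ _ _ (precomp_kernel mg) measurable_precomp.

Let precomp_prob x : precomp_kernel mg x setT = 1%E.
Proof. exact: prob_kernel. Qed.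

HB.instance Definition _ :=
  Kernel_isProbability.Build _ _ _ _ _ (precomp_kernel mg) precomp_prob.

End precomp_kernel.

Definition qform {R : realType} d (C : 'M[R]_d) (v : 'cV[R]_d) : R :=
  (v^T *m C *m v) 0 0.

Definition gaussian_pdf {R : realType} d (mu : 'cV[R]_d) (C : 'M[R]_d)
    (x : 'cV[R]_d) : R :=
  (Num.sqrt ((2 * pi) ^+ d * \det C))^-1 *
  expR (- 2^-1 * qform (invmx C) (x - mu)).

Definition inverse_wishart_unnormalized {R : realType} m (nu : nat) (Psi : 'M[R]_m)
    (S : 'M[R]_m) : R :=
  (\det S) `^ (- (nu + m + 1)%:R / 2) *
  expR (- 2^-1 * \tr (invmx S *m Psi)).

Definition inverse_wishart_pdf {R : realType} m (nu : nat) (Psi : 'M[R]_m)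
    (S : spd R m) : R :=
  inverse_wishart_unnormalized nu Psi S /
  fine (\int[@lebesgue_spd R m]_S'
    (inverse_wishart_unnormalized nu Psi S')%:E)%E.

(* vec stacks the columns, i.e. reads the transpose in row-major order, which is
   what mxvec does. *)
Definition vec {R : realType} a b (M : 'M[R]_(a, b)) : 'cV[R]_(b * a) :=
  (mxvec M^T)^T.

Definition unvec {R : realType} a b (v : 'cV[R]_(b * a)) : 'M[R]_(a, b) :=
  (vec_mx v^T)^T.

Lemma vecK {R : realType} a b : cancel (@vec R a b) (@unvec R a b).
Proof. by move=> M; rewrite /unvec /vec trmxK mxvecK trmxK. Qed.

Lemma unvecK {R : realType} a b : cancel (@unvec R a b) (@vec R a b).
Proof. by move=> v; rewrite /unvec /vec trmxK vec_mxK trmxK. Qed.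

Section measurable_pdf.
Context d (T : measurableType d) (R : realType).

Lemma measurable_qform k (C : T -> 'M[R]_k) (v : T -> 'cV[R]_k) :
  measurable_fun setT C -> measurable_fun setT v ->
  measurable_fun setT (fun t => qform (C t) (v t)).
Proof.
move=> mC mv; apply: measurable_mx_entry; apply: measurable_mulmx => //.
by apply: measurable_mulmx => //; exact: measurable_trmx.
Qed.

Lemma measurable_gaussian_pdf k (mu : T -> 'cV[R]_k) (C : T -> 'M[R]_k)
    (x : T -> 'cV[R]_k) :
  measurable_fun setT mu -> measurable_fun setT C -> measurable_fun setT x ->
  measurable_fun setT (fun t => gaussian_pdf (mu t) (C t) (x t)).
Proof.
move=> mmu mC mx; apply: measurable_funM.
  apply: measurable_inv; apply: measurableT_comp.
    by apply: continuous_measurable_fun; exact: sqrt_continuous.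
  by apply: measurable_funM => //; exact: measurable_det.
apply: measurableT_comp => //; apply: measurable_funM => //.
apply: measurable_qform; first exact: measurable_invmx.
exact: measurable_submx.
Qed.

Lemma measurable_inverse_wishart_pdf m nu (Psi : 'M[R]_m) (S : T -> spd R m) :
  measurable_fun setT S ->
  measurable_fun setT (fun t => inverse_wishart_pdf nu Psi (S t)).
Proof.
move=> mS; have mS' : measurable_fun setT (fun t => spd_mx (S t)).
  by apply: measurableT_comp => //; exact: measurable_spd_mx.
apply: measurable_funM => //; apply: measurable_funM.
  apply: (@measurableT_comp _ _ _ _ _ _ (@powR R ^~ _)).
    exact: measurable_powR.
  exact: measurable_det.
apply: measurableT_comp => //; apply: measurable_funM => //.
apply: measurable_mxtrace; apply: measurable_mulmx => //.
exact: measurable_invmx.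
Qed.

Lemma measurable_unvec a b (v : T -> 'cV[R]_(b * a)) :
  measurable_fun setT v -> measurable_fun setT (fun t => unvec (v t)).
Proof.
by move=> mv; apply: measurable_trmx; apply: measurable_vec_mx; exact: measurable_trmx.
Qed.

End measurable_pdf.

Lemma gaussian_pdf_ge0 (R : realType) k (mu : 'cV[R]_k) C x :
  0 <= gaussian_pdf mu C x.
Proof. by rewrite mulr_ge0 ?invr_ge0 ?sqrtr_ge0 ?expR_ge0. Qed.

Lemma inverse_wishart_pdf_ge0 (R : realType) m nu (Psi : 'M[R]_m) S :
  0 <= inverse_wishart_pdf nu Psi S.
Proof.
rewrite mulr_ge0 ?invr_ge0 ?mulr_ge0 ?powR_ge0 ?expR_ge0// fine_ge0//.
by apply: integral_ge0 => S' _; rewrite lee_fin mulr_ge0 ?powR_ge0 ?expR_ge0.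
Qed.

(* Features Z_i, error covariances V_i, prior parameters (k_i, K_i), (a0, B0) and
   (j0, J0), and the observed data y_i, x_i. *)
Record eiv_model (R : realType) (m n p q : nat) := EIVModel {
  eivZ : 'I_n -> 'cV[R]_q ;
  eivV : 'I_n -> spd R p ;
  eivk : 'I_n -> 'cV[R]_p ;
  eivK : 'I_n -> spd R p ;
  eiva0 : nat ;
  eivB0 : spd R m ;
  eivj0 : 'cV[R]_(m * q + m * p) ;
  eivJ0 : spd R (m * q + m * p) ;
  eivy : 'I_n -> 'cV[R]_m ;
  eivx : 'I_n -> 'cV[R]_p }.

Section eiv.
Context {R : realType} {m n p q : nat} (M : eiv_model R m n p q).

Local Notation Z := (eivZ M).
Local Notation V := (eivV M).
Local Notation k := (eivk M).
Local Notation K := (eivK M).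
Local Notation a0 := (eiva0 M).
Local Notation B0 := (eivB0 M).
Local Notation j0 := (eivj0 M).
Local Notation J0 := (eivJ0 M).
Local Notation y := (eivy M).
Local Notation x := (eivx M).

Local Notation matA := 'M[R]_(n, p).
Local Notation coef := ('cV[R]_(m * q) * 'cV[R]_(m * p))%type.
Local Notation state := ('M[R]_(n, p) * coef * spd R m)%type.

(* A state is (A, (theta, beta), Sigma), with theta = vec Theta, beta = vec B and
   the latent vector A_i (as a column) the transpose of the i-th row of A. *)
Definition latent (A : matA) (i : 'I_n) : 'cV[R]_p := (row i A)^T.

Definition regression_mean (A : matA) (b : coef) (i : 'I_n) : 'cV[R]_m :=
  (unvec b.1)^T *m Z i + (unvec b.2)^T *m latent A i.

(* Joint density of the data (y, x) and the parameters: likelihood times priors.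
   Theta and B are unvec b.1 and unvec b.2. *)
Definition joint_density (s : state) : R :=
  let: (A, b, Sg) := s in
  (\prod_(i < n) (gaussian_pdf (regression_mean A b i) Sg (y i) *
                  gaussian_pdf (latent A i) (V i) (x i) *
                  gaussian_pdf (k i) (K i) (latent A i))) *
  inverse_wishart_pdf a0 B0 Sg *
  gaussian_pdf j0 J0 (col_mx b.1 b.2).

Definition lebesgue_coef : {sigma_finite_measure set coef -> \bar R} :=
  prod_measure (lebesgue_mx (m * q) 1) (lebesgue_mx (m * p) 1).

Definition lebesgue_state : {sigma_finite_measure set state -> \bar R} :=
  prod_measure (prod_measure (lebesgue_mx n p) lebesgue_coef) (lebesgue_spd m).

Definition posterior_density (s : state) : R :=
  joint_density s / fine (\int[lebesgue_state]_u (joint_density u)%:E)%E.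

Definition posterior (B : set state) : \bar R :=
  (\int[lebesgue_state]_(s in B) (posterior_density s)%:E)%E.

(* This is k'_i. *)
Definition shrunk_mean (i : 'I_n) : 'cV[R]_p :=
  invmx (invmx (V i) + invmx (K i)) *m
  (invmx (V i) *m x i + invmx (K i) *m k i).

Definition posterior_formula (s : state) : R :=
  let: (A, b, Sg) := s in
  (\det Sg) `^ (- (n + a0 + m + 1)%:R / 2) *
  expR (- 2^-1 * \tr (invmx Sg *m B0)
        - 2^-1 * \sum_(i < n) qform (invmx Sg) (y i - regression_mean A b i)) *
  expR (- 2^-1 * \sum_(i < n)
            qform (invmx (V i) + invmx (K i)) (latent A i - shrunk_mean i)
        - 2^-1 * qform (invmx J0) (col_mx b.1 b.2 - j0)).

Lemma posterior_density_ge0 s : 0 <= posterior_density s.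
Proof.
have h u : 0 <= joint_density u.
  case: u => -[A b] Sg; apply: mulr_ge0; last exact: gaussian_pdf_ge0.
  apply: mulr_ge0; last exact: inverse_wishart_pdf_ge0.
  apply: prodr_ge0 => i _.
  by apply: mulr_ge0; [apply: mulr_ge0|]; exact: gaussian_pdf_ge0.
rewrite mulr_ge0// invr_ge0 fine_ge0// integral_ge0// => u _.
by rewrite lee_fin.
Qed.

Lemma measurable_posterior_density : measurable_fun setT posterior_density.
Proof.
apply: measurable_funM => //.
have mA : measurable_fun [set: state] (fun s => s.1.1) by exact: measurableT_comp.
have mb1 : measurable_fun [set: state] (fun s => s.1.2.1).
  by apply: measurableT_comp => //; exact: measurableT_comp.
have mb2 : measurable_fun [set: state] (fun s => s.1.2.2).
  by apply: measurableT_comp => //; exact: measurableT_comp.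
have mS : measurable_fun [set: state] (fun s => spd_mx s.2).
  by apply: measurableT_comp => //; exact: measurable_spd_mx.
have ml i : measurable_fun [set: state] (fun s => latent s.1.1 i).
  by apply: measurable_trmx; exact: measurable_row.
rewrite (_ : joint_density = fun s : state =>
  (\prod_(i < n) (gaussian_pdf (regression_mean s.1.1 s.1.2 i) s.2 (y i) *
                  gaussian_pdf (latent s.1.1 i) (V i) (x i) *
                  gaussian_pdf (k i) (K i) (latent s.1.1 i))) *
  inverse_wishart_pdf a0 B0 s.2 *
  gaussian_pdf j0 J0 (col_mx s.1.2.1 s.1.2.2)); last first.
  by apply/funext => -[[A b] Sg].
apply: measurable_funM; first apply: measurable_funM.
- apply: measurable_prod => i _; apply: measurable_funM; first apply: measurable_funM.
  + apply: measurable_gaussian_pdf => //.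
    apply: measurable_addmx; apply: measurable_mulmx => //;
      by apply: measurable_trmx; exact: measurable_unvec.
  + exact: measurable_gaussian_pdf.
  + exact: measurable_gaussian_pdf.
- exact: measurable_inverse_wishart_pdf.
- by apply: measurable_gaussian_pdf => //; exact: measurable_col_mx.
Qed.

Let mpi d (T : measurableType d) (A : T -> matA) (b : T -> coef) (S : T -> spd R m) :
  measurable_fun setT A -> measurable_fun setT b -> measurable_fun setT S ->
  measurable_fun setT (fun t => posterior_density (A t, b t, S t)).
Proof.
move=> mA mb mS; apply: (measurableT_comp measurable_posterior_density).
by apply: measurable_fun_pair => //; exact: measurable_fun_pair.
Qed.

Let mpi_Sigma : measurable_fun setT
  (fun z : (matA * coef) * spd R m => posterior_density (z.1.1, z.1.2, z.2)).
Proof. by apply: mpi => //; exact: measurableT_comp. Qed.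

Let mpi_coef : measurable_fun setT
  (fun z : (matA * spd R m) * coef => posterior_density (z.1.1, z.2, z.1.2)).
Proof. by apply: mpi => //; exact: measurableT_comp. Qed.

Let mpi_A : measurable_fun setT
  (fun z : (coef * spd R m) * matA => posterior_density (z.2, z.1.1, z.1.2)).
Proof. by apply: mpi => //; exact: measurableT_comp. Qed.

Definition conditional_Sigma : R.-pker matA * coef ~> spd R m :=
  full_conditional (lebesgue_spd m) mpi_Sigma (fun=> posterior_density_ge0 _).

Definition conditional_coef : R.-pker matA * spd R m ~> coef :=
  full_conditional lebesgue_coef mpi_coef (fun=> posterior_density_ge0 _).

Definition conditional_A : R.-pker coef * spd R m ~> matA :=
  full_conditional (lebesgue_mx n p) mpi_A (fun=> posterior_density_ge0 _).

Let mSigma : measurable_fun [set: state] (fun s => s.1).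
Proof. exact: measurable_fst. Qed.

Let mcoef : measurable_fun [set: state * spd R m] (fun z => (z.1.1.1, z.2)).
Proof.
apply: measurable_fun_pair => //; apply: measurableT_comp => //.
exact: measurableT_comp.
Qed.

Let mmatA : measurable_fun [set: state * spd R m * coef] (fun z => (z.2, z.1.2)).
Proof. by apply: measurable_fun_pair => //; exact: measurableT_comp. Qed.

Let mnew : measurable_fun [set: state * spd R m * coef * matA]
  (fun z => (z.2, z.1.2, z.1.1.2) : state).
Proof.
apply: measurable_fun_pair; first by apply: measurable_fun_pair => //; exact: measurableT_comp.
by apply: measurableT_comp => //; exact: measurableT_comp.
Qed.

(* One sweep: Sigma given (A, b), then b given (A, new Sigma), then A given
   (new b, new Sigma); gibbs_kernelE spells it out. *)
Definition gibbs_kernel : state -> {measure set state -> \bar R} :=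
  (precomp_kernel conditional_Sigma mSigma \;
    (precomp_kernel conditional_coef mcoef \;
      (precomp_kernel conditional_A mmatA \; kdirac mnew)))%E.

Lemma gibbs_kernelE A b S B : measurable B ->
  gibbs_kernel (A, b, S) B =
  (\int[conditional_Sigma (A, b)]_S'
     \int[conditional_coef (A, S')]_b'
       conditional_A (b', S') [set A' | B (A', b', S')])%E.
Proof.
move=> mB; rewrite /gibbs_kernel/= /kcomp; apply: eq_integral => S' _.
rewrite /= /kcomp; apply: eq_integral => b' _.
rewrite /= /kcomp/= /precomp_kernel/=.
have mB' : measurable [set A' | B (A', b', S')].
  rewrite -[X in measurable X]setTI; apply: (_ : measurable_fun setT (fun A' => (A', b', S'))) => //.
  by apply: measurable_fun_pair => //; exact: measurable_fun_pair.
transitivity (\int[conditional_A (b', S')]_A' (\1_[set A' | B (A', b', S')] A')%:E)%E.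
  by [].
by rewrite integral_indic// setIT.
Qed.

End eiv.

Section ergodicity.
Context d (T : measurableType d) (R : realType).

(* The t-step kernel P^t, with P^0 s the Dirac mass at s. *)
Fixpoint kernel_iter (P : T -> {measure set T -> \bar R}) (t : nat) (s : T)
    (B : set T) : \bar R :=
  if t is t'.+1 then (\int[P s]_u kernel_iter P t' u B)%E else \d_s B.

Definition geometrically_ergodic (P : T -> {measure set T -> \bar R})
    (Pi : set T -> \bar R) : Prop :=
  exists (rho : R) (M : T -> R),
    [/\ 0 < rho < 1, (forall s, 0 <= M s) &
      forall s t, (1 <= t)%N ->
        (ereal_sup [set `| kernel_iter P t s B - Pi B | | B in measurable]
          <= (M s * rho ^+ t)%:E)%E].

End ergodicity.

(* Main.v *)
From HB Require Import structures.
From mathcomp Require Import all_boot all_order all_algebra.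
From mathcomp Require Import all_classical all_reals all_analysis.
From mathcomp Require Import measurable_realfun ring lra.
Require Import Defs.

Set Implicit Arguments.
Unset Strict Implicit.
Unset Printing Implicit Defensive.

Import Order.TTheory GRing.Theory Num.Theory.
Import numFieldNormedType.Exports.

Local Open Scope classical_set_scope.
Local Open Scope ring_scope.

(* The sampler satisfies a Doeblin condition in two sweeps, hence it is uniformly
   ergodic.  Whatever the current state, the scale matrix
   B_0 + sum_i r_i r_i^T, r_i the residuals, of the inverse-Wishart conditional dominates B_0,
   so with probability at least 1/2 the new Sigma has tr(Sigma^-1) below a universal
   constant; on that event the Gaussian conditional of (theta, beta), and then that of
   A, each puts mass at least 1/2 on a fixed ball, because its log-density is
   controlled at the origin and decreases at least like a fixed quadratic form.  From
   (A, theta, beta) in these balls the product of the three conditional densities is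
   bounded below by an explicit positive function of the new state.  The conditional
   tails are obtained from dilations: doubling Sigma or halving the Gaussian blocks
   raises the densities by factors exponential in
   tr(Sigma^-1) and in the squared norms.  Integrability of the inverse-Wishart
   density is proved by induction on m through Schur complements. *)

(** The lower bound on the conditional densities degrades with the residuals at the current
    [(A, theta, beta)]; the first of the two sweeps serves only to bring these variables into a
    fixed set. A sweep forgets the current [Sigma], which it redraws first. The scan order makes the
    tail bounds uniform. At [theta = beta = 0] the residuals are the data [y_i] whatever [A] is, so
    the coefficients are controlled with no bound on [A]; at [A = 0] the residuals still involve
    [theta], but by then the coefficients are confined. Conditional means and covariances are never
    computed. Normalizing constants are bounded above, uniformly in the conditioning variables, by
    discarding the nonnegative residual term, and every density is handled up to a factor that
    cancels in the conditional. Traces and Frobenius norms stand in for eigenvalues, by way of a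
    factorization [P = L L^T]. *)

Definition norm2 {R : realType} d (v : 'cV[R]_d) : R := \sum_i v i 0 ^+ 2.

(** * Quadratic forms and symmetric positive definite matrices *)

Section spd_algebra.
Context {R : realType}.

Lemma norm2_ge0 d (v : 'cV[R]_d) : 0 <= norm2 v.
Proof. by apply: sumr_ge0 => i _; exact: sqr_ge0. Qed.

Lemma norm2E d (v : 'cV[R]_d) : norm2 v = (v^T *m v) 0 0.
Proof. by rewrite mxE; apply: eq_bigr => i _; rewrite mxE expr2. Qed.

Lemma qformD d (P Q : 'M[R]_d) v : qform (P + Q) v = qform P v + qform Q v.
Proof. by rewrite /qform mulmxDr mulmxDl mxE. Qed.

Lemma qformZ d a (P : 'M[R]_d) v : qform (a *: P) v = a * qform P v.
Proof. by rewrite /qform -scalemxAr -scalemxAl mxE. Qed.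

Lemma qformZv d a (P : 'M[R]_d) (v : 'cV[R]_d) : qform P (a *: v) = a ^+ 2 * qform P v.
Proof.
rewrite /qform; have -> : (a *: v)^T = a *: v^T by apply/matrixP => i j; rewrite !mxE.
by rewrite -!scalemxAl -scalemxAr !mxE mulrA expr2.
Qed.

Lemma qform0 d (P : 'M[R]_d) : qform P 0 = 0.
Proof. by rewrite /qform mulmx0 mxE. Qed.

Lemma qformN d (P : 'M[R]_d) v : qform P (- v) = qform P v.
Proof. by rewrite -scaleN1r qformZv sqrrN expr1n mul1r. Qed.

Lemma trmx_bil d (P : 'M[R]_d) (u v : 'cV[R]_d) : P^T = P ->
  (u^T *m P *m v) 0 0 = (v^T *m P *m u) 0 0.
Proof.
move=> Pt; rewrite -[in LHS](trmxK (u^T *m P *m v)) mxE !trmx_mul trmxK Pt.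
by rewrite mulmxA.
Qed.

Lemma qformDv d (P : 'M[R]_d) (u v : 'cV[R]_d) : P^T = P ->
  qform P (u + v) = qform P u + 2 * (u^T *m P *m v) 0 0 + qform P v.
Proof.
move=> Pt; rewrite /qform.
have -> : (u + v)^T = u^T + v^T by apply/matrixP => i j; rewrite !mxE.
rewrite !mulmxDl !mulmxDr [in LHS]mxE.
rewrite [X in X + _ = _]mxE [X in _ + X = _]mxE (trmx_bil v u Pt); ring.
Qed.

Lemma qform_mulmx d e (L : 'M[R]_(d, e)) v : qform (L *m L^T) v = norm2 (L^T *m v).
Proof. by rewrite norm2E trmx_mul trmxK /qform !mulmxA. Qed.

Lemma spd_qform_ge0 d (P : 'M[R]_d) v : is_spd P -> 0 <= qform P v.
Proof.
by move=> [_ Pp]; have [->|/Pp/ltW//] := eqVneq v 0; rewrite qform0.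
Qed.

Lemma spd_unit d (P : 'M[R]_d) : is_spd P -> P \in unitmx.
Proof.
move=> [_ Pp]; rewrite unitmxE unitfE; apply/negP => /det0P[v v0 vP0].
have := Pp v^T; rewrite trmxK vP0 mul0mx mxE ltxx trmx_eq0 => /(_ v0).
by [].
Qed.

Lemma trmx_invmx_sym d (P : 'M[R]_d) : P^T = P -> (invmx P)^T = invmx P.
Proof. by move=> Pt; rewrite trmx_inv Pt. Qed.

Lemma spd_invmx d (P : 'M[R]_d) : is_spd P -> is_spd (invmx P).
Proof.
move=> sP; have [Pt Pp] := sP; have uP := spd_unit sP.
split => [|v v0]; first exact: trmx_invmx_sym.
have := Pp (invmx P *m v); rewrite trmx_mul trmx_invmx_sym// !mulmxA mulmxKV//.
apply.
apply: contra_neq v0 => /(congr1 (mulmx P)); by rewrite mulKVmx// mulmx0.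
Qed.

Lemma spd_add d (P Q : 'M[R]_d) : is_spd P -> is_spd Q -> is_spd (P + Q).
Proof.
move=> [Pt Pp] [Qt Qp]; split => [|v v0]; first by rewrite linearD/= Pt Qt.
by rewrite -/(qform _ _) qformD addr_gt0//; [exact: Pp|exact: Qp].
Qed.

Lemma spd_scale d a (P : 'M[R]_d) : 0 < a -> is_spd P -> is_spd (a *: P).
Proof.
move=> a0 [Pt Pp]; split => [|v v0]; first by rewrite linearZ/= Pt.
by rewrite -/(qform _ _) qformZ mulr_gt0//; exact: Pp.
Qed.

Section schur.
Variables (m : nat) (s : R) (v : 'cV[R]_m) (S : 'M[R]_m).

Definition schur_block : 'M[R]_(1 + m) := block_mx s%:M v^T v S.

Definition schur_complement : 'M[R]_m := S - s^-1 *: (v *m v^T).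

Lemma qform_schur (x : R) (w : 'cV[R]_m) : s != 0 -> S^T = S ->
  qform schur_block (col_mx x%:M w) =
  s * (x + s^-1 * (v^T *m w) 0 0) ^+ 2 + qform schur_complement w.
Proof.
move=> s0 St; rewrite /qform /schur_block tr_col_mx mul_row_block mul_row_col.
rewrite tr_scalar_mx -!mulmxA.
have e11 (A B : 'M[R]_1) : (A *m B) 0 0 = A 0 0 * B 0 0.
  by rewrite mxE big_ord1.
have vw : (w^T *m v) 0 0 = (v^T *m w) 0 0.
  by rewrite !mxE; apply: eq_bigr => i _; rewrite !mxE mulrC.
have eD (A B : 'M[R]_1) : (A + B) 0 0 = A 0 0 + B 0 0 by rewrite mxE.
have eN (A : 'M[R]_1) : (- A) 0 0 = - A 0 0 by rewrite mxE.
have eZ t (A : 'M[R]_1) : (t *: A) 0 0 = t * A 0 0 by rewrite mxE.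
rewrite eD e11 eD e11 vw mulmxDl eD -!mulmxA e11 /schur_complement mulmxBl mulmxBr.
rewrite -scalemxAl -scalemxAr -(mulmxA v) (mulmxA _ v) eD eN eZ e11 vw.
set a := (v^T *m w) 0 0; set b := (w^T *m (S *m w)) 0 0.
rewrite !mxE eqxx !mulr1n.
by field.
Qed.

Lemma schur_block_tr : schur_block^T = schur_block -> S^T = S.
Proof.
by rewrite /schur_block tr_block_mx => /eq_block_mx[_ _ _].
Qed.

Lemma schur_blockP : is_spd schur_block -> 0 < s /\ is_spd schur_complement.
Proof.
move=> [Bt Bp]; have St := schur_block_tr Bt.
have s0 : 0 < s.
  have := Bp (col_mx 1%:M 0); rewrite -/(qform _ _).
  have -> : qform schur_block (col_mx 1%:M 0) = s.
    rewrite /qform /schur_block tr_col_mx mul_row_block mul_row_col.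
    by rewrite trmx0 !mul0mx !mulmx0 !addr0 trmx1 mul1mx mulmx1 mxE eqxx.
  apply; apply/eqP => /matrixP/(_ (lshift _ 0) 0); rewrite col_mxEu !mxE eqxx.
  by move/eqP; rewrite oner_eq0.
split => //; split => [|w w0].
  by rewrite /schur_complement linearB linearZ/= St trmx_mul trmxK.
(* This first coordinate minimizes the form for given [w]: the square vanishes and the Schur
   complement remains. *)
have := Bp (col_mx (- (s^-1 * (v^T *m w) 0 0))%:M w); rewrite -/(qform _ _).
rewrite qform_schur ?gt_eqF// addNr expr0n/= mulr0 add0r; apply.
apply: contra_neq w0 => /matrixP h; apply/matrixP => i j.
by have := h (rshift 1 i) j; rewrite col_mxEd !mxE.
Qed.

(** One step of Gaussian elimination, as a block [L D L^T] factorization. *)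
Let low : 'M[R]_(1 + m) := block_mx 1%:M 0 (s^-1 *: v) 1%:M.
Let D : 'M[R]_(1 + m) := block_mx s%:M 0 0 schur_complement.

Lemma schur_factor : s != 0 -> schur_block = low *m D *m low^T.
Proof.
move=> s0; rewrite /low /D tr_block_mx !mulmx_block.
rewrite !(mul0mx, mulmx0, mul1mx, mulmx1, addr0, add0r, trmx1, trmx0).
rewrite linearZ/= mul_scalar_mx scalerA mulfV// scale1r.
rewrite mul_mx_scalar scalerA mulfV// scale1r /schur_complement -scalemxAr.
by rewrite addrC subrK.
Qed.

Lemma det_schur : s != 0 -> \det schur_block = s * \det schur_complement.
Proof.
move=> s0; rewrite schur_factor// !det_mulmx det_tr /low /D det_lblock det_ublock.
by rewrite !det1 det_scalar1 !mul1r mulr1.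
Qed.

Lemma trace_inv_schur : s != 0 -> schur_complement \in unitmx ->
  \tr (invmx schur_block) =
  s^-1 + (s ^+ 2)^-1 * qform (invmx schur_complement) v + \tr (invmx schur_complement).
Proof.
move=> s0 uC.
pose T := schur_complement; pose W := invmx T.
(* The block inversion formula. Checking that it is a right inverse suffices for a square matrix. *)
pose B : 'M[R]_(1 + m) :=
  block_mx (s^-1%:M + (s ^+ 2)^-1 *: (v^T *m W *m v)) (- s^-1 *: (v^T *m W))
           (- s^-1 *: (W *m v)) W.
have SBu : schur_block *m B = 1%:M.
  have SE : S = T + s^-1 *: (v *m v^T) by rewrite /T /schur_complement subrK.
  have TW : T *m W = 1%:M by rewrite mulmxV.
  rewrite /schur_block /B mulmx_block SE.
  rewrite [RHS](_ : _ = block_mx 1%:M 0 0 1%:M); last by rewrite -scalar_mx_block.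
  congr block_mx.
  - rewrite mulmxDr -scalar_mxM mulfV// mul_scalar_mx scalerA.
    rewrite -scalemxAr mulmxA -addrA -scalerDl.
    by rewrite (_ : _ + - s^-1 = 0) ?scale0r ?addr0//; field.
  - rewrite -scalemxAr mul_scalar_mx scalerA mulNr mulVf// scaleN1r.
    by rewrite addNr.
  - rewrite mulmxDr mulmxDl -!scalemxAr -!scalemxAl mul_mx_scalar.
    rewrite (mulmxA T) TW mul1mx !mulmxA scalerA addrACA -!scalerDl.
    rewrite (_ : _ - s^-1 = 0) ?subrr// scale0r add0r.
    by rewrite (_ : _ + _ = 0) ?scale0r//; field.
  - rewrite mulmxDl TW -scalemxAr -scalemxAl mulmxA scaleNr addrCA addNr addr0//.
have uB : schur_block \in unitmx by case: (mulmx1_unit SBu).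
have -> : invmx schur_block = B.
  by rewrite -[LHS]mulmx1 -SBu mulmxA mulVmx// mul1mx.
rewrite /B mxtrace_block; congr (_ + _).
by rewrite mxtraceD mxtraceZ mxtrace_scalar mulr1n /qform /mxtrace big_ord1.
Qed.

End schur.

Lemma mx_schur m (P : 'M[R]_(1 + m)) : P^T = P ->
  P = schur_block (P 0 0) (dlsubmx P) (drsubmx P).
Proof.
move=> Pt; rewrite /schur_block -[LHS]submxK; congr block_mx.
  by apply/matrixP => i j; rewrite !ord1 !mxE eqxx mulr1n; congr (P _ _); exact/val_inj.
by rewrite trmx_dlsub Pt.
Qed.

(** Cholesky factorization, by recursion on the Schur complement. It replaces the spectral theorem:
    the estimates below use columns of [L] instead of eigenvectors. *)
Lemma spd_factor d (P : 'M[R]_d) : is_spd P ->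
  exists L : 'M[R]_d, P = L *m L^T.
Proof.
elim: d P => [|d IH] P sP; first by exists 0; rewrite [LHS]flatmx0 [RHS]flatmx0.
rewrite -[d.+1]/(1 + d)%N in P sP *.
have [Pt _] := sP.
move: sP; rewrite {1}(mx_schur Pt) => /schur_blockP[s0 /IH[L PL]].
exists (block_mx 1%:M 0 ((P 0 0)^-1 *: dlsubmx P) 1%:M *m
        block_mx (Num.sqrt (P 0 0))%:M 0 0 L).
rewrite [LHS](mx_schur Pt) schur_factor ?gt_eqF// trmx_mul !mulmxA.
congr (_ *m _); rewrite -!mulmxA; congr (_ *m _).
rewrite tr_block_mx mulmx_block !(mul0mx, mulmx0, addr0, add0r, trmx0).
by rewrite tr_scalar_mx -scalar_mxM -expr2 sqr_sqrtr ?ltW// PL.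
Qed.

Lemma spd_det_gt0 d (P : 'M[R]_d) : is_spd P -> 0 < \det P.
Proof.
move=> sP; have := spd_unit sP; have [L PL] := spd_factor sP.
rewrite unitmxE unitfE PL det_mulmx det_tr => h.
by rewrite lt_def h -expr2 sqr_ge0.
Qed.

Lemma trace_mulmx_tr d e (L : 'M[R]_(d, e)) : \tr (L *m L^T) = \sum_k norm2 (col k L).
Proof.
rewrite mxtrace_mulC /mxtrace; apply: eq_bigr => k _.
by rewrite mxE /norm2; apply: eq_bigr => i _; rewrite !mxE expr2.
Qed.

(** Cauchy-Schwarz, from the norm of [norm2 v *: u - b *: v], the part of [u] orthogonal to [v] with
    denominators cleared. *)
Lemma dot_le d (u v : 'cV[R]_d) : (\sum_i u i 0 * v i 0) ^+ 2 <= norm2 u * norm2 v.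
Proof.
set b := \sum_i _.
have [v0|v0] := eqVneq (norm2 v) 0.
  have vi i : v i 0 = 0.
    move/eqP: v0; rewrite psumr_eq0 => [/allP/(_ i)|j _]; last exact: sqr_ge0.
    by rewrite mem_index_enum => /(_ isT)/=; rewrite sqrf_eq0 => /eqP.
  by rewrite /b big1 ?expr0n/= ?v0 ?mulr0// => i _; rewrite vi mulr0.
have {}v0 : 0 < norm2 v by rewrite lt_def v0 norm2_ge0.
have : 0 <= norm2 (norm2 v *: u - b *: v) by exact: norm2_ge0.
have -> : norm2 (norm2 v *: u - b *: v) = norm2 v * (norm2 u * norm2 v - b ^+ 2).
  transitivity (\sum_i (norm2 v ^+ 2 * u i 0 ^+ 2 - 2 * norm2 v * b * (u i 0 * v i 0)
      + b ^+ 2 * v i 0 ^+ 2)).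
    by apply: eq_bigr => i _; rewrite !mxE; ring.
  rewrite big_split/= sumrB -!mulr_sumr -/b -/(norm2 u) -/(norm2 v); ring.
by rewrite pmulr_rge0// subr_ge0.
Qed.

(** The trace replaces the largest eigenvalue: Cauchy-Schwarz on each column of a factor [L]. *)
Lemma qform_le_trace d (P : 'M[R]_d) v : is_spd P -> qform P v <= \tr P * norm2 v.
Proof.
move=> /spd_factor[L ->]; rewrite qform_mulmx trace_mulmx_tr mulr_suml.
apply: ler_sum => k _; apply: le_trans (dot_le _ _).
by rewrite mxE; under eq_bigr do rewrite mxE; under [X in _ <= X ^+ 2]eq_bigr do rewrite mxE.
Qed.

Lemma spd_trace_ge0 d (P : 'M[R]_d) : is_spd P -> 0 <= \tr P.
Proof.
move=> /spd_factor[L ->]; rewrite trace_mulmx_tr.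
by apply: sumr_ge0 => k _; exact: norm2_ge0.
Qed.

Lemma spd_coercive d (P : 'M[R]_d) : is_spd P ->
  exists2 a : R, 0 < a & forall v, a * norm2 v <= qform P v.
Proof.
move=> sP; have uP := spd_unit sP; have [L PL] := spd_factor sP.
have uL : L^T \in unitmx by move: uP; rewrite PL unitmx_mul => /andP[].
(* Squared Frobenius norm of the inverse of [L^T], so that [norm2 v <= K * norm2 (L^T v)]. Adding 1
   below keeps the coercivity constant positive in dimension 0, where [K = 0]. *)
pose K := \tr ((invmx L^T)^T *m (invmx L^T)^T^T).
have K0 : 0 <= K.
  rewrite /K trace_mulmx_tr.
  by apply: sumr_ge0 => k _; exact: norm2_ge0.
exists (K + 1)^-1; first by rewrite invr_gt0 ltr_wpDl.
move=> v; rewrite mulrC ler_pdivrMr ?ltr_wpDl//.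
rewrite {1}PL qform_mulmx.
have {1}-> : v = invmx L^T *m (L^T *m v) by rewrite mulKmx.
set w := L^T *m v.
have -> : norm2 (invmx L^T *m w) = \sum_k ((row k (invmx L^T)) *m w) 0 0 ^+ 2.
  by apply: eq_bigr => k _; rewrite -row_mul [in RHS]mxE.
apply: (@le_trans _ _ (norm2 w * K)); last first.
  by apply: ler_wpM2l; [exact: norm2_ge0|rewrite lerDl].
rewrite /K trace_mulmx_tr mulr_sumr.
apply: ler_sum => k _; rewrite mulrC; apply: le_trans (dot_le _ _).
by rewrite mxE; under [X in _ <= X ^+ 2]eq_bigr do rewrite !mxE;
  under [X in X ^+ 2 <= _]eq_bigr do rewrite !mxE.
Qed.

(** With [P = L L^T], the trace of [P Q] is the sum of the form [Q] over the columns of [L], and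
    [\tr P] the sum of their squared norms. *)
Lemma trace_coercive d (P Q : 'M[R]_d) a : is_spd P ->
  (forall v, a * norm2 v <= qform Q v) -> a * \tr P <= \tr (P *m Q).
Proof.
move=> /spd_factor[L ->] aQ; rewrite trace_mulmx_tr -mulmxA mxtrace_mulC.
rewrite mulr_sumr /mxtrace; apply: ler_sum => k _; apply: le_trans (aQ _) _.
rewrite le_eqVlt; apply/orP; left; apply/eqP.
rewrite /qform.
have -> : (L^T *m Q *m L) k k = ((col k L)^T *m Q *m col k L) 0 0.
  by rewrite tr_col -row_mul !mxE; apply: eq_bigr => i _; rewrite !mxE.
by [].
Qed.

End spd_algebra.

(** * Lebesgue measure under affine maps, and product laws of coordinates *)

Definition image_measure d1 d2 (T1 : measurableType d1) (T2 : measurableType d2)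
    (R : realType) (mu : {measure set T1 -> \bar R}) (f : T1 -> T2)
    (mf : measurable_fun setT f) : {measure set T2 -> \bar R} :=
  measure_function_pushforward__canonical__measure_function_Measure mu mf.

Section affine_lebesgue.
Context {R : realType}.
Local Notation RR := (measurableTypeR R).

(** By uniqueness of Lebesgue measure: the pushforward under the map, multiplied by [a], gives each
    interval []x, y]] its length. *)
Lemma lebesgue_measure_affine (a b : R) (A : set RR) : 0 < a -> measurable A ->
  lebesgue_measure ((fun x : RR => a * x + b) @^-1` A) =
  ((a^-1)%:E * lebesgue_measure A)%E.
Proof.
move=> a0 mA; have a00 : 0 <= a by exact: ltW.
pose f : RR -> RR := fun x : RR => a * x + b.
have mf : measurable_fun setT f.
  by apply: measurable_funD => //; exact: measurable_funM.
suff h : mscale (NngNum a00) (image_measure lebesgue_measure mf) A =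
    lebesgue_measure A.
  rewrite -h /mscale/= /pushforward muleA -EFinM mulVf ?gt_eqF// mul1e.
  by [].
apply/esym; apply: lebesgue_measure_unique => // _ [[x y] _ <-].
rewrite -[RHS]/((NngNum a00)%:num%:E * lebesgue_measure (f @^-1` _))%E /=.
have -> : f @^-1` `]x, y] = `](x - b) / a, (y - b) / a]%classic.
  apply/seteqP; split => t; rewrite /f /= !in_itv/=.
    by move=> /andP[h1 h2]; rewrite ltr_pdivrMr// ler_pdivlMr// ltrBlDr lerBrDr mulrC h1 h2.
  by rewrite ltr_pdivrMr// ler_pdivlMr// ltrBlDr lerBrDr mulrC.
rewrite !lebesgue_measure_itv/= !lte_fin ltr_pM2r ?invr_gt0// ltrD2r.
case: ifPn => xy; last by rewrite mule0.
rewrite -!EFinB -EFinM; congr EFin; field; exact: lt0r_neq0.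
Qed.

End affine_lebesgue.

Section box_measure.
Context {R : realType}.
Local Notation RR := (measurableTypeR R).

(** The coordinates [c] carry [mu] to a product of Lebesgue measures, as tested on boxes. The index
    is an arbitrary finite type so that coordinates can be relabelled along a bijection. *)
Definition box_measure d (T : measurableType d) (I : finType)
    (mu : set T -> \bar R) (c : I -> T -> RR) : Prop :=
  (forall i, measurable_fun setT (c i)) /\
  forall X : I -> set RR, (forall i, measurable (X i)) ->
    mu [set t | forall i, X i (c i t)] = (\prod_i lebesgue_measure (X i))%E.

Lemma measurable_box d (T : measurableType d) (I : finType) (c : I -> T -> RR)
    (X : I -> set RR) : (forall i, measurable_fun setT (c i)) ->
  (forall i, measurable (X i)) -> measurable [set t | forall i, X i (c i t)].
Proof.
move=> mc mX; rewrite (_ : [set _ | _] = \bigcap_(i in [set: I]) (c i @^-1` X i)).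
  apply: fin_bigcap_measurable => // i _.
  by rewrite -[X in measurable X]setTI; exact: mc.
by apply/seteqP; split=> [t h i _|t h i]; exact: h.
Qed.

Lemma integral_prod_measure d1 d2 (T1 : measurableType d1) (T2 : measurableType d2)
    (mu : {sigma_finite_measure set T1 -> \bar R})
    (nu : {sigma_finite_measure set T2 -> \bar R}) (f : T1 * T2 -> \bar R) :
  measurable_fun setT f -> (forall z, (0 <= f z)%E) ->
  (\int[prod_measure mu nu]_z f z = \int[mu]_x \int[nu]_y f (x, y))%E.
Proof. by move=> mf f0; exact: fubini_tonelli1. Qed.

Lemma tonelli d1 d2 (T1 : measurableType d1) (T2 : measurableType d2)
    (mu : {sigma_finite_measure set T1 -> \bar R})
    (nu : {sigma_finite_measure set T2 -> \bar R}) (f : T1 -> T2 -> \bar R) :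
  measurable_fun setT (fun z => f z.1 z.2) -> (forall x y, (0 <= f x y)%E) ->
  (\int[mu]_x \int[nu]_y f x y = \int[nu]_y \int[mu]_x f x y)%E.
Proof.
by move=> mf f0; exact: (@fubini_tonelli _ _ _ _ _ mu nu (fun z => f z.1 z.2)).
Qed.

Lemma box_lebesgue : box_measure (@lebesgue_measure R) (fun _ : 'I_1 => @id RR).
Proof.
split=> [_|X mX]; first exact: measurable_id.
rewrite big_ord1; congr (_ _); apply/seteqP; split => t /=; first exact.
by move=> h i; rewrite ord1.
Qed.

Lemma box_prod d1 d2 (T1 : measurableType d1) (T2 : measurableType d2)
    (I1 I2 : finType)
    (mu : {sigma_finite_measure set T1 -> \bar R})
    (nu : {sigma_finite_measure set T2 -> \bar R})
    (c1 : I1 -> T1 -> RR) (c2 : I2 -> T2 -> RR) :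
  box_measure mu c1 -> box_measure nu c2 ->
  box_measure (prod_measure mu nu)
    (fun (i : I1 + I2) z => match i with inl i => c1 i z.1 | inr i => c2 i z.2 end).
Proof.
move=> [m1 b1] [m2 b2]; split => [[i|i]|X mX].
- exact: measurableT_comp.
- exact: measurableT_comp.
rewrite big_sumType/= -b1// -b2// -product_measure1E; last 2 first.
- exact: (@measurable_box _ _ _ c1 (fun i => X (inl i))).
- exact: (@measurable_box _ _ _ c2 (fun i => X (inr i))).
congr (product_measure1 _ _ _); apply/seteqP; split => [[x y]/= h|[x y]/= [h1 h2]].
  by split => i; [exact: (h (inl i))|exact: (h (inr i))].
by case.
Qed.

Lemma box_reindex d (T : measurableType d) (I J : finType) (mu : set T -> \bar R)
    (c : I -> T -> RR) (h : J -> I) : bijective h ->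
  box_measure mu c -> box_measure mu (fun j => c (h j)).
Proof.
move=> [g hK gK] [mc bc]; split => [j|X mX]; first exact: mc.
rewrite (_ : [set _ | _] = [set t | forall i, X (g i) (c i t)]).
  by rewrite (bc (fun i => X (g i)))// [RHS](reindex g)//; exists h => i _; rewrite ?hK ?gK.
apply/seteqP; split => t /= H i; first by rewrite -{2}(gK i).
by rewrite -[i in X i]hK.
Qed.

Lemma eq_box_measure d (T : measurableType d) (I : finType) (mu : set T -> \bar R)
    (c c' : I -> T -> RR) : (forall i t, c i t = c' i t) ->
  box_measure mu c -> box_measure mu c'.
Proof.
by move=> cc'; have -> : c' = c by apply/funext => i; apply/funext => t.
Qed.

(** Preimages under the affine map shrink by [a^-1] in each coordinate, which the factor [a ^+ #|I|]
    on the measure compensates. *)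
Lemma box_affine d (T : measurableType d) (I : finType)
    (mu : {measure set T -> \bar R}) (c : I -> T -> RR) (a : R) (b : I -> R)
    (a0 : 0 < a) :
  box_measure mu c ->
  box_measure (mscale (NngNum (exprn_ge0 #|I| (ltW a0))) mu)
    (fun i t => a * c i t + b i).
Proof.
move=> [mc bc]; split => [i|X mX].
  apply: (@measurable_funD _ _ _ _ (fun t => a * c i t) (cst (b i))) => //.
  by apply: measurable_funM; [exact: measurable_cst|exact: (mc i)].
have mY i : measurable ((fun x : RR => a * x + b i) @^-1` X i).
  rewrite -[X in measurable X]setTI.
  have mf : measurable_fun setT (fun x : RR => a * x + b i).
    by apply: measurable_funD => //; exact: measurable_funM.
  exact: mf (mX i).
rewrite -[LHS]/((NngNum _)%:num%:E * mu _)%E /= (bc (fun i => (fun x : RR => a * x + b i) @^-1` X i))//.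
rewrite (eq_bigr (fun i => ((a^-1)%:E * lebesgue_measure (X i))%E)); last first.
  by move=> i _; exact: lebesgue_measure_affine.
rewrite big_split/= prodEFin prodr_const muleA -EFinM exprVn mulfV ?mul1e//.
by rewrite expf_neq0// gt_eqF.
Qed.

Lemma box_tuple n : box_measure (@lebesgue_tuple R n) (fun i t => tnth t i).
Proof.
split=> [i|]; first exact: measurable_tnth.
elim: n => [|n IH] X mX.
  by rewrite big_ord0/= diracE mem_set// => -[].
rewrite big_ord_recl/= /push_measure /pushforward.
rewrite (_ : _ @^-1` _ = X ord0 `*` [set t | forall i, X (lift ord0 i) (tnth t i)]).
  rewrite /prod_measure product_measure1E//.
    by rewrite -(IH (fun i => X (lift ord0 i))).
  apply: (@measurable_box _ _ _ (fun i t => tnth t i) (fun i => X (lift ord0 i))) => // i.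
  exact: measurable_tnth.
apply/seteqP; split => [[x t]/= h|[x t]/= [h1 h2] i].
  split; first by have := h ord0; rewrite (tnth_nth x).
  by move=> i; have := h (lift ord0 i); rewrite !(tnth_nth x).
case: (unliftP ord0 i) => [j|] ->; last by rewrite (tnth_nth x).
by have := h2 j; rewrite !(tnth_nth x).
Qed.

(** Uniqueness on a pi-system: boxes are stable under intersection, they generate the product
    sigma-algebra, and the cubes []-k, k[], of finite measure, exhaust the space. *)
Lemma box_tuple_unique n (mu : {measure set (n.-tuple RR) -> \bar R}) :
  box_measure mu (fun i t => tnth t i) ->
  forall A, measurable A -> mu A = lebesgue_tuple n A.
Proof.
move=> [_ bmu] A mA; have [mt bl] := box_tuple n.
pose box (X : 'I_n -> set RR) := [set t : n.-tuple RR | forall i, X i (tnth t i)].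
pose G := [set box X | X in [set X | forall i, measurable (X i)]].
pose g k := box (fun=> `]- k%:R, k%:R[%classic).
apply: (measure_unique G g) => //.
- rewrite eqEsubset; split => B.
    apply: smallest_sub; first exact: smallest_sigma_algebra.
    apply: (big_ind (fun S => S `<=` <<s G >>)) => [//|S S' hS hS'|i _].
      by rewrite subUset.
    move=> _ [Y mY <-]; apply: sub_sigma_algebra.
    exists (fun j => if j == i then Y else setT).
      by move=> j /=; case: ifPn.
    apply/seteqP; split => [t h|t [_ h] j]; last by case: eqP => // ->.
    by split => //; have := h i; rewrite eqxx.
  apply: smallest_sub; first exact: sigma_algebra_measurable.
  by move=> _ [X mX <-]; exact: measurable_box.
- move=> _ _ [X mX <-] [Y mY <-]; exists (fun i => X i `&` Y i).
    by move=> i; exact: measurableI.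
  by apply/seteqP; split => [t h|t [h1 h2] i] //; split => i; have [] := h i.
- by move=> k; exists (fun=> `]- k%:R, k%:R[%classic).
- apply/seteqP; split => // t _; pose s := \sum_i `|tnth t i|.
  exists (Num.bound s) => // i /=.
  rewrite in_itv/= -ltr_norml (le_lt_trans _ (archi_boundP _))//; last exact: sumr_ge0.
  rewrite /s (bigD1 i)//= lerDl; exact: sumr_ge0.
- by move=> _ [X mX <-]; rewrite /box bmu// -bl.
- move=> k; rewrite /g /box (bmu (fun=> `]- k%:R, k%:R[%classic))// (eq_bigr (fun=> (k%:R - - k%:R)%:E)).
    by rewrite prodEFin ltry.
  (* The interval of index [k = 0] is empty, in agreement with the length [k - -k = 0]. *)
  move=> i _; rewrite lebesgue_measure_itv/= lte_fin; case: ifPn => // h.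
  have : ~~ (0 < k)%N.
    by apply: contra h => k0; rewrite (@lt_trans _ _ 0) ?oppr_lt0 ?ltr0n.
  by rewrite -eqn0Ngt => /eqP ->; rewrite mulr0n !oppr0 addr0.
Qed.

(* Any measure space whose coordinates have the product law of Lebesgue measure
   computes integrals over tuples: all changes of variables below (reordering of
   coordinates, dilations, shears) are instances of this. *)
Lemma integral_box_tuple d (T : measurableType d) (mu : {measure set T -> \bar R})
    n (c : 'I_n -> T -> RR) (f : n.-tuple RR -> \bar R) :
  box_measure mu c -> measurable_fun setT f -> (forall t, (0 <= f t)%E) ->
  (\int[lebesgue_tuple n]_t f t = \int[mu]_t f [tuple c i t | i < n])%E.
Proof.
move=> [mc bc] mf f0; pose phi t := [tuple c i t | i < n].
have mphi : measurable_fun setT phi.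
  apply/measurable_fun_tnthP => i; rewrite [X in measurable_fun _ X](_ : _ = c i)//.
  by apply/funext => t /=; rewrite tnth_mktuple.
have := @ge0_integral_pushforward _ _ _ _ R phi mphi mu setT f measurableT mf.
rewrite preimage_setT => /(_ (fun _ _ => f0 _)) <-.
apply: (@eq_measure_integral _ _ R _ (image_measure mu mphi)) => A mA _.
apply/esym; apply: box_tuple_unique => //; split => [i|X mX].
  exact: measurable_tnth.
rewrite -bc//; congr (mu _); apply/seteqP; split => t /= h i; have := h i.
  by rewrite tnth_mktuple.
by rewrite tnth_mktuple.
Qed.

End box_measure.

(** * Integrals over matrices and symmetric matrices in coordinates *)

Section lebesgue_coordinates.
Context {R : realType}.
Local Notation RR := (measurableTypeR R).

Lemma integral_push_measure d1 d2 (T1 : measurableType d1) (T2 : measurableType d2)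
    (mu : {sigma_finite_measure set T1 -> \bar R}) (f : T1 -> T2) (g : T2 -> T1)
    (mf : measurable_fun setT f) (mg : measurable_fun setT g) (fK : cancel f g)
    (h : T2 -> \bar R) : measurable_fun setT h -> (forall x, (0 <= h x)%E) ->
  (\int[push_measure mu mf mg fK]_x h x = \int[mu]_x h (f x))%E.
Proof.
move=> mh h0; have := @ge0_integral_pushforward _ _ _ _ R f mf mu setT h measurableT mh.
by rewrite preimage_setT => /(_ (fun _ _ => h0 _)) <-.
Qed.

Lemma integral_lebesgue_mx d (T : measurableType d) (mu : {measure set T -> \bar R})
    m n (c : 'I_m * 'I_n -> T -> RR) (f : 'M[R]_(m, n) -> \bar R) :
  box_measure mu c -> measurable_fun setT f -> (forall t, (0 <= f t)%E) ->
  (\int[lebesgue_mx m n]_A f A = \int[mu]_t f (\matrix_(i, j) c (i, j) t))%E.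
Proof.
move=> bc mf f0; rewrite /lebesgue_mx integral_push_measure//.
rewrite (integral_box_tuple (box_reindex (@enum_val_bij _) bc))//.
  apply: eq_integral => t _; congr f; apply/matrixP => i j.
  by rewrite !mxE tnth_mktuple enum_rankK.
apply: (measurableT_comp mf); apply/measurable_fun_mxP => i j.
set k := enum_rank (i, j).
rewrite [X in measurable_fun _ X](_ : _ = fun t : #|{: 'I_m * 'I_n}|.-tuple RR =>
    tnth t k); first exact: measurable_tnth.
by apply/funext => t; rewrite mxE.
Qed.

Lemma box_lebesgue_mx m n :
  box_measure (@lebesgue_mx R m n) (fun ij (A : 'M[R]_(m, n)) => A ij.1 ij.2 : RR).
Proof.
split=> [ij|X mX]; first exact: measurable_coord.
have [_ <-//] := box_reindex (@enum_rank_bij _) (@box_tuple R #|{: 'I_m * 'I_n}|).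
rewrite /lebesgue_mx /= /push_measure /pushforward; congr (_ _).
by apply/seteqP; split => t /= h ij; have := h ij; rewrite mxE -surjective_pairing.
Qed.

(** Copies the ordering of indices that is local to the construction of [lebesgue_sym], as [symt]
    copies its parametrization. The default of [insubd] is never reached, since the pair is put in
    nondecreasing order. *)
Definition sort_index m (i j : 'I_m) : upper_index m :=
  insubd (exist _ (i, i) (leqnn i) : upper_index m)
    (if (i <= j)%N then (i, j) else (j, i)).

Lemma sort_indexE m (i j : 'I_m) :
  val (sort_index i j) = if (i <= j)%N then (i, j) else (j, i).
Proof.
by rewrite val_insubd; case: (leqP i j) => [->//|/ltnW ->].
Qed.

Lemma sort_index_id m (i j : 'I_m) (ij : (i <= j)%N) :
  sort_index i j = exist _ (i, j) ij.
Proof. by apply: val_inj; rewrite sort_indexE/= ij. Qed.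

Definition symt m (t : #|{: upper_index m}|.-tuple RR) : 'M[R]_m :=
  \matrix_(i, j) tnth t (enum_rank (sort_index i j)).

Lemma measurable_symt m : measurable_fun setT (@symt m).
Proof.
apply/measurable_fun_mxP => i j.
rewrite [X in measurable_fun _ X](_ : _ = fun t : #|{: upper_index m}|.-tuple RR =>
    tnth t (enum_rank (sort_index i j))); first exact: measurable_tnth.
by apply/funext => t; rewrite mxE.
Qed.

Lemma trmx_symt m (t : #|{: upper_index m}|.-tuple RR) : (symt t)^T = symt t.
Proof.
apply/matrixP => i j; rewrite !mxE; congr (tnth _ (enum_rank _)).
apply: val_inj; rewrite !sort_indexE; case: ltngtP => // /val_inj -> //.
Qed.

Lemma integral_symt m (f : 'M[R]_m -> \bar R) :
  measurable_fun setT f -> (forall t, (0 <= f t)%E) ->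
  (\int[lebesgue_sym m]_A f A = \int[lebesgue_tuple #|{: upper_index m}|]_t f (symt t))%E.
Proof. by move=> mf f0; rewrite /lebesgue_sym integral_push_measure. Qed.

Lemma integral_lebesgue_sym d (T : measurableType d) (mu : {measure set T -> \bar R})
    m (c : upper_index m -> T -> RR) (f : 'M[R]_m -> \bar R) :
  box_measure mu c -> measurable_fun setT f -> (forall t, (0 <= f t)%E) ->
  (\int[lebesgue_sym m]_A f A = \int[mu]_t f (\matrix_(i, j) c (sort_index i j) t))%E.
Proof.
move=> bc mf f0; rewrite integral_symt//.
rewrite (integral_box_tuple (box_reindex (@enum_val_bij _) bc))//.
  apply: eq_integral => t _; congr f; apply/matrixP => i j.
  by rewrite !mxE tnth_mktuple enum_rankK.
by apply: (measurableT_comp mf); exact: measurable_symt.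
Qed.

Lemma box_symt m : box_measure (lebesgue_tuple #|{: upper_index m}|)
  (fun (ij : upper_index m) t => symt t (val ij).1 (val ij).2 : RR).
Proof.
apply: eq_box_measure (box_reindex (@enum_rank_bij _) (@box_tuple R _)) => -[[i j] ij] t.
by rewrite mxE/= (sort_index_id ij).
Qed.

Lemma integral_mscale_box d (T : measurableType d) (mu : {measure set T -> \bar R})
    (k : R) (k0 : 0 <= k) (f : T -> \bar R) :
  measurable_fun setT f -> (forall t, (0 <= f t)%E) ->
  (\int[mscale (NngNum k0) mu]_t f t = k%:E * \int[mu]_t f t)%E.
Proof. by move=> mf f0; rewrite ge0_integral_mscale. Qed.

Lemma measurable_scalemx d (T : measurableType d) m n (a : R) (f : T -> 'M[R]_(m, n)) :
  measurable_fun setT f -> measurable_fun setT (fun x => a *: f x).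
Proof.
move=> mf; apply/measurable_fun_mxP => i j.
under eq_fun do rewrite mxE.
by apply: measurable_funM => //; exact: measurable_mx_entry.
Qed.

Lemma dilate_lebesgue_mx m n (a : R) (f : 'M[R]_(m, n) -> \bar R) : 0 < a ->
  measurable_fun setT f -> (forall t, (0 <= f t)%E) ->
  (\int[lebesgue_mx m n]_A f A =
   (a ^+ #|{: 'I_m * 'I_n}|)%:E * \int[lebesgue_mx m n]_A f (a *: A)%R)%E.
Proof.
move=> a0 mf f0.
rewrite [LHS](integral_lebesgue_mx (box_affine (fun=> 0) a0 (@box_lebesgue_mx m n)))//.
rewrite integral_mscale_box//.
  by congr (_ * _)%E; apply: eq_integral => A _; congr f; apply/matrixP => i j; rewrite !mxE addr0.
apply: (measurableT_comp mf); apply/measurable_fun_mxP => i j.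
under eq_fun do rewrite mxE/= addr0.
by apply: measurable_funM => //; exact: measurable_coord.
Qed.

(** A common factor [a] and a symmetric [D] act on each upper-triangular coordinate separately, so
    the Jacobian has one factor [a] per upper index. *)
Lemma affine_lebesgue_sym m (a : R) (D : 'M[R]_m) (f : 'M[R]_m -> \bar R) : 0 < a ->
  D^T = D -> measurable_fun setT f -> (forall t, (0 <= f t)%E) ->
  (\int[lebesgue_sym m]_A f A =
   (a ^+ #|{: upper_index m}|)%:E * \int[lebesgue_sym m]_A f (a *: A + D)%R)%E.
Proof.
move=> a0 Dt mf f0.
have mg : measurable_fun setT (fun A : 'M[R]_m => a *: A + D).
  by apply: measurable_addmx => //; exact: measurable_scalemx.
rewrite [LHS](integral_lebesgue_sym
  (box_affine (fun ij : upper_index m => D (val ij).1 (val ij).2) a0 (@box_symt m)))//.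
have E t : \matrix_(i, j) (a * symt t (val (sort_index i j)).1 (val (sort_index i j)).2
    + D (val (sort_index i j)).1 (val (sort_index i j)).2) = a *: symt t + D.
  apply/matrixP => i j; rewrite mxE sort_indexE; case: ifPn => _; first by rewrite !mxE.
  have sw (S : 'M[R]_m) : S^T = S -> S j i = S i j by move=> /matrixP/(_ i j); rewrite mxE.
  by rewrite /= (sw _ (trmx_symt t)) (sw _ Dt) !mxE.
under eq_integral do rewrite E.
have mg2 : measurable_fun setT (fun A : 'M[R]_m => f (a *: A + D)).
  exact: (measurableT_comp mf).
rewrite integral_mscale_box//; last first.
  by apply: (measurableT_comp mg2); exact: measurable_symt.
by rewrite [in RHS]integral_symt.
Qed.

Lemma translate_symt m (D : 'M[R]_m) (f : 'M[R]_m -> \bar R) : D^T = D ->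
  measurable_fun setT f -> (forall S, (0 <= f S)%E) ->
  (\int[lebesgue_tuple #|{: upper_index m}|]_t f (symt t + D)%R =
   \int[lebesgue_tuple #|{: upper_index m}|]_t f (symt t))%E.
Proof.
move=> Dt mf f0; rewrite -[RHS]integral_symt// (affine_lebesgue_sym ltr01 Dt mf f0).
rewrite expr1n mul1e.
have E S : f (1 *: S + D) = f (S + D) by rewrite scale1r.
under [in RHS]eq_integral do rewrite E.
rewrite (@integral_symt m (fun S => f (S + D)))//.
by apply: (measurableT_comp mf); exact: measurable_addmx.
Qed.

(** Moves integrals off the subtype [spd], so that changes of variables in the linear space of
    symmetric matrices apply. *)
Lemma integral_lebesgue_spd m (f : 'M[R]_m -> \bar R) : measurable_fun setT f ->
  (forall S, (0 <= f S)%E) ->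
  (\int[lebesgue_spd m]_S f (spd_mx S) =
   \int[lebesgue_sym m]_S (f S * (\1_[set S : 'M[R]_m | is_spd S] S)%:E))%E.
Proof.
move=> mf f0.
have := @ge0_integral_pushforward _ _ _ _ R (@spd_mx R m) (@measurable_spd_mx R m)
  (lebesgue_spd m) setT f measurableT mf.
rewrite preimage_setT => /(_ (fun _ _ => f0 _)) <-.
pose D := [set S : 'M[R]_m | is_spd S].
have mD : measurable D by exact: measurable_is_spd.
rewrite [RHS](eq_integral (f \_ D)); last first.
  by move=> S _; rewrite patchE indicE; case: ifPn; rewrite ?mule1 ?mule0.
rewrite -integral_mkcond.
pose mu := image_measure (lebesgue_spd m) (@measurable_spd_mx R m).
have muE A : measurable A -> mu A = lebesgue_sym m (A `&` D).
  move=> mA; rewrite /mu/= /pushforward /lebesgue_spd; congr (_ _).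
  apply/seteqP; split => [_ [S AS <-]|S [AS pS]].
    by split=> //; exact: spd_mxP.
  by exists (SPD pS).
have mu0 : mu (~` D) = 0%E by rewrite muE ?setICl ?measure0//; exact: measurableC.
rewrite -[LHS]/(\int[mu]_y f y)%E (ge0_negligible_integral _ _ _ _ mu0)//; last first.
  exact: measurableC.
rewrite setTD setCK; apply: eq_measure_integral => A mA AD; rewrite muE//; congr (_ _).
by apply/setIidPl.
Qed.

End lebesgue_coordinates.

(** * Gaussian integrals *)

Section gaussian_integral.
Context {R : realType}.
Local Notation RR := (measurableTypeR R).

Lemma integral_gauss_shift (s a : R) : 0 < s ->
  (\int[lebesgue_measure]_x (expR (- (s * (x + a) ^+ 2)))%:E = (Num.sqrt (pi / s))%:E)%E.
Proof.
(* The standard deviation of the normal law whose exponent is [- s (x + a)^2]; its mean is [- a]. *)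
move=> s0; pose sg := Num.sqrt (2 * s)^-1.
have sg2 : sg ^+ 2 = (2 * s)^-1 by rewrite sqr_sqrtr// invr_ge0 mulr_ge0// ltW.
have sg0 : sg != 0 by rewrite gt_eqF// sqrtr_gt0 invr_gt0 mulr_gt0.
have E x : (expR (- (s * (x + a) ^+ 2)))%:E =
    ((Num.sqrt (pi / s))%:E * (normal_pdf (- a) sg x)%:E)%E.
  rewrite normal_pdfE// /normal_peak /normal_fun opprK -EFinM; congr EFin.
  rewrite sg2 (_ : (2 * s)^-1 * pi *+ 2 = pi / s); last by field; rewrite gt_eqF.
  rewrite mulVKf; last by rewrite gt_eqF// sqrtr_gt0 divr_gt0// pi_gt0.
  by congr expR; field; rewrite gt_eqF.
under eq_integral do rewrite E.
rewrite ge0_integralZl_EFin//; first by rewrite integral_normal_pdf mule1.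
- by move=> x _; rewrite lee_fin normal_pdf_ge0.
- by apply/measurable_EFinP; exact: measurable_normal_pdf.
Qed.

Definition colt d (t : d.-tuple RR) : 'cV[R]_d := \col_i tnth t i.

Lemma measurable_colt d : measurable_fun setT (@colt d).
Proof.
apply/measurable_fun_mxP => i j.
rewrite [X in measurable_fun _ X](_ : _ = fun t : d.-tuple RR => tnth t i).
  exact: measurable_tnth.
by apply/funext => t; rewrite mxE.
Qed.

Lemma colt_cons d (x : R) (t : d.-tuple RR) :
  colt [tuple of x :: t] = col_mx x%:M (colt t) :> 'cV_(1 + d).
Proof.
apply/matrixP => i j; rewrite !mxE; case: (split_ordP i) => k ->.
  by rewrite ord1 !mxE !ord1 eqxx (tnth_nth x).
by rewrite !mxE !(tnth_nth x).
Qed.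

Lemma measurable_expR_fun d (T : measurableType d) (f : T -> R) :
  measurable_fun setT f -> measurable_fun setT (fun x => (expR (f x))%:E).
Proof.
by move=> mf; apply/measurable_EFinP; exact: (measurableT_comp (@measurable_expR R)).
Qed.

(** Induction on the dimension. The first coordinate, in which the square is completed, contributes
    [sqrt (pi / s)]; the Schur complement remains, and [det_schur] multiplies the determinants. *)
Lemma integral_gauss_tuple d (Q : 'M[R]_d) : is_spd Q ->
  (\int[lebesgue_tuple d]_t (expR (- qform Q (colt t)))%:E =
   (Num.sqrt (pi ^+ d / \det Q))%:E)%E.
Proof.
elim: d Q => [|d IH] Q sQ.
  rewrite integral_dirac// ?diracT ?mul1e; last first.
    apply: measurable_expR_fun; apply: measurable_funN; apply: measurable_qform => //.
    exact: measurable_colt.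
  by rewrite /qform mxE big_ord0 oppr0 expR0 expr0 det_mx00 divr1 sqrtr1.
rewrite -[d.+1]/(1 + d)%N in Q sQ *.
have [Qt _] := sQ.
move: sQ; rewrite (mx_schur Qt); set s := Q 0 0; set v := dlsubmx Q.
set S := drsubmx Q => sQ.
have [s0 sS] := schur_blockP sQ.
have St := schur_block_tr sQ.1.
rewrite det_schur ?gt_eqF//.
have mq (q : 'M[R]_(1 + d)) : measurable_fun setT
    (fun t : (1 + d).-tuple RR => (expR (- qform q (colt t)))%:E).
  apply: measurable_expR_fun; apply: measurable_funN; apply: measurable_qform => //.
  exact: measurable_colt.
rewrite /= integral_push_measure//.
have mF : measurable_fun setT (fun z : RR * d.-tuple RR =>
    (expR (- qform (schur_block s v S) (colt [tuple of z.1 :: z.2])))%:E).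
  apply: (measurableT_comp (mq (schur_block s v S))).
  by apply: measurable_cons.
rewrite integral_prod_measure//.
(* The first coordinate becomes the inner variable, to be integrated at fixed values of the
   others. *)
rewrite tonelli//.
transitivity (\int[lebesgue_tuple d]_t
    ((Num.sqrt (pi / s))%:E * (expR (- qform (schur_complement s v S) (colt t)))%:E))%E.
  apply: eq_integral => t _.
  rewrite -(integral_gauss_shift (s^-1 * (v^T *m colt t) 0 0) s0).
  rewrite -ge0_integralZr//; last first.
    apply: measurable_expR_fun; apply: measurable_funN; apply: measurable_funM => //.
    by apply: measurable_funX; exact: measurable_funD.
  apply: eq_integral => x _; rewrite /= colt_cons qform_schur ?gt_eqF//.
  by rewrite opprD expRD EFinM.
rewrite ge0_integralZl_EFin ?sqrtr_ge0//; last first.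
  apply: measurable_expR_fun; apply: measurable_funN; apply: measurable_qform => //.
  exact: measurable_colt.
rewrite IH// -EFinM -sqrtrM; last by rewrite divr_ge0 ?pi_ge0// ltW.
by rewrite exprS invfM mulrACA.
Qed.

End gaussian_integral.

(** * Inverse-gamma integrals in one variable *)

Section inverse_gamma.
Context {R : realType}.
Local Notation RR := (measurableTypeR R).

Lemma powR_cvgNy0 (b : R) : 0 < b -> x `^ (- b) @[x --> +oo%R] --> (0 : R).
Proof.
move=> b0; apply/cvgrPdist_lt => e e0.
near=> x.
have x0 : 0 < x by near: x; exact: nbhs_pinfty_gt.
rewrite sub0r normrN ger0_norm ?powR_ge0// powRN.
rewrite invf_plt ?posrE ?powR_gt0//.
have -> : e^-1 = (e^-1 `^ b^-1) `^ b.
  by rewrite -powRrM mulVf ?gt_eqF// powRr1// invr_ge0 ltW.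
rewrite gt0_ltr_powR ?nnegrE ?powR_ge0// ?ltW//.
Unshelve. all: by end_near. Qed.

Lemma integral_powRN_lty (b : R) : 1 < b ->
  (\int[lebesgue_measure]_(x in `[1%R, +oo[) (x `^ (- b))%:E < +oo)%E.
Proof.
move=> b1; have b10 : 0 < b - 1 by rewrite subr_gt0.
pose F (x : R) := - (b - 1)^-1 * x `^ (- (b - 1)).
have dF (x : R) : 0 < x -> is_derive x 1 F (x `^ (- b)).
  move=> x0; have := is_derive1_powR (- (b - 1)) x0.
  move=> /(@is_deriveZ _ _ _ _ (- (b - 1)^-1)).
  rewrite (_ : _ *: _ = x `^ (- b)); first by [].
  rewrite /GRing.scale/= mulrA mulNr mulrN opprK mulVf ?gt_eqF// mul1r.
  by congr powR; ring.
rewrite (@ge0_continuous_FTC2y _ _ F _ 0).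
- by rewrite -EFinB ltry.
- by move=> x _; exact: powR_ge0.
- apply: continuous_in_subspaceT => x; rewrite inE/= in_itv/= andbT => x1.
  have x0 : 0 < x by exact: lt_le_trans x1.
  apply: differentiable_continuous; apply/derivable1_diffP.
  by have [] := is_derive1_powR (- b) x0.
- rewrite -[X in _ --> X](mulr0 (- (b - 1)^-1)).
  by apply: cvgMr; exact: powR_cvgNy0.
- by move=> x x1; have [] := dF x (lt_trans ltr01 x1).
- apply: cvg_at_right_filter.
  apply: differentiable_continuous; apply/derivable1_diffP.
  by have [] := dF 1 ltr01.
- move=> x; rewrite in_itv/= andbT => x1.
  by have [_] := dF x (lt_trans ltr01 x1); rewrite derive1E.
Qed.

(** As [x <= 1], the exponent [b] can be raised to an integer [N > b], and
    [exp (c / x) >= (c / (N x)) ^ N] absorbs the power. *)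
Lemma inverse_gamma_bound (b c x : R) : 0 < c -> 0 < x -> x <= 1 -> 0 <= b ->
  x `^ (- b) * expR (- (c / x)) <=
  ((Num.bound b)%:R / c) ^+ (Num.bound b).
Proof.
move=> c0 x0 x1 b0; set N := Num.bound b.
have bN : b < N%:R by exact: archi_boundP.
have N0 : 0 < N%:R :> R by exact: le_lt_trans bN.
have h1 : x `^ (- b) <= x^-1 ^+ N.
  rewrite /powR gt_eqF// -[in leRHS](lnK (_ : x \is Num.pos)) ?posrE// -expRN.
  rewrite -expRM_natl ler_expR mulNr mulrN lerN2 ler_wnM2r ?ln_le0//.
  exact: ltW.
have h2 : (c / x / N%:R) ^+ N <= expR (c / x).
  rewrite (_ : expR (c / x) = expR (c / x / N%:R) ^+ N); last first.
    by rewrite -expRM_natl; congr expR; field; rewrite !gt_eqF.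
  apply: lerXn2r; rewrite ?nnegrE ?expR_ge0//.
    by rewrite !divr_ge0// ltW.
  by rewrite (le_trans _ (expR_ge1Dx _))// lerDr.
rewrite expRN ler_pdivrMr ?expR_gt0//.
apply: le_trans h1 _; apply: le_trans (ler_wpM2l _ h2); last first.
  by rewrite exprn_ge0// divr_ge0// ltW.
rewrite -exprMn le_eqVlt; apply/orP; left; apply/eqP; congr (_ ^+ _).
by field; rewrite !gt_eqF.
Qed.

(** The integrand is bounded on []0, 1]] by the exponential factor and dominated beyond 1 by
    [x ^ (- b)], integrable because [b > 1]. *)
Lemma inverse_gamma_lty (b c : R) : 1 < b -> 0 < c ->
  (\int[lebesgue_measure]_x
     (\1_[set x : R | (0 < x)%R] x * (x `^ (- b) * expR (- (c / x))))%:E < +oo)%E.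
Proof.
move=> b1 c0; have b0 : 0 < b by exact: lt_trans b1.
set K := ((Num.bound b)%:R / c) ^+ (Num.bound b).
have K0 : 0 <= K by rewrite exprn_ge0// divr_ge0// ltW.
have mpow : measurable_fun setT (fun x : RR => x `^ (- b)) by exact: measurable_powR.
have mF : measurable_fun setT (fun x : RR =>
    \1_[set x : R | (0 < x)%R] x * (x `^ (- b) * expR (- (c / x)))).
  apply: measurable_funM.
    apply: measurable_indic; rewrite (_ : [set _ | _] = `]0, +oo[%classic)//.
    by apply/seteqP; split => x /=; rewrite in_itv/= andbT.
  apply: measurable_funM => //.
  apply: (measurableT_comp (@measurable_expR R)); apply: measurable_funN.
  by apply: measurable_funM => //; exact: measurable_inv.
apply: (@le_lt_trans _ _ (\int[lebesgue_measure]_x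
   ((K * \1_`]0%R, 1%R] x)%:E + (\1_`[1%R, +oo[ x * x `^ (- b))%:E))%E).
  apply: ge0_le_integral => //.
  - by move=> x _; rewrite lee_fin !mulr_ge0 ?powR_ge0 ?expR_ge0.
  - exact/measurable_EFinP.
  - apply: emeasurable_funD; apply/measurable_EFinP; apply: measurable_funM => //.
  move=> x _; rewrite -EFinD lee_fin !indicE.
  have -> : (x \in [set x : R | 0 < x]) = (0 < x) by apply/idP/idP; rewrite inE.
  rewrite !mem_setE/= !in_itv/= andbT.
  case: (ltP 0 x) => x0; last by rewrite mul0r addr_ge0// ?mulr_ge0 ?powR_ge0.
  rewrite mul1r; case: (leP x 1) => x1 /=.
    apply: le_trans (inverse_gamma_bound c0 x0 x1 (ltW b0)) _.
    by rewrite mulr1 lerDl mulr_ge0// powR_ge0.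
  rewrite (ltW x1) mulr0 add0r mul1r ler_piMr ?powR_ge0//.
  by rewrite -expR0 ler_expR oppr_le0 divr_ge0// ltW.
rewrite ge0_integralD//; last 4 first.
- by move=> x _; rewrite lee_fin mulr_ge0.
- by apply/measurable_EFinP; apply: measurable_funM.
- by move=> x _; rewrite lee_fin !mulr_ge0 ?powR_ge0.
- by apply/measurable_EFinP; apply: measurable_funM.
apply: lte_add_pinfty.
  under eq_integral do rewrite EFinM.
  rewrite ge0_integralZl_EFin//; last exact/measurable_EFinP.
  rewrite integral_indic// setIT -[X in (_ * X)%E]/(@lebesgue_measure R _).
  rewrite lebesgue_measure_itv/= lte_fin ltr01.
  by rewrite oppr0 adde0 mule1 ltry.
under eq_integral => x _.
  rewrite (_ : (_ * _)%:E = (((fun x => (x `^ (- b))%:E) \_ `[1%R, +oo[%classic) x)).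
    over.
  by rewrite patchE indicE; case: ifPn => _; rewrite ?mul1r ?mul0r.
rewrite -integral_mkcond; exact: integral_powRN_lty.
Qed.

End inverse_gamma.

(** * Corner, border and block coordinates on symmetric matrices *)

Section schur_coordinates.
Context {R : realType}.
Local Notation RR := (measurableTypeR R).

(** The upper indices of a bordered matrix are the corner, the rest of the first row, and the upper
    indices of the block. A row in the block with a column in the border never occurs for an upper
    index; the value there is a placeholder. *)
Definition schur_index m (u : upper_index (1 + m)) : ('I_1 + 'I_m) + upper_index m :=
  match fintype.split (val u).1, fintype.split (val u).2 with
  | inl i, inl j => inl (inl i)
  | inl i, inr j => inl (inr j)
  | inr i, inl j => inl (inr i)
  | inr i, inr j => inr (sort_index i j)
  end.

Lemma schur_index_bij m : bijective (@schur_index m).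
Proof.
pose g (x : ('I_1 + 'I_m) + upper_index m) : upper_index (1 + m) :=
  match x with
  | inl (inl i) => sort_index (lshift m i) (lshift m i)
  | inl (inr j) => sort_index (lshift m 0) (rshift 1 j)
  | inr u => sort_index (rshift 1 (val u).1) (rshift 1 (val u).2)
  end.
have sl (i : 'I_1) : fintype.split (lshift m i) = inl i := unsplitK (inl i).
have sr (i : 'I_m) : fintype.split (rshift 1 i) = inr i := unsplitK (inr i).
exists g => [[[i j] ij]|[[i|j]|[[i j] ij]]].
- move: ij; rewrite /schur_index /=.
  case: (split_ordP i) => i' ->; case: (split_ordP j) => j' -> /= ij.
  + by apply: val_inj; rewrite sort_indexE /= !ord1.
  + by apply: val_inj; rewrite sort_indexE /= !ord1.
  + by exfalso; move: ij; rewrite !ord1.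
  + have ij' : (i' <= j')%N by move: ij; rewrite !add1n ltnS.
    by apply: val_inj; rewrite !(sort_indexE, sort_index_id ij')/= ij.
- by rewrite /schur_index /= sort_indexE leqnn /= sl.
- by rewrite /schur_index /= sort_indexE /= sl sr.
- have ij1 : (rshift 1 i <= rshift 1 j)%N by rewrite /= !add1n ltnS.
  rewrite /schur_index /= sort_indexE ij1 /= !sr.
  by rewrite (sort_index_id (ij : (i <= j)%N)).
Qed.

(** Makes Lebesgue measure on symmetric matrices a product over corner, border and block, so that
    the three can be integrated one after the other. *)
Lemma box_schur m :
  box_measure (prod_measure (prod_measure (@lebesgue_measure R) (lebesgue_tuple m))
      (lebesgue_tuple #|{: upper_index m}|))
    (fun (ij : upper_index (1 + m)) z =>
       schur_block z.1.1 (colt z.1.2) (symt z.2) (val ij).1 (val ij).2 : RR).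
Proof.
apply: eq_box_measure (box_reindex (@schur_index_bij m)
  (box_prod (box_prod (@box_lebesgue R) (box_tuple m)) (@box_symt R m))).
move=> [[i j] ij] [[x v] t]; rewrite /schur_index /schur_block/=.
have sl (i : 'I_1) : fintype.split (lshift m i) = inl i := unsplitK (inl i).
have sr (i : 'I_m) : fintype.split (rshift 1 i) = inr i := unsplitK (inr i).
move: ij; case: (split_ordP i) => i' ->; case: (split_ordP j) => j' -> /= ij.
- by rewrite block_mxEul !mxE !ord1 eqxx.
- by rewrite block_mxEur !mxE.
- by exfalso; move: ij; rewrite !ord1.
- have ij' : (i' <= j')%N by move: ij; rewrite !add1n ltnS.
  by rewrite block_mxEdr (sort_index_id ij').
Qed.

Lemma schur_block_sym m (x : R) v (S : 'M[R]_m) : S^T = S ->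
  (schur_block x v S)^T = schur_block x v S.
Proof. by move=> St; rewrite /schur_block tr_block_mx trmxK St tr_scalar_mx. Qed.

Lemma integral_schur m (f : 'M[R]_(1 + m) -> \bar R) :
  measurable_fun setT f -> (forall S, (0 <= f S)%E) ->
  (\int[lebesgue_sym (1 + m)]_S f S =
   \int[prod_measure (prod_measure (@lebesgue_measure R) (lebesgue_tuple m))
      (lebesgue_tuple #|{: upper_index m}|)]_z
     f (schur_block z.1.1 (colt z.1.2) (symt z.2)))%E.
Proof.
move=> mf f0; rewrite (integral_lebesgue_sym (@box_schur m))//.
apply: eq_integral => -[[x v] t] _; congr f; apply/matrixP => i j.
rewrite mxE sort_indexE; case: ifPn => _ //=.
by have /matrixP/(_ i j) := schur_block_sym x (colt v) (trmx_symt t); rewrite mxE.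
Qed.

End schur_coordinates.

(** * Finiteness of the inverse-Wishart mass *)

Section inverse_wishart_finite.
Context {R : realType}.
Local Notation RR := (measurableTypeR R).

Lemma measurable_schur_complement d (T : measurableType d) m (s : T -> R)
    (v : T -> 'cV[R]_m) (S : T -> 'M[R]_m) :
  measurable_fun setT s -> measurable_fun setT v -> measurable_fun setT S ->
  measurable_fun setT (fun t => schur_complement (s t) (v t) (S t)).
Proof.
move=> ms mv mS; apply: measurable_submx => //.
apply/measurable_fun_mxP => i j; under eq_fun do rewrite mxE.
apply: measurable_funM; first exact: measurable_inv.
by apply: measurable_mx_entry; apply: measurable_mulmx => //; exact: measurable_trmx.
Qed.

(** Inverse-Wishart kernel with the scalar scale matrix [2 c I]. The exponent is an arbitrary real
    because the induction on the dimension lowers it by 1/2. *)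
Definition iw_density m (a c : R) (S : 'M[R]_m) : R :=
  (\det S) `^ (- a) * expR (- (c * \tr (invmx S))).

Lemma iw_density_ge0 m a c (S : 'M[R]_m) : 0 <= iw_density a c S.
Proof. by rewrite mulr_ge0 ?powR_ge0 ?expR_ge0. Qed.

Lemma measurable_iw_density d (T : measurableType d) m a c (S : T -> 'M[R]_m) :
  measurable_fun setT S -> measurable_fun setT (fun t => iw_density a c (S t)).
Proof.
move=> mS; apply: measurable_funM.
  apply: (measurableT_comp (@measurable_powR R (- a))); exact: measurable_det.
apply: (measurableT_comp (@measurable_expR R)); apply: measurable_funN.
apply: measurable_funM => //; apply: measurable_mxtrace; exact: measurable_invmx.
Qed.

Lemma measurable_indic_spd d (T : measurableType d) m (S : T -> 'M[R]_m) :
  measurable_fun setT S ->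
  measurable_fun setT (fun t => \1_[set A : 'M[R]_m | is_spd A] (S t) : R).
Proof.
move=> mS; apply: (measurableT_comp _ mS); apply: measurable_indic.
exact: measurable_is_spd.
Qed.

Lemma indic_spdT m (S : 'M[R]_m) : is_spd S ->
  \1_[set A : 'M[R]_m | is_spd A] S = 1 :> R.
Proof. by move=> sS; rewrite indicE mem_set. Qed.

Lemma indic_spdF m (S : 'M[R]_m) : ~ is_spd S ->
  \1_[set A : 'M[R]_m | is_spd A] S = 0 :> R.
Proof. by move=> sS; rewrite indicE memNset. Qed.

(* Split S = [[x, v^T], [v, S']] and let T := S' - v v^T / x.  The density becomes
   x^-a det(T)^-a exp(- c / x - c tr T^-1 - (c / x^2) v^T T^-1 v): the integral in v
   is Gaussian and the shear S' |-> T is volume preserving. *)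
Definition iw_split m (a c x : R) (v : 'cV[R]_m) (T : 'M[R]_m) : R :=
  \1_[set y : R | 0 < y] x * x `^ (- a) * expR (- (c / x)) *
  (\1_[set A : 'M[R]_m | is_spd A] T * iw_density a c T) *
  expR (- qform ((c / x ^+ 2) *: invmx T) v).

Lemma iw_split_ge0 m a c x (v : 'cV[R]_m) T : 0 <= iw_split a c x v T.
Proof.
rewrite mulr_ge0 ?expR_ge0// mulr_ge0//.
  by rewrite mulr_ge0 ?expR_ge0// mulr_ge0// powR_ge0.
by rewrite mulr_ge0// iw_density_ge0.
Qed.

(** On SPD blocks the two sides agree, and elsewhere the left side vanishes. Stating an inequality
    avoids the converse of [schur_blockP]. *)
Lemma iw_le_split m a c x (v : 'cV[R]_m) S :
  \1_[set A : 'M[R]_(1 + m) | is_spd A] (schur_block x v S) *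
    iw_density a c (schur_block x v S) <= iw_split a c x v (schur_complement x v S).
Proof.
have [sB|sB] := pselect (is_spd (schur_block x v S)); last first.
  by rewrite indic_spdF// mul0r iw_split_ge0.
have [x0 sT] := schur_blockP sB.
rewrite /iw_split !indic_spdT// !mul1r indicE mem_set// mul1r.
rewrite /iw_density det_schur ?gt_eqF// trace_inv_schur ?gt_eqF//; last exact: spd_unit.
rewrite qformZ powRM; [|exact: ltW|exact/ltW/spd_det_gt0].
rewrite -!mulrA ler_pM2l ?powR_gt0// [leRHS]mulrCA.
rewrite ler_pM2l ?powR_gt0//; last exact: spd_det_gt0.
rewrite -!expRD ler_expR le_eqVlt; apply/orP; left; apply/eqP.
by rewrite !mulrDr !mulrA; ring.
Qed.

Lemma measurable_iw_split d (T : measurableType d) m a c (x : T -> R)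
    (v : T -> 'cV[R]_m) (S : T -> 'M[R]_m) :
  measurable_fun setT x -> measurable_fun setT v -> measurable_fun setT S ->
  measurable_fun setT (fun t => iw_split a c (x t) (v t) (S t)).
Proof.
move=> mx mv mS; have mix : measurable_fun setT (fun t => (x t)^-1) by exact: measurable_inv.
apply: measurable_funM; first apply: measurable_funM; first apply: measurable_funM.
- apply: measurable_funM.
    apply: (measurableT_comp _ mx); apply: measurable_indic.
    rewrite (_ : [set _ | _] = `]0, +oo[%classic)//.
    by apply/seteqP; split => y /=; rewrite in_itv/= andbT.
  exact: (measurableT_comp (@measurable_powR R (- a))).
- apply: (measurableT_comp (@measurable_expR R)); apply: measurable_funN.
  by apply: measurable_funM.
- by apply: measurable_funM; [exact: measurable_indic_spd|exact: measurable_iw_density].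
- apply: (measurableT_comp (@measurable_expR R)); apply: measurable_funN.
  under eq_fun do rewrite qformZ.
  apply: measurable_funM; last by apply: measurable_qform => //; exact: measurable_invmx.
  apply: measurable_funM => //; apply: measurable_inv; exact: measurable_funX.
Qed.

(** The Gaussian integral in [v] has matrix [(c / x^2) T^-1], hence the value
    [sqrt (pi^m x^(2m) det T / c^m)]: the exponent of [x] moves by [m] and that of [det T] by
    1/2. *)
Lemma integral_iw_split_v m a c x (T : 'M[R]_m) : 0 < c ->
  (\int[lebesgue_tuple m]_v (iw_split a c x (colt v) T)%:E =
   (Num.sqrt (pi ^+ m / c ^+ m) *
    (\1_[set y : R | 0 < y] x * (x `^ (- (a - m%:R)) * expR (- (c / x)))) *
    (\1_[set A : 'M[R]_m | is_spd A] T * iw_density (a - 2^-1) c T))%:E)%E.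
Proof.
move=> c0; have [x0|x0] := ltP 0 x; last first.
  rewrite integral0_eq => [|v _]; rewrite ?/iw_split indicE memNset ?mul0r ?mulr0 ?mul0r//=.
    by apply/negP; rewrite -leNgt.
  by apply/negP; rewrite -leNgt.
have [sT|sT] := pselect (is_spd T); last first.
  rewrite integral0_eq => [|v _].
    by rewrite indic_spdF// mul0r mulr0.
  by rewrite /iw_split (indic_spdF sT) mul0r mulr0 mul0r.
have x2 : 0 < c / x ^+ 2 by rewrite divr_gt0// exprn_gt0.
rewrite /iw_split.
under eq_integral do rewrite EFinM.
rewrite ge0_integralZl_EFin//; last 2 first.
- apply: measurable_expR_fun; apply: measurable_funN; apply: measurable_qform => //.
  exact: measurable_colt.
- by rewrite mulr_ge0// ?iw_density_ge0 ?mulr_ge0 ?expR_ge0 ?powR_ge0.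
rewrite integral_gauss_tuple; last by apply: spd_scale => //; exact: spd_invmx.
rewrite -EFinM; congr EFin; rewrite !indic_spdT// indicE mem_set// !mul1r.
have dT := spd_det_gt0 sT.
rewrite detZ det_inv expr_div_n.
have -> : pi ^+ m / (c ^+ m / (x ^+ 2) ^+ m / \det T) =
    (pi ^+ m / c ^+ m) * (x ^+ m) ^+ 2 * \det T.
  rewrite -!exprM mulnC; field.
  by rewrite !expf_neq0 ?gt_eqF.
rewrite sqrtrM; last first.
  by rewrite mulr_ge0 ?sqr_ge0// divr_ge0 ?exprn_ge0 ?pi_ge0// ltW.
rewrite sqrtrM; last by rewrite divr_ge0 ?exprn_ge0 ?pi_ge0// ltW.
rewrite sqrtr_sqr ger0_norm ?exprn_ge0 ?ltW//.
rewrite /iw_density !opprB.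
have -> : x `^ (m%:R - a) = x `^ (- a) * x ^+ m.
  rewrite (_ : m%:R - a = - a + m%:R); last by ring.
  rewrite powRD ?powR_mulrn//; first exact: ltW.
  by rewrite (gt_eqF x0) implybT.
have -> : (\det T) `^ (2^-1 - a) = (\det T) `^ (- a) * Num.sqrt (\det T).
  rewrite (_ : 2^-1 - a = - a + 2^-1); last by ring.
  rewrite powRD ?powR12_sqrt//; first exact: ltW.
  by rewrite (gt_eqF dT) implybT.
by ring.
Qed.

(** For fixed [x] and [v], passing to the Schur complement is a translation by a fixed symmetric
    matrix. *)
Lemma iw_split_shear m a c x (v : 'cV[R]_m) :
  (\int[lebesgue_tuple #|{: upper_index m}|]_t
    (iw_split a c x v (schur_complement x v (symt t)))%:E =
   \int[lebesgue_tuple #|{: upper_index m}|]_t (iw_split a c x v (symt t))%:E)%E.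
Proof.
rewrite -[RHS](@translate_symt R m (- (x^-1 *: (v *m v^T))) (fun S => (iw_split a c x v S)%:E))//.
- by rewrite linearN linearZ/= trmx_mul trmxK.
- by apply/measurable_EFinP; exact: measurable_iw_split.
- by move=> S; rewrite lee_fin iw_split_ge0.
Qed.

Lemma integral_spd_symt m (f : 'M[R]_m -> R) : measurable_fun setT f ->
  (forall S, 0 <= f S) ->
  (\int[lebesgue_sym m]_S (\1_[set A : 'M[R]_m | is_spd A] S * f S)%:E =
   \int[lebesgue_tuple #|{: upper_index m}|]_t
     (\1_[set A : 'M[R]_m | is_spd A] (symt t) * f (symt t))%:E)%E.
Proof.
move=> mf f0; rewrite (@integral_symt R m (fun S => (\1_[set A : 'M[R]_m | is_spd A] S * f S)%:E))//.
  apply/measurable_EFinP; apply: measurable_funM => //; exact: measurable_indic_spd.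
by move=> S; rewrite lee_fin mulr_ge0.
Qed.

Lemma measurable_inverse_gamma_fun (b c : R) : measurable_fun setT (fun x : RR =>
  \1_[set y : R | 0 < y] x * (x `^ (- b) * expR (- (c / x)))).
Proof.
apply: measurable_funM.
  apply: measurable_indic; rewrite (_ : [set _ | _] = `]0, +oo[%classic)//.
  by apply/seteqP; split => y /=; rewrite in_itv/= andbT.
apply: measurable_funM; first exact: measurable_powR.
apply: (measurableT_comp (@measurable_expR R)); apply: measurable_funN.
by apply: measurable_funM => //; exact: measurable_inv.
Qed.

Section iw_split_integrals.
Variable m : nat.
Local Notation N := #|{: upper_index m}|.

Lemma measurable_iw_split_tuple d (T : measurableType d) a c (x : T -> RR)
    (v : T -> m.-tuple RR) (t : T -> N.-tuple RR) :
  measurable_fun setT x -> measurable_fun setT v -> measurable_fun setT t ->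
  measurable_fun setT (fun z => (iw_split a c (x z) (colt (v z)) (symt (t z)))%:E).
Proof.
move=> mx mv mt; apply/measurable_EFinP; apply: measurable_iw_split => //.
  exact: (measurableT_comp (@measurable_colt R m)).
exact: (measurableT_comp (@measurable_symt R m)).
Qed.

Lemma integral_iw_split_vt a c (x : R) : 0 < c ->
  (\int[lebesgue_tuple m]_v \int[lebesgue_tuple N]_t
     (iw_split a c x (colt v) (symt t))%:E =
   (Num.sqrt (pi ^+ m / c ^+ m) *
    (\1_[set y : R | (0 < y)%R] x * (x `^ (- (a - m%:R)) * expR (- (c / x)))))%:E *
   \int[lebesgue_tuple N]_t
     (\1_[set A : 'M[R]_m | is_spd A] (symt t) * iw_density (a - 2^-1) c (symt t))%:E)%E.
Proof.
move=> c0; rewrite tonelli; last 2 first.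
- by apply: measurable_iw_split_tuple; [exact: measurable_cst|exact: measurable_fst|exact: measurable_snd].
- by move=> v t; rewrite lee_fin iw_split_ge0.
rewrite -ge0_integralZl_EFin.
- by apply: eq_integral => t _; rewrite integral_iw_split_v// EFinM.
- by [].
- by move=> t _; rewrite lee_fin mulr_ge0// iw_density_ge0.
- apply/measurable_EFinP; apply: measurable_funM.
    exact: (measurable_indic_spd (@measurable_symt R m)).
  exact: (measurable_iw_density _ _ (@measurable_symt R m)).
- by rewrite !mulr_ge0 ?sqrtr_ge0 ?powR_ge0 ?expR_ge0.
Qed.

Local Notation mu3 := (prod_measure (prod_measure (@lebesgue_measure R)
  (lebesgue_tuple m)) (lebesgue_tuple N)).

Lemma measurable_schur_block :
  measurable_fun setT (fun z : RR * m.-tuple RR * N.-tuple RR =>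
    schur_block z.1.1 (colt z.1.2) (symt z.2)).
Proof.
apply/measurable_fun_mxP => i j.
case: (@box_schur R m) => h _.
have := h (sort_index i j).
congr (measurable_fun _ _); apply/funext => -[[x v] t].
rewrite sort_indexE; case: ifPn => _ //=.
by have /matrixP/(_ i j) := schur_block_sym x (colt v) (trmx_symt t); rewrite mxE.
Qed.

(** The shear acts on the innermost variable and the Gaussian integral on the next one; corner and
    block then separate. *)
Lemma integral_iw_split a c : 0 < c ->
  (\int[mu3]_z
    (iw_split a c z.1.1 (colt z.1.2) (schur_complement z.1.1 (colt z.1.2) (symt z.2)))%:E =
   \int[lebesgue_measure]_x ((Num.sqrt (pi ^+ m / c ^+ m) *
    (\1_[set y : R | (0 < y)%R] x * (x `^ (- (a - m%:R)) * expR (- (c / x)))))%:E *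
   \int[lebesgue_tuple N]_t
     (\1_[set A : 'M[R]_m | is_spd A] (symt t) * iw_density (a - 2^-1) c (symt t))%:E))%E.
Proof.
move=> c0; rewrite integral_prod_measure; last 2 first.
- have mv : measurable_fun setT (fun z : RR * m.-tuple RR * N.-tuple RR => colt z.1.2).
    apply: (measurableT_comp (@measurable_colt R m)); exact: measurableT_comp.
  have mx : measurable_fun setT (fun z : RR * m.-tuple RR * N.-tuple RR => z.1.1).
    exact: measurableT_comp.
  have mt : measurable_fun setT (fun z : RR * m.-tuple RR * N.-tuple RR => symt z.2).
    exact: (measurableT_comp (@measurable_symt R m)).
  apply/measurable_EFinP; apply: measurable_iw_split; [exact: mx|exact: mv|].
  exact: measurable_schur_complement.
- by move=> z; rewrite lee_fin iw_split_ge0.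
transitivity (\int[prod_measure (@lebesgue_measure R) (lebesgue_tuple m)]_z
    \int[lebesgue_tuple N]_t (iw_split a c z.1 (colt z.2) (symt t))%:E)%E.
  by apply: eq_integral => z _; rewrite /= iw_split_shear.
rewrite integral_prod_measure; last 2 first.
- apply: (@measurable_fun_fubini_tonelli_F _ _ _ _ _ (lebesgue_tuple N)
    (fun z : (RR * m.-tuple RR) * N.-tuple RR =>
      (iw_split a c z.1.1 (colt z.1.2) (symt z.2))%:E)).
    apply: measurable_iw_split_tuple; last exact: measurable_snd.
      exact: measurableT_comp.
    exact: measurableT_comp.
  by move=> z; rewrite lee_fin iw_split_ge0.
- by move=> z; apply: integral_ge0 => t _; rewrite lee_fin iw_split_ge0.
by apply: eq_integral => x _; exact: integral_iw_split_vt.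
Qed.

End iw_split_integrals.

(** Induction on [m]. In dimension [1 + m], the hypothesis [1 + m < a] yields both [a - m > 1], for
    the inverse-gamma integral of the corner, and [a - 1/2 > m], for the block. *)
Lemma iw_density_lty m (a c : R) : m%:R < a -> 0 < c ->
  (\int[lebesgue_sym m]_S
    (\1_[set A : 'M[R]_m | is_spd A] S * iw_density a c S)%:E < +oo)%E.
Proof.
elim: m a => [|m IH] a ma c0.
  rewrite integral_spd_symt; [|exact: measurable_iw_density|exact: iw_density_ge0].
  (* In dimension 0 the measure is a point mass and the integrand a finite constant. *)
  have card0 : #|{: upper_index 0}| = 0%N.
    by apply: eq_card0 => -[[[]]].
  pose k := (\1_[set A : 'M[R]_0 | is_spd A] (0 : 'M[R]_0) * iw_density a c (0 : 'M[R]_0))%:E.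
  rewrite (eq_integral (cst k)); last first.
    by move=> t _; rewrite /k/= [symt t]flatmx0.
  rewrite integral_cst// card0/= diracT mule1 /k ltry//.
rewrite -[m.+1]/(1 + m)%N in ma *.
rewrite integral_schur; last 2 first.
- apply/measurable_EFinP; apply: measurable_funM; first exact: measurable_indic_spd.
  exact: measurable_iw_density.
- by move=> S; rewrite lee_fin mulr_ge0// iw_density_ge0.
apply: (@le_lt_trans _ _ (\int[prod_measure (prod_measure (@lebesgue_measure R)
    (lebesgue_tuple m)) (lebesgue_tuple #|{: upper_index m}|)]_z
    (iw_split a c z.1.1 (colt z.1.2) (schur_complement z.1.1 (colt z.1.2) (symt z.2)))%:E)%E).
  apply: ge0_le_integral => //.
  - by move=> z _; rewrite lee_fin mulr_ge0// iw_density_ge0.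
  - apply/measurable_EFinP; apply: measurable_funM.
      exact: (measurable_indic_spd (@measurable_schur_block m)).
    exact: (measurable_iw_density _ _ (@measurable_schur_block m)).
  - apply/measurable_EFinP; apply: measurable_iw_split.
    + exact: measurableT_comp.
    + apply: (measurableT_comp (@measurable_colt R m)); exact: measurableT_comp.
    + apply: measurable_schur_complement.
      * exact: measurableT_comp.
      * apply: (measurableT_comp (@measurable_colt R m)); exact: measurableT_comp.
      * exact: (measurableT_comp (@measurable_symt R m)).
  - by move=> z _; rewrite lee_fin; exact: iw_le_split.
rewrite integral_iw_split//.
have := IH (a - 2^-1).
rewrite integral_spd_symt; [|exact: measurable_iw_density|exact: iw_density_ge0].
set J := (\int[lebesgue_tuple #|{: upper_index m}|]_t _)%E => Joo.
have J0 : (0 <= J)%E.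
  by apply: integral_ge0 => t _; rewrite lee_fin mulr_ge0// iw_density_ge0.
have {}Joo : (J < +oo)%E.
  apply: Joo => //; move: ma; rewrite natrD => ma; rewrite ltrBrDr (le_lt_trans _ ma)//.
  by rewrite addrC lerD2r invf_le1// ler1n.
have Jfin : J \is a fin_num by rewrite ge0_fin_numE.
rewrite -(fineK Jfin).
under eq_integral do rewrite -EFinM mulrAC EFinM.
rewrite ge0_integralZl_EFin//; last 3 first.
- by move=> x _; rewrite lee_fin !mulr_ge0 ?powR_ge0 ?expR_ge0.
- apply/measurable_EFinP; exact: measurable_inverse_gamma_fun.
- by rewrite mulr_ge0 ?sqrtr_ge0// fine_ge0.
rewrite lte_mul_pinfty ?lee_fin ?mulr_ge0 ?sqrtr_ge0 ?fine_ge0//.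
by apply: inverse_gamma_lty => //; move: ma; rewrite natrD => ma; rewrite ltrBrDr.
Qed.

End inverse_wishart_finite.

(** * Integration against a density *)

Section nonneg_integrals.
Local Open Scope ereal_scope.
Context d (T : measurableType d) (R : realType) (mu : {measure set T -> \bar R}).
Implicit Types f g : T -> \bar R.

Lemma integralD_nneg f g : measurable_fun setT f -> measurable_fun setT g ->
  (forall x, 0 <= f x) -> (forall x, 0 <= g x) ->
  \int[mu]_x (f x + g x) = \int[mu]_x f x + \int[mu]_x g x.
Proof. by move=> mf mg f0 g0; rewrite ge0_integralD. Qed.

Lemma integralZl_nneg (k : R) f : (0 <= k)%R -> measurable_fun setT f ->
  (forall x, 0 <= f x) -> \int[mu]_x (k%:E * f x) = k%:E * \int[mu]_x f x.
Proof. by move=> k0 mf f0; rewrite ge0_integralZl_EFin. Qed.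

Lemma le_integral_nneg f g : measurable_fun setT f -> measurable_fun setT g ->
  (forall x, 0 <= f x) -> (forall x, f x <= g x) ->
  \int[mu]_x f x <= \int[mu]_x g x.
Proof. by move=> mf mg f0 fg; apply: ge0_le_integral. Qed.

End nonneg_integrals.

Section density.
Local Open Scope ereal_scope.
Context d (T : measurableType d) (R : realType).
Variables (nu mu : {measure set T -> \bar R}) (f : T -> R).
Hypothesis mf : measurable_fun setT f.
Hypothesis f0 : forall x, (0 <= f x)%R.
Hypothesis nuE : forall A, measurable A -> nu A = \int[mu]_(x in A) (f x)%:E.

Let mfE : measurable_fun setT (EFin \o f). Proof. exact/measurable_EFinP. Qed.

Import HBNNSimple.

Let integral_density_nnsfun (h : {nnsfun T >-> R}) :
  \int[nu]_x (h x)%:E = \int[mu]_x ((h x)%:E * (f x)%:E).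
Proof.
transitivity (\int[nu]_x (\sum_(y \in range h) (y * \1_(h @^-1` [set y]) x)%:E)).
  by apply: eq_integral => t tE; rewrite /= fimfunE -fsumEFin.
rewrite ge0_integral_fsum//; last 2 first.
- by move=> y; apply/measurable_EFinP; exact: measurable_funM.
- by move=> m y Ey; exact: nnfun_muleindic_ge0.
transitivity (\int[mu]_x (\sum_(y \in range h)
    (y * \1_(h @^-1` [set y]) x)%:E * (f x)%:E)); last first.
  apply: eq_integral => x xE.
  rewrite -ge0_mule_fsuml => [|y]; last exact: nnfun_muleindic_ge0.
  by rewrite fsumEFin // -(fimfunE _ x).
rewrite ge0_integral_fsum//; last 2 first.
- move=> y; apply: emeasurable_funM => //.
  by apply/measurable_EFinP; exact: measurable_funM.
- move=> m y Ey; apply: mule_ge0; last by rewrite lee_fin.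
  by rewrite EFinM; exact: nnfun_muleindic_ge0.
apply: eq_fsbigr => r rhn.
under [LHS]eq_integral do rewrite EFinM.
rewrite integralZl_indic_nnsfun => //.
under [RHS]eq_integral do rewrite EFinM -muleA.
have r0 : (0 <= r)%R by move: rhn; rewrite inE => -[x _ <-].
have mh : measurable (h @^-1` [set r]) by exact: measurable_sfunP.
rewrite integralZl_nneg//; last 2 first.
- by apply: emeasurable_funM => //; exact/measurable_EFinP.
- by move=> x; rewrite mule_ge0 ?lee_fin.
rewrite integral_indic// setIT nuE// integral_mkcond; congr (_ * _).
apply: eq_integral => x _; rewrite patchE indicE.
by case: ifPn => _; rewrite ?mul1e ?mul0e.
Qed.

(** Holds for simple functions by linearity; both sides pass to the limit by monotone convergence
    along the same approximation of [g]. *)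
Lemma integral_density (g : T -> \bar R) : measurable_fun setT g ->
  (forall x, 0 <= g x) -> \int[nu]_x g x = \int[mu]_x (g x * (f x)%:E).
Proof.
move=> mg g0; pose h := nnsfun_approx measurableT mg.
have -> : \int[nu]_x g x = lim (\int[nu]_x (EFin \o h n) x @[n --> \oo]).
  have gE x : g x = lim ((EFin \o h n) x @[n --> \oo]).
    by apply/esym/cvg_lim => //; exact: cvg_nnsfun_approx.
  under eq_integral do rewrite gE.
  apply: monotone_convergence => //.
  - by move=> n; exact/measurable_EFinP.
  - by move=> n x Ex //=; rewrite lee_fin.
  - by move=> x Ex a b ab; rewrite lee_fin; exact/lefP/nd_nnsfun_approx.
have -> : \int[mu]_x (g x * (f x)%:E) =
    lim (\int[mu]_x ((h n x)%:E * (f x)%:E) @[n --> \oo]).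
  have fg x : g x * (f x)%:E = lim (((h n x)%:E * (f x)%:E) @[n --> \oo]).
    by apply/esym/cvg_lim => //; apply: cvgeZr => //; exact: cvg_nnsfun_approx.
  under eq_integral do rewrite fg.
  apply: monotone_convergence => //.
  - by move=> n; apply/emeasurable_funM => //; exact/measurable_EFinP.
  - by move=> n x Ex /=; rewrite mule_ge0 ?lee_fin.
  - move=> x Ex a b ab/=; rewrite lee_wpmul2r ?lee_fin//.
    exact/lefP/nd_nnsfun_approx.
by congr (limn _); apply/funext => n; exact: integral_density_nnsfun.
Qed.

End density.

(** * Uniform ergodicity from a two-step minorization *)

Section doeblin.
Local Open Scope ereal_scope.
Context d (T : measurableType d) (R : realType).
Variable P : T -> {measure set T -> \bar R}.
Hypothesis mP : forall g : T -> \bar R, measurable_fun setT g ->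
  (forall x, 0 <= g x) -> measurable_fun setT (fun s => \int[P s]_u g u).
Hypothesis P1 : forall s, P s setT = 1.

Lemma measurable_kernel_iter t B : measurable B ->
  measurable_fun setT (fun s => kernel_iter P t s B) /\
  forall s, 0 <= kernel_iter P t s B.
Proof.
move=> mB; elim: t => [|t [mk k0]] /=; split => //.
- rewrite [X in measurable_fun _ X](_ : _ = EFin \o \1_B).
    by apply/measurable_EFinP.
  by apply/funext => s; rewrite /= diracE indicE.
- exact: mP.
- by move=> s; apply: integral_ge0 => u _.
Qed.

Lemma integral_prob_cst s (r : R) : \int[P s]_u r%:E = r%:E.
Proof. by rewrite integral_cst// P1 mule1. Qed.

Lemma prob_integral_itv s (g : T -> \bar R) (a b : R) : measurable_fun setT g ->
  (0 <= a)%R -> (forall u, a%:E <= g u <= b%:E) -> a%:E <= \int[P s]_u g u <= b%:E.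
Proof.
move=> mg a0 gab; have g0 u : 0 <= g u.
  by case/andP: (gab u) => h _; apply: le_trans h; rewrite lee_fin.
apply/andP; split.
- rewrite -[leLHS](integral_prob_cst s a); apply: le_integral_nneg => // u.
  by case/andP: (gab u).
- rewrite -[leRHS](integral_prob_cst s b); apply: le_integral_nneg => // u.
  by case/andP: (gab u).
Qed.

Variables (Pi eta : {measure set T -> \bar R}) (e : R).
Hypothesis Pi1 : Pi setT = 1.
Hypothesis PiP : forall g : T -> \bar R, measurable_fun setT g ->
  (forall x, 0 <= g x) -> \int[Pi]_s \int[P s]_u g u = \int[Pi]_u g u.
Hypothesis e0 : (0 < e)%R.
Hypothesis eta1 : eta setT = e%:E.
Hypothesis minor : forall s (g : T -> \bar R), measurable_fun setT g ->
  (forall x, 0 <= g x) -> \int[eta]_u g u <= \int[P s]_u \int[P u]_v g v.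

(** A band of width [w] contains all values. Its lower end is nonnegative so that monotonicity of
    nonnegative integrals applies. *)
Let oscillation (k : T -> \bar R) (w : R) :=
  measurable_fun setT k /\ exists2 a : R, (0 <= a)%R & forall s, a%:E <= k s <= (a + w)%:E.

(** The minorization, applied to the nonnegative functions [k - a] and [a + w - k], raises the lower
    end of the band by [A] and lowers the upper end by [B]; and [A + B = w e]. *)
Lemma doeblin_contract (k : T -> \bar R) (w : R) : oscillation k w ->
  oscillation (fun s => \int[P s]_u \int[P u]_v k v) (w * (1 - e)).
Proof.
move=> [mk [a a0 kaw]].
have k0 u : 0 <= k u by case/andP: (kaw u) => h _; apply: le_trans h; rewrite lee_fin.
have kfin u : k u \is a fin_num.
  case/andP: (kaw u) => _ h; rewrite ge0_fin_numE//; exact: le_lt_trans h (ltry _).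
pose kr u := fine (k u).
have kE u : k u = (kr u)%:E by rewrite fineK.
have mkr : measurable_fun setT kr by exact: measurableT_comp.
have lo u : (a <= kr u)%R by rewrite -lee_fin -kE; case/andP: (kaw u).
have hi u : (kr u <= a + w)%R by rewrite -lee_fin -kE; case/andP: (kaw u).
split.
  apply: (mP (mP mk k0)) => u; apply: integral_ge0 => *; exact: k0.
have mlo : measurable_fun setT (fun u => (kr u - a)%:E).
  by apply/measurable_EFinP; exact: measurable_funB.
have mhi : measurable_fun setT (fun u => (a + w - kr u)%:E).
  by apply/measurable_EFinP; exact: measurable_funB.
have lo0 u : 0 <= (kr u - a)%:E by rewrite lee_fin subr_ge0.
have hi0 u : 0 <= (a + w - kr u)%:E by rewrite lee_fin subr_ge0.
pose A := \int[eta]_u (kr u - a)%:E; pose B := \int[eta]_u (a + w - kr u)%:E.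
(* A negative width contradicts the bounds at any state. *)
have [w0|] := leP 0%R w; last first.
  move=> w0; exists a => // s.
  by have := le_trans (lo s) (hi s); rewrite lerDl leNgt w0.
have AB : A + B = (w * e)%:E.
  rewrite -ge0_integralD// (eq_integral (cst w%:E)) ?integral_cst// ?eta1//.
  by move=> u _; rewrite /= -EFinD; congr EFin; ring.
have A0 : 0 <= A by apply: integral_ge0.
have B0 : 0 <= B by apply: integral_ge0.
have Afin : A \is a fin_num.
  by rewrite ge0_fin_numE// (le_lt_trans _ (ltry (w * e)))// -AB leeDl.
have Bfin : B \is a fin_num.
  by rewrite ge0_fin_numE// (le_lt_trans _ (ltry (w * e)))// -AB leeDr.
have ABr : (fine A + fine B = w * e)%R.
  by apply: EFin_inj; rewrite EFinD !fineK.
exists (a + fine A)%R; first by rewrite addr_ge0// fine_ge0.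
move=> s; set K := \int[P s]_u _.
have K1 : K = \int[P s]_u \int[P u]_v (kr v - a)%:E + a%:E.
  rewrite -(integral_prob_cst s a) -integralD_nneg//; last 2 first.
  - exact: mP.
  - by move=> u; exact: integral_ge0.
  apply: eq_integral => u _; rewrite -(integral_prob_cst u a) -integralD_nneg//.
  by apply: eq_integral => v _; rewrite kE -EFinD subrK.
have K2 : K + \int[P s]_u \int[P u]_v (a + w - kr v)%:E = (a + w)%:E.
  rewrite -(integral_prob_cst s (a + w)) -integralD_nneg; last 4 first.
  - exact: mP.
  - exact: mP.
  - by move=> u; exact: integral_ge0.
  - by move=> u; exact: integral_ge0.
  apply: eq_integral => u _; rewrite -(integral_prob_cst u (a + w)) -integralD_nneg//.
  by apply: eq_integral => v _; rewrite kE -EFinD; congr EFin; ring.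
have h1 := minor s mlo lo0; have h2 := minor s mhi hi0.
apply/andP; split.
  by rewrite K1 addrC EFinD fineK// leeD2r.
have -> : (a + fine A + w * (1 - e) = (a + w) - fine B)%R.
  by rewrite mulrBr mulr1 -ABr; ring.
rewrite EFinB fineK// leeBrDr//; rewrite -K2 leeD2l//.
Qed.

(** The minorization spans two sweeps, so the band contracts once per pair: induction by steps of
    two, from the band [[0, 1]] at [t = 0] and [t = 1]. *)
Lemma doeblin_iter t B : measurable B ->
  oscillation (fun s => kernel_iter P t s B) ((1 - e) ^+ t./2).
Proof.
have dirac01 (u : T) : 0%:E <= \d_u B <= (1%:E : \bar R).
  by rewrite measure_ge0 /= diracE lee_fin lern1 leq_b1.
move=> mB; elim/ltn_ind: t => -[|[|t]] IH.
- split; first exact: (measurable_kernel_iter 0 mB).1.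
  by exists 0%R => // s; rewrite expr0 add0r; exact: dirac01.
- have [mk k0] := measurable_kernel_iter 0 mB.
  split; first exact: (measurable_kernel_iter 1 mB).1.
  exists 0%R => // s; rewrite expr0 add0r.
  apply: prob_integral_itv => // u.
  exact: dirac01.
- have := doeblin_contract (IH t (leqnSn _)).
  by rewrite -exprSr.
Qed.

Lemma doeblin_geometric : geometrically_ergodic P Pi.
Proof.
have Pi_iter t B : measurable B -> \int[Pi]_s kernel_iter P t s B = Pi B.
  move=> mB; elim: t => [|t IH] /=.
    transitivity (\int[Pi]_s (\1_B s)%:E); first by apply: eq_integral => s _; rewrite diracE indicE.
    by rewrite integral_indic// setIT.
  have [mk k0] := measurable_kernel_iter t mB.
  by rewrite PiP.
(* Tests the minorization on the constant 1 at some state; a state exists because [Pi] has mass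
   1. *)
have e1 : (0 <= 1 - e)%R.
  have [s] : exists s : T, True.
    apply: contrapT => nT; have := Pi1.
    rewrite (_ : setT = set0) ?measure0; last first.
      by apply/seteqP; split => // x _; apply: nT; exists x.
    by move=> /eqP; rewrite eq_sym onee_eq0.
  move=> _; have := minor s (measurable_cst 1) (fun=> lee01).
  rewrite integral_cst// mul1e eta1.
  under eq_integral do rewrite (integral_prob_cst _ 1).
  by rewrite (integral_prob_cst _ 1) lee_fin subr_ge0.
(* Halving [e] keeps the rate positive even when [e = 1]. *)
pose r := (1 - e / 2)%R.
have e2 : (e / 2 < 1)%R by rewrite ltr_pdivrMr// mul1r; lra.
have r01 : (0 < r < 1)%R by rewrite subr_gt0 e2 /= ltrBlDr ltrDl divr_gt0.
pose rho := Num.sqrt r.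
have rho0 : (0 < rho)%R by rewrite sqrtr_gt0; case/andP: r01.
have rho2 : (rho ^+ 2 = r)%R by rewrite sqr_sqrtr//; case/andP: r01 => /ltW.
(* [rho ^ 2 = r] bounds the contraction per pair of sweeps; the factor [rho^-1] pays for an unpaired
   sweep, as [2 * (t./2) >= t - 1]. *)
exists rho, (fun=> (rho^-1)%R); split.
- rewrite rho0/= -[ltRHS]sqrtr1 ltr_sqrt//; by case/andP: r01.
- by move=> s; rewrite invr_ge0 ltW.
move=> s t t0; apply: ub_ereal_sup => _ [B mB <-].
have [mk [a a0 ka]] := doeblin_iter t mB.
have w0 : (0 <= (1 - e) ^+ t./2)%R by rewrite exprn_ge0.
have PiB : a%:E <= Pi B <= (a + (1 - e) ^+ t./2)%:E.
  have cst (c : R) : \int[Pi]_s c%:E = c%:E by rewrite integral_cst// Pi1 mule1.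
  have k0 u : 0 <= kernel_iter P t u B by exact: (measurable_kernel_iter t mB).2.
  rewrite -(Pi_iter t B mB); apply/andP; split.
    rewrite -[leLHS](cst a); apply: le_integral_nneg => // u.
    by case/andP: (ka u).
  rewrite -[leRHS](cst (a + _)%R); apply: le_integral_nneg => // u.
  by case/andP: (ka u).
have : `|kernel_iter P t s B - Pi B| <= ((1 - e) ^+ t./2)%:E.
  case/andP: (ka s) => h1 h2; case/andP: PiB => h3 h4.
  have f1 : kernel_iter P t s B \is a fin_num.
    rewrite ge0_fin_numE; first exact: le_lt_trans h2 (ltry _).
    by apply: le_trans h1; rewrite lee_fin.
  have f2 : Pi B \is a fin_num by rewrite ge0_fin_numE//; exact: le_lt_trans h4 (ltry _).
  move: h1 h2 h3 h4; rewrite -(fineK f1) -(fineK f2) -EFinB abse_EFin !lee_fin => *.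
  by rewrite ler_norml; apply/andP; split; lra.
move=> /le_trans; apply; rewrite lee_fin.
have er : (1 - e <= r)%R.
  by rewrite lerD2l lerN2 ler_piMr ?(ltW e0)// invf_le1// ler1n.
apply: (@le_trans _ _ (r ^+ t./2)%R).
  by apply: lerXn2r; rewrite ?nnegrE//; case/andP: r01 => /ltW.
rewrite -rho2 -exprM ler_pdivlMl// -exprS.
apply: ler_wiXn2l; first exact: ltW.
  by rewrite -[leRHS]sqrtr1 ler_sqrt//; case/andP: r01 => _ /ltW.
by rewrite mul2n -addn1 addnC -[X in (X <= _)%N]odd_double_half leq_add2r leq_b1.
Qed.

End doeblin.

(** * Exponential tail bounds by dilation *)

Section tail_bound.
Local Open Scope ereal_scope.
Context d (T : measurableType d) (R : realType) (mu : {measure set T -> \bar R}).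

(* The dilation phi turns an exponential moment of W under the density h into the
   total mass of h, up to the constants K and C. *)
Lemma tail_bound (phi : T -> T) (h W : T -> R) (K C w : R) :
  measurable_fun setT phi -> measurable_fun setT h -> measurable_fun setT W ->
  (forall x, 0 <= h x)%R -> (0 <= K)%R ->
  (forall x, h x * expR (W x) <= K * h (phi x))%R ->
  \int[mu]_x (h (phi x))%:E = C%:E * \int[mu]_x (h x)%:E ->
  \int[mu]_(x in [set x | (w < W x)%R]) (h x)%:E <=
    (expR (- w) * K * C)%:E * \int[mu]_x (h x)%:E.
Proof.
move=> mphi mh mW h0 K0 hW hC.
have mhE : measurable_fun setT (fun x => (h x)%:E) by exact/measurable_EFinP.
rewrite integral_mkcond.
apply: (@le_trans _ _ (\int[mu]_x ((expR (- w) * K)%:E * (h (phi x))%:E))).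
  apply: ge0_le_integral => //.
  - by move=> x _; rewrite patchE; case: ifPn => // _; rewrite lee_fin.
  - apply/(measurable_restrictT _ _).1 => //; last exact: measurable_funTS.
    apply: measurable_bool_set; exact: measurable_fun_ltr.
  - apply: emeasurable_funM => //; apply/measurable_EFinP; exact: measurableT_comp.
  - move=> x _; rewrite patchE; case: ifPn => [|_]; last first.
      by rewrite mule_ge0// lee_fin// mulr_ge0// expR_ge0.
    rewrite inE/= => wW; rewrite -EFinM lee_fin -mulrA.
    apply: le_trans (ler_wpM2l (expR_ge0 _) (hW x)).
    by rewrite mulrCA -expRD ler_peMr// -expR0 ler_expR addrC subr_ge0 ltW.
rewrite integralZl_nneg//; last 3 first.
- by rewrite mulr_ge0// expR_ge0.
- by apply/measurable_EFinP; exact: measurableT_comp.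
- by move=> x; rewrite lee_fin.
by rewrite hC muleA -EFinM.
Qed.

End tail_bound.

(** * Full conditionals and the scan as iterated integrals *)

Section full_conditional_density.
Local Open Scope ereal_scope.
Context d d' (X : measurableType d) (Y : measurableType d') (R : realType).
Variables (mu : {sigma_finite_measure set Y -> \bar R}) (f : X * Y -> R).
Variables (mf : measurable_fun setT f) (f0 : forall z, (0 <= f z)%R).
Variables (x : X) (c : R) (g : Y -> R).
Hypothesis c0 : (0 < c)%R.
Hypothesis mg : measurable_fun setT g.
Hypothesis g0 : forall y, (0 <= g y)%R.
Hypothesis fg : forall y, f (x, y) = (c * g y)%R.
Hypothesis Z0 : 0 < \int[mu]_y (g y)%:E.
Hypothesis Zoo : \int[mu]_y (g y)%:E < +oo.

Let Z := \int[mu]_y (g y)%:E.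

Let Zfin : Z \is a fin_num. Proof. by rewrite ge0_fin_numE// ltW. Qed.

Let fineZ : (0 < fine Z)%R. Proof. by rewrite fine_gt0// Z0 Zoo. Qed.

(** The factor [c] carries what depends on the conditioning variables only, and cancels. Positive
    finite mass excludes the Dirac default of the normalization. *)
Lemma full_conditionalE A : measurable A ->
  full_conditional mu mf f0 x A = \int[mu]_(y in A) (g y / fine Z)%:E.
Proof.
move=> mA.
have kE B : measurable B ->
    mdensity_kernel mu mf f0 x B = c%:E * \int[mu]_(y in B) (g y)%:E.
  move=> mB; rewrite -ge0_integralZl_EFin//; last 3 first.
  - by move=> y _; rewrite lee_fin.
  - by apply: measurable_funTS; exact/measurable_EFinP.
  - exact: ltW.
  by apply: eq_integral => y _; rewrite fg EFinM.
have kT : mdensity_kernel mu mf f0 x setT = (c * fine Z)%:E.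
  by rewrite kE// EFinM fineK.
rewrite /full_conditional /= /knormalize /mnormalize /= kT.
rewrite eqe mulf_eq0 (gt_eqF c0) (gt_eqF fineZ)/=.
rewrite -[density_kernel mu mf f0 x A]/(mdensity_kernel mu mf f0 x A) kE//.
under [RHS]eq_integral do rewrite mulrC EFinM.
rewrite ge0_integralZl_EFin//; last 3 first.
- by move=> y _; rewrite lee_fin.
- by apply: measurable_funTS; exact/measurable_EFinP.
- by rewrite invr_ge0 ltW.
rewrite muleAC -EFinM; congr (_ * _); congr EFin; field.
by rewrite !gt_eqF.
Qed.

Lemma integral_full_conditional (h : Y -> \bar R) : measurable_fun setT h ->
  (forall y, 0 <= h y) ->
  \int[full_conditional mu mf f0 x]_y h y = \int[mu]_y (h y * (g y / fine Z)%:E).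
Proof.
move=> mh h0; apply: integral_density => //.
- by apply: measurable_funM.
- by move=> y; rewrite divr_ge0// ltW.
- exact: full_conditionalE.
Qed.

End full_conditional_density.

Section sweep.
Local Open Scope ereal_scope.
Context d0 d1 d2 d3 d1' d2' d3' (T : measurableType d0)
  (Z1 : measurableType d1) (Z2 : measurableType d2) (Z3 : measurableType d3)
  (U1 : measurableType d1') (U2 : measurableType d2') (U3 : measurableType d3')
  (R : realType).
Variables (k1 : R.-pker U1 ~> Z1) (k2 : R.-pker U2 ~> Z2) (k3 : R.-pker U3 ~> Z3).
Variables (g1 : T -> U1) (g2 : T * Z1 -> U2) (g3 : T * Z1 * Z2 -> U3).
Variable new : T * Z1 * Z2 * Z3 -> T.
Hypotheses (m1 : measurable_fun setT g1) (m2 : measurable_fun setT g2)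
  (m3 : measurable_fun setT g3) (mnew : measurable_fun setT new).

(** An abstract scan with the shape of [gibbs_kernel]; the measurability proofs enclosed in the
    latter are recovered by unification. *)
Definition sweep : T -> {measure set T -> \bar R} :=
  (precomp_kernel k1 m1 \; (precomp_kernel k2 m2 \; (precomp_kernel k3 m3 \; kdirac mnew)))%E.

Lemma integral_sweep s (h : T -> \bar R) : measurable_fun setT h -> (forall s, 0 <= h s) ->
  \int[sweep s]_u h u =
  \int[k1 (g1 s)]_z1 \int[k2 (g2 (s, z1))]_z2 \int[k3 (g3 (s, z1, z2))]_z3
    h (new (s, z1, z2, z3)).
Proof.
move=> mh h0; rewrite /sweep integral_kcomp//; apply: eq_integral => z1 _.
rewrite integral_kcomp//; apply: eq_integral => z2 _.
rewrite integral_kcomp//; apply: eq_integral => z3 _.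
by rewrite /kdirac/= integral_dirac// diracT mul1e.
Qed.

Lemma measurable_integral_sweep (h : T -> \bar R) :
  measurable_fun setT h -> (forall s, 0 <= h s) ->
  measurable_fun setT (fun s => \int[sweep s]_u h u).
Proof.
move=> mh h0; apply: measurable_fun_integral_kernel => // U mU.
rewrite /sweep; exact: measurable_kernel.
Qed.

Lemma sweepT s : sweep s setT = 1.
Proof.
have int1 d' (Y : measurableType d') (mu : {measure set Y -> \bar R}) :
    \int[mu]_y cst 1 y = mu setT.
  by rewrite integral_cst ?mul1e//; exact: measurableT.
rewrite -(int1 _ _ (sweep s)) (integral_sweep s (measurable_cst 1) (fun=> lee01)).
transitivity (\int[k1 (g1 s)]_z1 cst 1 z1); last by rewrite int1 prob_kernel.
apply: eq_integral => z1 _.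
transitivity (\int[k2 (g2 (s, z1))]_z2 cst 1 z2); last by rewrite int1 prob_kernel.
apply: eq_integral => z2 _.
transitivity (\int[k3 (g3 (s, z1, z2))]_z3 cst 1 z3); last by rewrite int1 prob_kernel.
by [].
Qed.

End sweep.

Section gibbs_integral.
Local Open Scope ereal_scope.
Context {R : realType} {m n p q : nat} (M : eiv_model R m n p q).
Local Notation matA := 'M[R]_(n, p).
Local Notation coef := ('cV[R]_(m * q) * 'cV[R]_(m * p))%type.
Local Notation state := ('M[R]_(n, p) * coef * spd R m)%type.

Lemma integral_gibbs_kernel A b S (h : state -> \bar R) :
  measurable_fun setT h -> (forall s, 0 <= h s) ->
  \int[gibbs_kernel M (A, b, S)]_s h s =
  \int[conditional_Sigma M (A, b)]_S' \int[conditional_coef M (A, S')]_b'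
    \int[conditional_A M (b', S')]_A' h (A', b', S').
Proof.
move=> mh h0; rewrite /gibbs_kernel.
exact: (@integral_sweep _ _ _ _ _ _ _ _ _ _ _ _ _ _ _ _ _ _ _ _ _ _ _ _ _ _ (A, b, S) h mh h0).
Qed.

Lemma measurable_integral_gibbs_kernel (h : state -> \bar R) :
  measurable_fun setT h -> (forall s, 0 <= h s) ->
  measurable_fun setT (fun s => \int[gibbs_kernel M s]_u h u).
Proof.
move=> mh h0; rewrite /gibbs_kernel; exact: (measurable_integral_sweep _ _ _ _ _ _ _ mh h0).
Qed.

Lemma gibbs_kernelT s : gibbs_kernel M s setT = 1.
Proof. rewrite /gibbs_kernel; exact: (sweepT (conditional_Sigma M)). Qed.

End gibbs_integral.

(** * Invariance and minorization for a scan over three blocks *)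

Section triple_tonelli.
Local Open Scope ereal_scope.
Context d1 d2 d3 (X : measurableType d1) (Y : measurableType d2)
  (Z : measurableType d3) (R : realType).
Variables (mu : {sigma_finite_measure set X -> \bar R})
  (nu : {sigma_finite_measure set Y -> \bar R})
  (la : {sigma_finite_measure set Z -> \bar R}).

Definition measurable3 (F : X -> Y -> Z -> \bar R) :=
  measurable_fun setT (fun s : X * Y * Z => F s.1.1 s.1.2 s.2).

Variable F : X -> Y -> Z -> \bar R.
Hypothesis mF : measurable3 F.
Hypothesis F0 : forall x y z, 0 <= F x y z.

Lemma measurable_integral3 :
  measurable_fun setT (fun s : X * Y => \int[la]_z F s.1 s.2 z).
Proof.
exact: (@measurable_fun_fubini_tonelli_F _ _ _ _ _ la
  (fun s : X * Y * Z => F s.1.1 s.1.2 s.2)).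
Qed.

Lemma tonelli3_23 :
  \int[mu]_x \int[nu]_y \int[la]_z F x y z = \int[mu]_x \int[la]_z \int[nu]_y F x y z.
Proof.
apply: eq_integral => x _; apply: tonelli => //.
have : measurable_fun setT (fun z : Y * Z => (x, z.1, z.2)).
  by do 2 (apply: measurable_fun_pair => //).
by move=> mg; exact: (measurableT_comp mF mg).
Qed.

Lemma tonelli3_12 :
  \int[mu]_x \int[nu]_y \int[la]_z F x y z = \int[nu]_y \int[mu]_x \int[la]_z F x y z.
Proof.
apply: (@tonelli _ _ _ _ _ mu nu (fun x y => \int[la]_z F x y z)).
  exact: measurable_integral3.
by move=> x y; exact: integral_ge0.
Qed.

Lemma integral_prod3 :
  \int[prod_measure (prod_measure mu nu) la]_s F s.1.1 s.1.2 s.2 =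
  \int[mu]_x \int[nu]_y \int[la]_z F x y z.
Proof.
rewrite integral_prod_measure// (integral_prod_measure mu nu)//.
  exact: measurable_integral3.
by move=> s; exact: integral_ge0.
Qed.

End triple_tonelli.

Section triple_perm.
Local Open Scope ereal_scope.
Context d1 d2 d3 (X : measurableType d1) (Y : measurableType d2)
  (Z : measurableType d3) (R : realType).
Implicit Types F : X -> Y -> Z -> \bar R.

Lemma measurable3_23 F : measurable3 F -> measurable3 (fun x z y => F x y z).
Proof.
move=> mF; have : measurable_fun setT (fun s : X * Z * Y => (s.1.1, s.2, s.1.2)).
  apply: measurable_fun_pair; last exact: measurableT_comp.
  by apply: measurable_fun_pair => //; exact: measurableT_comp.
by move=> mg; exact: (measurableT_comp mF mg).
Qed.

Lemma measurable3_12 F : measurable3 F -> measurable3 (fun y x z => F x y z).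
Proof.
move=> mF; have : measurable_fun setT (fun s : Y * X * Z => (s.1.2, s.1.1, s.2)).
  apply: measurable_fun_pair => //.
  by apply: measurable_fun_pair; exact: measurableT_comp.
by move=> mg; exact: (measurableT_comp mF mg).
Qed.

End triple_perm.

Section three_block.
Local Open Scope ereal_scope.
Context d1 d2 d3 (X : measurableType d1) (Y : measurableType d2)
  (Z : measurableType d3) (R : realType).
Variables (mu : {sigma_finite_measure set X -> \bar R})
  (nu : {sigma_finite_measure set Y -> \bar R})
  (la : {sigma_finite_measure set Z -> \bar R}).
Variables (f : X -> Y -> Z -> R) (pX : X -> Y -> Z -> R) (pY : X -> Y -> Z -> R)
  (pZ : X -> Y -> Z -> R).
Hypotheses (mf : measurable3 (fun x y z => (f x y z)%:E))
  (mpX : measurable3 (fun x y z => (pX x y z)%:E))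
  (mpY : measurable3 (fun x y z => (pY x y z)%:E))
  (mpZ : measurable3 (fun x y z => (pZ x y z)%:E)).
Hypotheses (f0 : forall x y z, (0 <= f x y z)%R)
  (pX0 : forall x y z, (0 <= pX x y z)%R) (pY0 : forall x y z, (0 <= pY x y z)%R)
  (pZ0 : forall x y z, (0 <= pZ x y z)%R).
Variables (NX : Y -> Z -> R) (NY : X -> Z -> R) (NZ : X -> Y -> R).
Hypotheses (NX0 : forall y z, (0 <= NX y z)%R) (NY0 : forall x z, (0 <= NY x z)%R)
  (NZ0 : forall x y, (0 <= NZ x y)%R).
Hypotheses (fX : forall x y z, f x y z = (NX y z * pX x y z)%R)
  (fY : forall x y z, f x y z = (NY x z * pY x y z)%R)
  (fZ : forall x y z, f x y z = (NZ x y * pZ x y z)%R).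
Hypotheses (pX1 : forall y z, \int[mu]_x (pX x y z)%:E = 1)
  (pY1 : forall x z, \int[nu]_y (pY x y z)%:E = 1)
  (pZ1 : forall x y, \int[la]_z (pZ x y z)%:E = 1).

(** [g] is a constant times the probability density [p], so averaging [H] under [p] before
    integrating against [g] changes nothing. *)
Lemma block_invariant d (V : measurableType d) (ro : {measure set V -> \bar R})
    (p g : V -> R) (N : R) (H : V -> \bar R) :
  measurable_fun setT (fun v => (p v)%:E) -> measurable_fun setT H ->
  (forall v, (0 <= p v)%R) -> (forall v, 0 <= H v) -> (0 <= N)%R ->
  (forall v, g v = (N * p v)%R) -> \int[ro]_v (p v)%:E = 1 ->
  \int[ro]_v ((\int[ro]_u (H u * (p u)%:E)) * (g v)%:E) = \int[ro]_v (H v * (g v)%:E).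
Proof.
move=> mp mH p0 H0 N0 gE p1.
have I0 : 0 <= \int[ro]_u (H u * (p u)%:E).
  by apply: integral_ge0 => u _; rewrite mule_ge0 ?lee_fin.
under eq_integral do rewrite gE EFinM muleCA.
rewrite integralZl_nneg//; last 2 first.
- by apply: emeasurable_funM.
- by move=> v; rewrite mule_ge0 ?lee_fin.
rewrite ge0_integralZl//; last by move=> v _; rewrite lee_fin.
rewrite p1 mule1 -integralZl_nneg//; last 2 first.
- exact: emeasurable_funM.
- by move=> v; rewrite mule_ge0 ?lee_fin.
by apply: eq_integral => v _; rewrite gE EFinM muleCA.
Qed.

Variable h : X -> Y -> Z -> \bar R.
Hypotheses (mh : measurable3 h) (h0 : forall x y z, 0 <= h x y z).

(** Nested updates, the last one innermost: [Z] is redrawn first, then [Y], then [X]. Thus [sweepZ]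
    is the action of a whole sweep on [h], a function of the current [(x, y)] alone. *)
Definition sweepX y z := \int[mu]_x (h x y z * (pX x y z)%:E).
Definition sweepY x z := \int[nu]_y (sweepX y z * (pY x y z)%:E).
Definition sweepZ x y := \int[la]_z (sweepY x z * (pZ x y z)%:E).

Lemma sweepX_ge0 y z : 0 <= sweepX y z.
Proof. by apply: integral_ge0 => x _; rewrite mule_ge0 ?lee_fin. Qed.

Lemma sweepY_ge0 x z : 0 <= sweepY x z.
Proof. by apply: integral_ge0 => y _; rewrite mule_ge0 ?lee_fin ?sweepX_ge0. Qed.

Let m3M (F G : X -> Y -> Z -> \bar R) : measurable3 F -> measurable3 G ->
  measurable3 (fun x y z => F x y z * G x y z).
Proof. by move=> mF mG; exact: emeasurable_funM. Qed.

Let m12 d1' d2' d3' (X' : measurableType d1') (Y' : measurableType d2') (Z' : measurableType d3')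
  (F : X' -> Y' -> \bar R) : measurable_fun setT (fun s => F s.1 s.2) ->
  measurable3 (fun x y (_ : Z') => F x y).
Proof. by move=> mF; exact: (measurableT_comp mF). Qed.

Lemma measurable_sweepX : measurable_fun setT (fun s => sweepX s.1 s.2).
Proof.
apply: (@measurable_integral3 _ _ _ Y Z X _ mu (fun y z x => h x y z * (pX x y z)%:E)).
  apply: (@measurable3_23 _ _ _ Y X Z _ (fun y x z => h x y z * (pX x y z)%:E)).
  by apply: measurable3_12; exact: m3M.
by move=> y z x; rewrite mule_ge0 ?lee_fin.
Qed.

Let m3sweepX : measurable3 (fun (_ : X) y z => sweepX y z).
Proof.
apply: (@measurable3_12 _ _ _ Y X Z _ (fun y _ z => sweepX y z)).
by apply: (@measurable3_23 _ _ _ Y Z X _ (fun y z _ => sweepX y z)); exact: m12 measurable_sweepX.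
Qed.

Lemma measurable_sweepY : measurable_fun setT (fun s => sweepY s.1 s.2).
Proof.
apply: (@measurable_integral3 _ _ _ X Z Y _ nu (fun x z y => sweepX y z * (pY x y z)%:E)).
  by apply: measurable3_23; exact: m3M.
by move=> x z y; rewrite mule_ge0 ?lee_fin ?sweepX_ge0.
Qed.

Let m3sweepY : measurable3 (fun x (_ : Y) z => sweepY x z).
Proof.
by apply: (@measurable3_23 _ _ _ X Z Y _ (fun x z _ => sweepY x z)); exact: m12 measurable_sweepY.
Qed.

Let section2 d1' d2' (U : measurableType d1') (V : measurableType d2') (F : U -> V -> \bar R) u :
  measurable_fun setT (fun s => F s.1 s.2) -> measurable_fun setT (F u).
Proof.
move=> mF; have : measurable_fun setT (fun v : V => (u, v)) by exact: measurable_fun_pair.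
by move=> mg; exact: (measurableT_comp mF mg).
Qed.

Let section2' d1' d2' (U : measurableType d1') (V : measurableType d2') (F : U -> V -> \bar R) v :
  measurable_fun setT (fun s => F s.1 s.2) -> measurable_fun setT (F ^~ v).
Proof.
move=> mF; have : measurable_fun setT (fun u : U => (u, v)) by exact: measurable_fun_pair.
by move=> mg; exact: (measurableT_comp mF mg).
Qed.

Let section3 (F : X -> Y -> Z -> \bar R) x y : measurable3 F -> measurable_fun setT (F x y).
Proof.
move=> mF; have : measurable_fun setT (fun z : Z => (x, y, z)).
  by do 2 (apply: measurable_fun_pair => //).
by move=> mg; exact: (measurableT_comp mF mg).
Qed.

Let section3y (F : X -> Y -> Z -> \bar R) x z : measurable3 F ->
  measurable_fun setT (fun y => F x y z).
Proof.
move=> mF; have : measurable_fun setT (fun y : Y => (x, y, z)).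
  by do 2 (apply: measurable_fun_pair => //).
by move=> mg; exact: (measurableT_comp mF mg).
Qed.

Let section3x (F : X -> Y -> Z -> \bar R) y z : measurable3 F ->
  measurable_fun setT (fun x => F x y z).
Proof.
move=> mF; have : measurable_fun setT (fun x : X => (x, y, z)).
  by do 2 (apply: measurable_fun_pair => //).
by move=> mg; exact: (measurableT_comp mF mg).
Qed.

(** Each block update preserves the law with density [f]. Tonelli puts the updated variable
    innermost, and the updates are removed from the first to the last. *)
Lemma sweep_invariant :
  \int[mu]_x \int[nu]_y \int[la]_z (sweepZ x y * (f x y z)%:E) =
  \int[mu]_x \int[nu]_y \int[la]_z (h x y z * (f x y z)%:E).
Proof.
transitivity (\int[mu]_x \int[nu]_y \int[la]_z (sweepY x z * (f x y z)%:E)).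
  apply: eq_integral => x _; apply: eq_integral => y _.
  apply: (block_invariant (N := NZ x y)) => //.
  - exact: section3 mpZ.
  - exact: section2 measurable_sweepY.
  - by move=> z; exact: sweepY_ge0.
rewrite tonelli3_23; last 2 first.
- exact: m3M.
- by move=> x y z; rewrite mule_ge0 ?lee_fin ?sweepY_ge0.
transitivity (\int[mu]_x \int[la]_z \int[nu]_y (sweepX y z * (f x y z)%:E)).
  apply: eq_integral => x _; apply: eq_integral => z _.
  apply: (block_invariant (N := NY x z)) => //.
  - exact: section3y mpY.
  - exact: section2' measurable_sweepX.
  - by move=> y; exact: sweepX_ge0.
have toX (G : X -> Y -> Z -> \bar R) : measurable3 G -> (forall x y z, 0 <= G x y z) ->
    \int[mu]_x \int[nu]_y \int[la]_z G x y z = \int[nu]_y \int[la]_z \int[mu]_x G x y z.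
  move=> mG G0; rewrite tonelli3_12// (tonelli3_23 _ _ _ (measurable3_12 mG))//.
rewrite -tonelli3_23; last 2 first.
- exact: m3M.
- by move=> x y z; rewrite mule_ge0 ?lee_fin ?sweepX_ge0.
rewrite !toX; last 4 first.
- exact: m3M.
- by move=> x y z; rewrite mule_ge0 ?lee_fin.
- exact: m3M.
- by move=> x y z; rewrite mule_ge0 ?lee_fin ?sweepX_ge0.
apply: eq_integral => y _; apply: eq_integral => z _.
apply: (block_invariant (N := NX y z)) => //.
- exact: section3x mpX.
- exact: section3x mh.
Qed.

(** The product bounding [G] is the transition density from [(x, y)] to [(x', y', z')]: [z'] is
    drawn given the old pair, [y'] given the old [x] and [z'], and [x'] given new values only. *)
Lemma sweep_ge (G : X -> Y -> Z -> R) x y :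
  measurable3 (fun x y z => (G x y z)%:E) -> (forall x y z, 0 <= G x y z)%R ->
  (forall x' y' z', G x' y' z' <= pX x' y' z' * pY x y' z' * pZ x y z')%R ->
  \int[mu]_x \int[nu]_y \int[la]_z (h x y z * (G x y z)%:E) <= sweepZ x y.
Proof.
move=> mG G0 GE.
have mhG : measurable3 (fun x y z => h x y z * (G x y z)%:E) by exact: m3M.
have hG0 x' y' z' : 0 <= h x' y' z' * (G x' y' z')%:E by rewrite mule_ge0 ?lee_fin.
have -> : \int[mu]_x \int[nu]_y \int[la]_z (h x y z * (G x y z)%:E) =
    \int[la]_z \int[nu]_y \int[mu]_x (h x y z * (G x y z)%:E).
  (* The order [z], [y], [x] from the outside is the nesting of [sweepZ], so that the comparison can
     be made under each integral sign in turn. *)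
  rewrite tonelli3_23// (tonelli3_12 _ _ _ (measurable3_23 mhG))//.
  by rewrite (tonelli3_23 _ _ _ (measurable3_12 (measurable3_23 mhG))).
have mhG' : measurable3 (fun z y x => h x y z * (G x y z)%:E).
  exact (measurable3_23 (measurable3_12 (measurable3_23 mhG))).
rewrite /sweepZ; apply: ge0_le_integral => //.
- by move=> z _; do 2 (apply: integral_ge0 => ? _).
- apply: (@measurable_fun_fubini_tonelli_F _ _ Z Y _ nu
    (fun s : Z * Y => \int[mu]_x (h x s.2 s.1 * (G x s.2 s.1)%:E))).
    exact: (@measurable_integral3 _ _ _ Z Y X _ mu _ mhG').
  by move=> s; exact: integral_ge0.
- apply: emeasurable_funM; first exact: section2 measurable_sweepY.
  exact: section3 mpZ.
move=> z _; rewrite -ge0_integralZr//; last 3 first.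
- apply: emeasurable_funM; first exact: section2' measurable_sweepX.
  exact: section3y mpY.
- by move=> y' _; rewrite mule_ge0 ?lee_fin ?sweepX_ge0.
- by rewrite lee_fin.
apply: ge0_le_integral => //.
- by move=> y' _; exact: integral_ge0.
- exact: (@section2 _ _ Z Y (fun z y => \int[mu]_x (h x y z * (G x y z)%:E)) z
    (@measurable_integral3 _ _ _ Z Y X _ mu _ mhG' (fun z y x => hG0 x y z))).
- apply: emeasurable_funM; last exact: measurable_cst.
  apply: emeasurable_funM; first exact: section2' measurable_sweepX.
  exact: section3y mpY.
move=> y' _; rewrite -muleA -EFinM -ge0_integralZr//; last 3 first.
- apply: emeasurable_funM; [exact: section3x mh|exact: section3x mpX].
- by move=> x' _; rewrite mule_ge0 ?lee_fin.
- by rewrite lee_fin mulr_ge0.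
apply: ge0_le_integral => //.
- exact: section3x mhG.
- apply: emeasurable_funM; last exact: measurable_cst.
  by apply: emeasurable_funM; [exact: section3x mh|exact: section3x mpX].
move=> x' _; rewrite -muleA -EFinM; apply: lee_wpmul2l => //.
by rewrite lee_fin mulrA.
Qed.

End three_block.

(** * Geometric ergodicity of a three-block scan with a small set *)

Section three_block_ergodic.
Local Open Scope ereal_scope.
Context d1 d2 d3 (X : measurableType d1) (Y : measurableType d2)
  (Z : measurableType d3) (R : realType).
Variables (mu : {sigma_finite_measure set X -> \bar R})
  (nu : {sigma_finite_measure set Y -> \bar R})
  (la : {sigma_finite_measure set Z -> \bar R}).
Variables (f : X -> Y -> Z -> R) (pX : X -> Y -> Z -> R) (pY : X -> Y -> Z -> R)
  (pZ : X -> Y -> Z -> R).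
Hypotheses (mf : measurable3 (fun x y z => (f x y z)%:E))
  (mpX : measurable3 (fun x y z => (pX x y z)%:E))
  (mpY : measurable3 (fun x y z => (pY x y z)%:E))
  (mpZ : measurable3 (fun x y z => (pZ x y z)%:E)).
Hypotheses (f0 : forall x y z, (0 <= f x y z)%R)
  (pX0 : forall x y z, (0 <= pX x y z)%R) (pY0 : forall x y z, (0 <= pY x y z)%R)
  (pZ0 : forall x y z, (0 <= pZ x y z)%R).
Variables (NX : Y -> Z -> R) (NY : X -> Z -> R) (NZ : X -> Y -> R).
Hypotheses (NX0 : forall y z, (0 <= NX y z)%R) (NY0 : forall x z, (0 <= NY x z)%R)
  (NZ0 : forall x y, (0 <= NZ x y)%R).
Hypotheses (fX : forall x y z, f x y z = (NX y z * pX x y z)%R)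
  (fY : forall x y z, f x y z = (NY x z * pY x y z)%R)
  (fZ : forall x y z, f x y z = (NZ x y * pZ x y z)%R).
Hypotheses (pX1 : forall y z, \int[mu]_x (pX x y z)%:E = 1)
  (pY1 : forall x z, \int[nu]_y (pY x y z)%:E = 1)
  (pZ1 : forall x y, \int[la]_z (pZ x y z)%:E = 1).

Local Notation ro := (prod_measure (prod_measure mu nu) la).

Variable P : X * Y * Z -> {measure set (X * Y * Z) -> \bar R}.
Hypothesis mP : forall g : X * Y * Z -> \bar R, measurable_fun setT g ->
  (forall s, 0 <= g s) -> measurable_fun setT (fun s => \int[P s]_u g u).
Hypothesis P1 : forall s, P s setT = 1.
Hypothesis PE : forall (h : X * Y * Z -> \bar R) x y z, measurable_fun setT h ->
  (forall s, 0 <= h s) ->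
  \int[P (x, y, z)]_u h u = sweepZ mu nu la pX pY pZ (fun x y z => h (x, y, z)) x y.
Variable Pi : {measure set (X * Y * Z) -> \bar R}.
Hypothesis PiE : forall A, measurable A -> Pi A = \int[ro]_(s in A) (f s.1.1 s.1.2 s.2)%:E.
Hypothesis Pi1 : Pi setT = 1.
Variables (C : set (X * Y)) (dl : R) (G : X -> Y -> Z -> R).
Hypotheses (mC : measurable C) (dl0 : (0 < dl)%R)
  (PC : forall s, dl%:E <= P s (C `*` setT)).
Hypotheses (mG : measurable3 (fun x y z => (G x y z)%:E))
  (G0 : forall x y z, (0 <= G x y z)%R)
  (Gle : forall x y, C (x, y) ->
    forall x' y' z', (G x' y' z' <= pX x' y' z' * pY x y' z' * pZ x y z')%R)
  (Gpos : 0 < \int[ro]_s (G s.1.1 s.1.2 s.2)%:E).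

Let m3h (h : X * Y * Z -> \bar R) : measurable_fun setT h ->
  measurable3 (fun x y z => h (x, y, z)).
Proof. by rewrite /measurable3; congr (measurable_fun _ _); apply/funext => -[[x y] z]. Qed.

Let P_ge s (h : X * Y * Z -> \bar R) : measurable_fun setT h -> (forall s, 0 <= h s) ->
  C s.1 -> \int[ro]_s (h s * (G s.1.1 s.1.2 s.2)%:E) <= \int[P s]_u h u.
Proof.
case: s => -[x y] z /= mh h0 Cxy; rewrite PE//.
apply: (@le_trans _ _ (\int[mu]_x \int[nu]_y \int[la]_z (h (x, y, z) * (G x y z)%:E))); last first.
  by apply: sweep_ge => //; [exact: m3h|exact: Gle].
rewrite le_eqVlt; apply/orP; left; apply/eqP.
rewrite -(@integral_prod3 _ _ _ X Y Z R mu nu la (fun x y z => h (x, y, z) * (G x y z)%:E)).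
- by apply: eq_integral => -[[x' y'] z'] _.
- by apply: emeasurable_funM; [exact: m3h|exact: mG].
- by move=> *; rewrite mule_ge0 ?lee_fin.
Qed.

(** From any state the first sweep enters [C] with probability at least [dl], and from [C] the
    second sweep has density at least [G]. The minorizing measure therefore has density [dl * G]. *)
Lemma three_block_geometric : geometrically_ergodic P Pi.
Proof.
have mdG : measurable_fun setT (fun z : unit * (X * Y * Z) => dl * G z.2.1.1 z.2.1.2 z.2.2)%R.
  apply: measurable_funM => //.
  have mG' : measurable_fun setT (fun s : X * Y * Z => G s.1.1 s.1.2 s.2).
    exact/measurable_EFinP.
  by apply: (measurableT_comp mG'); exact: measurable_snd.
have dG0 (z : unit * (X * Y * Z)) : (0 <= dl * G z.2.1.1 z.2.1.2 z.2.2)%R.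
  by rewrite mulr_ge0// ltW.
(* A kernel from the one-point type is a measure with prescribed density. *)
pose eta := mdensity_kernel ro mdG dG0 tt.
have etaE (g : X * Y * Z -> \bar R) : measurable_fun setT g -> (forall s, 0 <= g s) ->
    \int[eta]_s g s = dl%:E * \int[ro]_s (g s * (G s.1.1 s.1.2 s.2)%:E).
  move=> mg g0.
  rewrite (@integral_density _ _ _ eta ro (fun s => dl * G s.1.1 s.1.2 s.2)%R)//.
  - rewrite -integralZl_nneg; last 3 first.
    + exact: ltW.
    + by apply: emeasurable_funM => //; exact: mG.
    + by move=> s; rewrite mule_ge0 ?lee_fin.
    by apply: eq_integral => s _; rewrite EFinM muleCA.
  - apply: measurable_funM => //; exact/measurable_EFinP.
  - by move=> s; rewrite mulr_ge0// ltW.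
have [s0 _] : exists s : X * Y * Z, True.
  apply: contrapT => nT; have := Pi1.
  rewrite (_ : setT = set0) ?measure0; last first.
    by apply/seteqP; split => // x _; apply: nT; exists x.
  by move=> /eqP; rewrite eq_sym onee_eq0.
have minor s (g : X * Y * Z -> \bar R) : measurable_fun setT g -> (forall s, 0 <= g s) ->
    \int[eta]_u g u <= \int[P s]_u \int[P u]_v g v.
  move=> mg g0; rewrite etaE//; set J := \int[ro]_s _.
  have J0 : 0 <= J by apply: integral_ge0 => u _; rewrite mule_ge0 ?lee_fin.
  apply: (@le_trans _ _ (\int[P s]_(u in C `*` setT) J)).
    rewrite integral_cst//; last exact: measurableX.
    by rewrite muleC; apply: lee_wpmul2l.
  rewrite integral_mkcond; apply: ge0_le_integral => //.
  - by move=> u _; rewrite patchE; case: ifPn.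
  - apply/(measurable_restrictT _ _).1 => //; exact: measurableX.
  - exact: mP.
  move=> u _; rewrite patchE; case: ifPn => [|_].
    by rewrite inE => -[Cu _]; exact: P_ge.
  by apply: integral_ge0 => *; exact: g0.
have eta1 : eta setT = dl%:E * \int[ro]_s (G s.1.1 s.1.2 s.2)%:E.
  transitivity (\int[eta]_s cst 1 s); first by rewrite integral_cst// mul1e.
  rewrite etaE//; congr (_ * _).
  by apply: eq_integral => s _; rewrite mul1e.
have etale : eta setT <= 1.
  have := minor s0 (cst 1) (measurable_cst 1) (fun=> lee01).
  rewrite integral_cst// mul1e => /le_trans; apply.
  under eq_integral do rewrite integral_cst// mul1e P1.
  by rewrite integral_cst// mul1e P1.
have etafin : eta setT \is a fin_num.
  by rewrite ge0_fin_numE// (le_lt_trans etale)// ltry.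
apply: (@doeblin_geometric _ _ _ P mP P1 Pi eta (fine (eta setT))).
- exact: Pi1.
- move=> g mg g0.
  have mPg := mP mg g0.
  have Pg0 s : 0 <= \int[P s]_u g u by apply: integral_ge0 => *; exact: g0.
  have mf' : measurable_fun setT (fun s : X * Y * Z => f s.1.1 s.1.2 s.2).
    exact/measurable_EFinP.
  have PiI (k : X * Y * Z -> \bar R) : measurable_fun setT k -> (forall s, 0 <= k s) ->
      \int[Pi]_s k s = \int[mu]_x \int[nu]_y \int[la]_z (k (x, y, z) * (f x y z)%:E).
    move=> mk k0; rewrite (@integral_density _ _ _ Pi ro _ mf')//.
    rewrite -(@integral_prod3 _ _ _ X Y Z R mu nu la (fun x y z => k (x, y, z) * (f x y z)%:E)).
    + by apply: eq_integral => -[[x' y'] z'] _.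
    + by apply: emeasurable_funM; [exact: m3h|exact: mf].
    + by move=> *; rewrite mule_ge0 ?lee_fin.
  rewrite (PiI _ mPg Pg0) (PiI _ mg g0).
  rewrite -(sweep_invariant mf mpX mpY mpZ f0 pX0 pY0 pZ0 NX0 NY0 NZ0 fX fY fZ pX1 pY1 pZ1
    (m3h mg) (fun x y z => g0 (x, y, z))).
  apply: eq_integral => x _; apply: eq_integral => y _; apply: eq_integral => z _.
  by rewrite PE.
- by rewrite fine_gt0// eta1 mule_gt0 ?lte_fin//= -eta1 (le_lt_trans etale)// ltry.
- by rewrite fineK.
- exact: minor.
Qed.

End three_block_ergodic.

(** * Positivity of integrals, and estimates on quadratic forms *)

Section positive_integral.
Local Open Scope ereal_scope.
Context d (T : measurableType d) (R : realType) (mu : {measure set T -> \bar R}).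

(** A null integral would make the strictly positive [f] vanish almost everywhere, hence the whole
    space negligible. *)
Lemma integral_gt0 (f : T -> R) : measurable_fun setT f -> (forall x, 0 < f x)%R ->
  mu setT != 0 -> 0 < \int[mu]_x (f x)%:E.
Proof.
move=> mf f0 mu0; rewrite lt_neqAle; apply/andP; split; last first.
  by apply: integral_ge0 => x _; rewrite lee_fin ltW.
apply: contra_neq mu0 => /esym I0.
have mfE : measurable_fun setT (EFin \o f) by exact/measurable_EFinP.
have := (ae_eq_integral_abs mu measurableT mfE).1.
have -> : \int[mu]_x `|(EFin \o f) x| = 0.
  by rewrite -[RHS]I0; apply: eq_integral => x _; rewrite /= ger0_norm ?ltW.
move=> /(_ erefl) [N [mN N0 subN]].
have NT : N = setT.
  apply/seteqP; split => // x _; apply: subN => /= /(_ I) /eqP.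
  by rewrite eqe gt_eqF.
by rewrite -NT.
Qed.

End positive_integral.

Section quadratic_forms.
Context {R : realType}.

Lemma qformBv d (P : 'M[R]_d) (u v : 'cV[R]_d) : P^T = P ->
  qform P (u - v) = qform P u - 2 * (u^T *m P *m v) 0 0 + qform P v.
Proof.
move=> Pt; rewrite qformDv// qformN.
have -> : (u^T *m P *m - v) 0 0 = - (u^T *m P *m v) 0 0 by rewrite mulmxN mxE.
by rewrite mulrN.
Qed.

(** [k'] solves [(P + Q) k' = P x + Q k], which removes the terms linear in [a]. For the measurement
    error and the latent prior it is [shrunk_mean]. *)
Lemma complete_square d (P Q : 'M[R]_d) (x k a : 'cV[R]_d) : is_spd P -> is_spd Q ->
  let k' := invmx (P + Q) *m (P *m x + Q *m k) in
  qform P (x - a) + qform Q (a - k) =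
  qform (P + Q) (a - k') + (qform P x + qform Q k - qform (P + Q) k').
Proof.
move=> sP sQ k'; have sPQ := spd_add sP sQ.
have [Pt _] := sP; have [Qt _] := sQ; have [PQt _] := sPQ.
rewrite !qformBv// (trmx_bil x a Pt).
have -> : (a^T *m (P + Q) *m k') 0 0 = (a^T *m P *m x) 0 0 + (a^T *m Q *m k) 0 0.
  rewrite /k' -mulmxA mulKVmx ?spd_unit// mulmxDr !mulmxA mxE.
  by [].
rewrite (qformD P Q a); ring.
Qed.

(** Convexity at the midpoint: the two sides differ by a quarter of the form at [u - v]. *)
Lemma qform_half d (P : 'M[R]_d) (u v : 'cV[R]_d) : is_spd P ->
  qform P (2^-1 *: (u + v)) <= 2^-1 * (qform P u + qform P v).
Proof.
move=> sP; have [Pt _] := sP.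
rewrite qformZv qformDv//.
have := spd_qform_ge0 (u - v) sP; rewrite qformBv//.
set a := qform P u; set b := qform P v; set c := (_ *m _) 0 0 => h.
rewrite -subr_ge0 (_ : _ - _ = 2^-1 ^+ 2 * (a - 2 * c + b)); last by field.
by rewrite mulr_ge0.
Qed.

Lemma norm2D_le d (u v : 'cV[R]_d) : norm2 (u + v) <= 2 * norm2 u + 2 * norm2 v.
Proof.
rewrite /norm2 !mulr_sumr -big_split/=; apply: ler_sum => i _; rewrite mxE.
have := sqr_ge0 (u i 0 - v i 0); set x := u i 0; set y := v i 0 => h.
rewrite -subr_ge0; apply: le_trans h _; rewrite le_eqVlt; apply/orP; left; apply/eqP.
by ring.
Qed.

Lemma norm2N d (u : 'cV[R]_d) : norm2 (- u) = norm2 u.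
Proof. by apply: eq_bigr => i _; rewrite mxE sqrrN. Qed.

Lemma norm2_col_mx d1 d2 (u : 'cV[R]_d1) (v : 'cV[R]_d2) :
  norm2 (col_mx u v) = norm2 u + norm2 v.
Proof.
rewrite /norm2 big_split_ord/=; congr (_ + _); apply: eq_bigr => i _.
  by rewrite col_mxEu.
by rewrite col_mxEd.
Qed.

Lemma qform_scalar d (c : R) (v : 'cV[R]_d) : qform c%:M v = c * norm2 v.
Proof. by rewrite /qform mul_mx_scalar -scalemxAl mxE norm2E. Qed.

(** The squared Frobenius norm. *)
Definition frob m n (A : 'M[R]_(m, n)) : R := \sum_i \sum_j A i j ^+ 2.

Lemma frob_col d (v : 'cV[R]_d) : frob v = norm2 v.
Proof. by apply: eq_bigr => i _; rewrite big_ord1. Qed.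

Lemma frob_row m n (A : 'M[R]_(m, n)) : frob A = \sum_i norm2 (row i A)^T.
Proof. by apply: eq_bigr => i _; apply: eq_bigr => j _; rewrite !mxE. Qed.

Lemma frob_unvec a b (v : 'cV[R]_(b * a)) : frob (unvec v) = norm2 v.
Proof.
rewrite /frob exchange_big pair_bigA/= /norm2.
rewrite (reindex _ (curry_mxvec_bij b a)); apply: eq_bigr => -[i j] _ /=.
by rewrite !mxE.
Qed.

(** Cauchy-Schwarz on each column of [A]. *)
Lemma norm2_tr_mul m n (A : 'M[R]_(m, n)) (v : 'cV[R]_m) :
  norm2 (A^T *m v) <= frob A * norm2 v.
Proof.
rewrite /frob exchange_big mulr_suml; apply: ler_sum => k _.
rewrite (_ : \sum_i A i k ^+ 2 = norm2 (col k A)); last first.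
  by apply: eq_bigr => i _; rewrite !mxE.
apply: le_trans (dot_le _ _); rewrite mxE.
by under eq_bigr do rewrite mxE; under [X in _ <= X ^+ 2]eq_bigr do rewrite mxE.
Qed.

End quadratic_forms.

(** * Nontriviality of the reference measures *)

Section lebesgue_positive.
Context {R : realType}.
Local Notation RR := (measurableTypeR R).

Lemma spd_scalar d (c : R) : 0 < c -> is_spd (c%:M : 'M[R]_d).
Proof.
by move=> c0; rewrite -scalemx1; apply: spd_scale => //; exact: is_spd1.
Qed.

Lemma measurable_frob d (T : measurableType d) m n (A : T -> 'M[R]_(m, n)) :
  measurable_fun setT A -> measurable_fun setT (fun t => frob (A t)).
Proof.
move=> mA; apply: measurable_sum => i; apply: measurable_sum => j.
by apply: measurable_funX; exact: measurable_mx_entry.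
Qed.

Lemma integral_gauss_mx m n (c : R) : 0 < c ->
  (\int[lebesgue_mx m n]_A (expR (- (c * frob A)))%:E =
   (Num.sqrt (pi ^+ #|{: 'I_m * 'I_n}| / c ^+ #|{: 'I_m * 'I_n}|))%:E)%E.
Proof.
move=> c0.
rewrite (integral_lebesgue_mx (box_reindex (@enum_rank_bij _) (@box_tuple R #|{: 'I_m * 'I_n}|))).
- rewrite -(det_scalar _ c) -(integral_gauss_tuple (spd_scalar _ c0)).
  apply: eq_integral => t _; rewrite qform_scalar; congr (expR (- (c * _)))%:E.
  rewrite /frob pair_bigA/= /norm2 (reindex _ (onW_bij _ (@enum_rank_bij _)))/=.
  by apply: eq_bigr => -[i j] _; rewrite !mxE.
- apply: measurable_expR_fun; apply: measurable_funN; apply: measurable_funM => //.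
  exact: measurable_frob.
- by move=> A; rewrite lee_fin expR_ge0.
Qed.

(** A null measure would give a null Gaussian integral. *)
Lemma lebesgue_mx_neq0 m n : @lebesgue_mx R m n setT != 0%E.
Proof.
apply/eqP => L0; have := @integral_gauss_mx m n 1 ltr01.
rewrite null_set_integral//; last first.
  apply: measurable_expR_fun; apply: measurable_funN; apply: measurable_funM => //.
  exact: measurable_frob.
move=> /esym/eqP; rewrite eqe sqrtr_eq0 leNgt => /negP; apply.
by rewrite divr_gt0// exprn_gt0// pi_gt0.
Qed.

Lemma prod_measure_neq0 d1 d2 (T1 : measurableType d1) (T2 : measurableType d2)
    (mu : {sigma_finite_measure set T1 -> \bar R})
    (nu : {sigma_finite_measure set T2 -> \bar R}) :
  mu setT != 0%E -> nu setT != 0%E -> prod_measure mu nu setT != 0%E.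
Proof.
move=> mu0 nu0; rewrite /prod_measure -setXTT product_measure1E//.
by rewrite mule_eq0 negb_or mu0.
Qed.

(** The deviation of the form from [norm2 x] is at most the square of the sum of the [|x_i|] divided
    by [m + 1], and Cauchy-Schwarz bounds this by [m / (m + 1)] times [norm2 x]. *)
Lemma near_identity_spd m (S : 'M[R]_m) : S^T = S ->
  (forall i j, `|S i j - (i == j)%:R| <= (m.+1%:R)^-1) -> is_spd S.
Proof.
move=> St Sd; split => // x x0; rewrite -/(qform S x).
have -> : qform S x = norm2 x + qform (S - 1%:M) x.
  transitivity (qform (1%:M + (S - 1%:M)) x); first by rewrite addrC subrK.
  by rewrite [LHS]qformD qform_scalar mul1r.
have n0 : 0 < norm2 x.
  rewrite lt_def norm2_ge0 andbT; apply: contra_neq x0 => /eqP.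
  rewrite psumr_eq0 => [/allP h|i _]; last exact: sqr_ge0.
  apply/matrixP => i j; rewrite (ord1 j) mxE; apply/eqP; rewrite -sqrf_eq0.
  by apply: h; rewrite mem_index_enum.
have bound : `|qform (S - 1%:M) x| <= (m.+1%:R)^-1 * (m%:R * norm2 x).
  have -> : qform (S - 1%:M) x = \sum_j \sum_i x i 0 * (S i j - (i == j)%:R) * x j 0.
    rewrite /qform mxE; apply: eq_bigr => j _; rewrite mxE mulr_suml.
    by apply: eq_bigr => i _; rewrite !mxE.
  apply: (@le_trans _ _ (\sum_j \sum_i (m.+1%:R)^-1 * (`|x i 0| * `|x j 0|))).
    apply: le_trans (ler_norm_sum _ _ _) _; apply: ler_sum => j _.
    apply: le_trans (ler_norm_sum _ _ _) _; apply: ler_sum => i _.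
    rewrite !normrM mulrAC mulrC; apply: ler_wpM2r; first by rewrite mulr_ge0.
    exact: Sd.
  rewrite (eq_bigr (fun j => (m.+1%:R)^-1 * (\sum_i `|x i 0|) * `|x j 0|)); last first.
    move=> j _; rewrite -mulrA mulr_suml mulr_sumr.
    by [].
  rewrite -mulr_sumr -mulrA ler_wpM2l ?invr_ge0//.
  have := dot_le (\col_(i < m) 1) (\col_i `|x i 0|).
  under eq_bigr do rewrite !mxE mul1r.
  rewrite expr2 => /le_trans; apply.
  rewrite /norm2; under eq_bigr do rewrite mxE expr1n.
  under [X in _ * X]eq_bigr do rewrite mxE real_normK ?num_real//.
  by rewrite sumr_const card_ord.
rewrite -[X in 0 < _ + X]opprK subr_gt0; apply: le_lt_trans (ler_norm _) _; rewrite normrN.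
apply: le_lt_trans bound _; rewrite mulrA -[ltRHS]mul1r ltr_pM2r//.
by rewrite mulrC ltr_pdivrMr// mul1r ltr_nat.
Qed.

(** A box of side [2 e] around the identity, in upper-triangular coordinates, has positive volume
    and lies in the cone. *)
Lemma lebesgue_spd_neq0 m : @lebesgue_spd R m setT != 0%E.
Proof.
pose e : R := (m.+1%:R)^-1.
have e0 : 0 < e by rewrite invr_gt0.
pose I (ij : upper_index m) : set RR :=
  `](((val ij).1 == (val ij).2)%:R - e), (((val ij).1 == (val ij).2)%:R + e)[%classic.
pose B := [set t | forall ij : upper_index m, I ij (symt t (val ij).1 (val ij).2)].
have [mb bE] := @box_symt R m.
have mB : measurable B by apply: (measurable_box mb) => ij; exact: measurable_itv.
have LB : (0 < lebesgue_tuple #|{: upper_index m}| B)%E.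
  have -> : lebesgue_tuple #|{: upper_index m}| B = (\prod_ij lebesgue_measure (I ij))%E.
    by apply: bE => ij; exact: measurable_itv.
  rewrite (eq_bigr (fun=> (2 * e)%:E)); last first.
    move=> ij _; rewrite lebesgue_measure_itv/= lte_fin ltrD2l.
    rewrite gtrN// -EFinB; congr EFin; ring.
  by rewrite prodEFin lte_fin prodr_gt0// => i _; rewrite mulr_gt0.
apply/eqP => L0; have := LB; rewrite ltNge => /negP; apply.
rewrite -L0 /lebesgue_spd /lebesgue_sym/= /push_measure /pushforward.
apply: le_measure; rewrite ?inE//.
  rewrite -[X in measurable X]setTI; apply: (@measurable_symt R m) => //.
  exact: measurable_image_spd.
move=> t tB; suff sS : is_spd (symt t) by exists (SPD sS).
apply: near_identity_spd; first exact: trmx_symt.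
have key (i' j' : 'I_m) : (i' <= j')%N -> `|symt t i' j' - (i' == j')%:R| <= e.
  move=> ij; have := tB (exist _ (i', j') ij); rewrite /I/= in_itv/=.
  by rewrite -ltr_distl => /ltW.
move=> i j; have [ij|/ltnW ji] := leqP i j; first exact: key.
have /matrixP/(_ j i) := trmx_symt t; rewrite mxE => ->.
by rewrite eq_sym; exact: key.
Qed.

End lebesgue_positive.

(** * Dilations of the blocks, and the inverse-Wishart normalizer *)

Section dilations.
Context {R : realType}.

Lemma dilate_lebesgue_prod m1 n1 m2 n2 (a : R)
    (f : 'M[R]_(m1, n1) * 'M[R]_(m2, n2) -> \bar R) : 0 < a ->
  measurable_fun setT f -> (forall z, (0 <= f z)%E) ->
  (\int[prod_measure (lebesgue_mx m1 n1) (lebesgue_mx m2 n2)]_z f z =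
   (a ^+ (#|{: 'I_m1 * 'I_n1}| + #|{: 'I_m2 * 'I_n2}|))%:E *
   \int[prod_measure (lebesgue_mx m1 n1) (lebesgue_mx m2 n2)]_z
     f (a *: z.1, a *: z.2)%R)%E.
Proof.
move=> a0 mf f0.
have mg : measurable_fun setT
    (fun z : 'M[R]_(m1, n1) * 'M[R]_(m2, n2) => f (a *: z.1, a *: z.2)).
  apply: (measurableT_comp mf); apply: measurable_fun_pair.
    by apply: measurable_scalemx; exact: measurable_fst.
  by apply: measurable_scalemx; exact: measurable_snd.
have msec (x : 'M[R]_(m1, n1)) : measurable_fun setT (fun y => f (x, y)).
  by apply: (measurableT_comp mf); exact: measurable_fun_pair.
rewrite !integral_prod_measure//.
have mI : measurable_fun setT (fun x => \int[lebesgue_mx m2 n2]_y f (x, y))%E.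
  exact: measurable_fun_fubini_tonelli_F.
rewrite (dilate_lebesgue_mx a0 mI); last by move=> x; exact: integral_ge0.
rewrite exprD EFinM -muleA; congr (_ * _)%E.
rewrite -integralZl_nneg; last 3 first.
- by rewrite exprn_ge0// ltW.
- exact: (@measurable_fun_fubini_tonelli_F _ _ _ _ _ (lebesgue_mx m2 n2) _ mg).
- by move=> x; exact: integral_ge0.
by apply: eq_integral => x _; rewrite (dilate_lebesgue_mx a0 (msec _)).
Qed.

Definition spd_double m (S : spd R m) : spd R m := SPD (spd_scale (ltr0Sn R 1) (spd_mxP S)).

Lemma measurable_spd_double m : measurable_fun setT (@spd_double m).
Proof.
move=> _ Y [B mB <-]; rewrite !setTI.
have -> : @spd_double m @^-1` ((@spd_mx R m) @^-1` B) =
    (@spd_mx R m) @^-1` ((fun S : 'M[R]_m => 2 *: S) @^-1` B) by [].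
exists ((fun S : 'M[R]_m => 2 *: S) @^-1` B); last by rewrite setTI.
rewrite -[X in measurable X]setTI; apply: (_ : measurable_fun setT _) => //.
by apply: measurable_scalemx; exact: measurable_id.
Qed.

Lemma indic_spd_scale m (a : R) (S : 'M[R]_m) : 0 < a ->
  \1_[set A : 'M[R]_m | is_spd A] (a *: S) = \1_[set A : 'M[R]_m | is_spd A] S :> R.
Proof.
move=> a0; have [sS|sS] := pselect (is_spd S).
  by rewrite !indic_spdT//; exact: spd_scale.
rewrite !indic_spdF// => saS; apply: sS.
have a1 : 0 < a^-1 by rewrite invr_gt0.
by have := spd_scale a1 saS; rewrite scalerA mulVf ?gt_eqF// scale1r.
Qed.

(** The SPD cone is invariant under doubling, so only the Jacobian of the symmetric coordinates
    appears. *)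
Lemma integral_spd_double m (F : 'M[R]_m -> R) : measurable_fun setT F ->
  (forall S, 0 <= F S) ->
  (\int[lebesgue_spd m]_S (F (spd_mx (spd_double S)))%:E =
   (2 ^- #|{: upper_index m}|)%:E * \int[lebesgue_spd m]_S (F (spd_mx S))%:E)%E.
Proof.
move=> mF F0.
have mFE : measurable_fun setT (fun S => (F S)%:E) by exact/measurable_EFinP.
have F0E S : (0 <= (F S)%:E)%E by rewrite lee_fin.
have mF2 : measurable_fun setT (fun S : 'M[R]_m => (F (2 *: S))%:E).
  apply: (measurableT_comp mFE); apply: measurable_scalemx; exact: measurable_id.
rewrite (integral_lebesgue_spd mFE F0E).
rewrite (integral_lebesgue_spd mF2); last by move=> S; rewrite lee_fin.
set g := fun S : 'M[R]_m => ((F S)%:E * (\1_[set A : 'M[R]_m | is_spd A] S)%:E)%E.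
have mg : measurable_fun setT g.
  apply: emeasurable_funM => //; apply/measurable_EFinP; exact: measurable_indic_spd.
have g0 S : (0 <= g S)%E by rewrite mule_ge0.
have Dt : (0 : 'M[R]_m)^T = 0 by rewrite trmx0.
rewrite [in RHS](affine_lebesgue_sym (ltr0Sn R 1) Dt mg g0) muleA -EFinM mulVf ?mul1e; last first.
  by rewrite expf_neq0.
by apply: eq_integral => S _; rewrite /g addr0 indic_spd_scale.
Qed.

(** Coercivity of [B] reduces to a scalar scale matrix, and [m <= nu] makes the exponent
    [(nu + m + 1) / 2] exceed [m]. *)
Lemma inverse_wishart_lty m nu (B : spd R m) : (m <= nu)%N ->
  (\int[lebesgue_spd m]_S (inverse_wishart_unnormalized nu B S)%:E < +oo)%E.
Proof.
move=> mnu; have [la la0 Bla] := spd_coercive (spd_mxP B).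
pose F (S : 'M[R]_m) := iw_density ((nu + m + 1)%:R / 2) (la / 2) S.
have mF : measurable_fun setT F by exact: measurable_iw_density.
apply: (@le_lt_trans _ _ (\int[lebesgue_spd m]_S (F S)%:E)%E).
  apply: ge0_le_integral => //.
  - by move=> S _; rewrite lee_fin mulr_ge0 ?powR_ge0 ?expR_ge0.
  - apply/measurable_EFinP; apply: measurable_funM.
      apply: (@measurableT_comp _ _ _ _ _ _ (@powR R ^~ _)); first exact: measurable_powR.
      by apply: measurable_det; exact: measurable_spd_mx.
    apply: measurableT_comp => //; apply: measurable_funM => //.
    apply: measurable_mxtrace; apply: measurable_mulmx => //.
    by apply: measurable_invmx; exact: measurable_spd_mx.
  - by apply/measurable_EFinP; apply: (measurableT_comp mF); exact: measurable_spd_mx.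
  move=> S _; rewrite lee_fin /inverse_wishart_unnormalized /F /iw_density mulNr.
  rewrite ler_wpM2l ?powR_ge0// ler_expR mulNr lerN2.
  rewrite [leLHS]mulrAC [leRHS]mulrC ler_wpM2r// ?invr_ge0//.
  exact: trace_coercive (spd_invmx (spd_mxP S)) Bla.
rewrite (@integral_lebesgue_spd R m (fun S => (F S)%:E)); last 2 first.
- exact/measurable_EFinP.
- by move=> S; rewrite lee_fin iw_density_ge0.
rewrite (eq_integral (fun S : 'M[R]_m =>
    (\1_[set A : 'M[R]_m | is_spd A] S * F S)%:E)); last first.
  by move=> S _; rewrite -EFinM mulrC.
apply: iw_density_lty; last by rewrite divr_gt0.
rewrite ltr_pdivlMr// -natrM ltr_nat muln2 -addnn addn1 ltnS leq_add2r//.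
Qed.

Lemma inverse_wishart_gt0 m nu (B : spd R m) :
  (0 < \int[lebesgue_spd m]_S (inverse_wishart_unnormalized nu B S)%:E)%E.
Proof.
apply: integral_gt0.
- apply: measurable_funM.
    apply: (@measurableT_comp _ _ _ _ _ _ (@powR R ^~ _)); first exact: measurable_powR.
    by apply: measurable_det; exact: measurable_spd_mx.
  apply: measurableT_comp => //; apply: measurable_funM => //.
  apply: measurable_mxtrace; apply: measurable_mulmx => //.
  by apply: measurable_invmx; exact: measurable_spd_mx.
- by move=> S; rewrite mulr_gt0 ?expR_gt0// powR_gt0// spd_det_gt0//; exact: spd_mxP.
- exact: lebesgue_spd_neq0.
Qed.

End dilations.

(** * Sets of conditional probability at least one half *)

Section half_mass.
Local Open Scope ereal_scope.
Context d d' (X : measurableType d) (Y : measurableType d') (R : realType).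
Variables (mu : {sigma_finite_measure set Y -> \bar R}) (f : X * Y -> R).
Variables (mf : measurable_fun setT f) (f0 : forall z, (0 <= f z)%R).
Variables (x : X) (c : R) (g : Y -> R).
Hypothesis c0 : (0 < c)%R.
Hypothesis mg : measurable_fun setT g.
Hypothesis g0 : forall y, (0 <= g y)%R.
Hypothesis fg : forall y, f (x, y) = (c * g y)%R.
Hypothesis Z0 : 0 < \int[mu]_y (g y)%:E.
Hypothesis Zoo : \int[mu]_y (g y)%:E < +oo.
Variables (phi : Y -> Y) (W : Y -> R) (K C w : R).
Hypotheses (mphi : measurable_fun setT phi) (mW : measurable_fun setT W)
  (K0 : (0 <= K)%R) (gW : forall y, (g y * expR (W y) <= K * g (phi y))%R)
  (gC : \int[mu]_y (g (phi y))%:E = C%:E * \int[mu]_y (g y)%:E)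
  (wK : (expR (- w) * K * C <= 2^-1)%R).

(** Outside [B] the function [W] exceeds [w], and the dilation estimate caps the mass of that event
    at one half. *)
Lemma full_conditional_half (B : set Y) : measurable B ->
  (forall y, ~ B y -> (w < W y)%R) ->
  (2^-1)%:E <= full_conditional mu mf f0 x B.
Proof.
move=> mB Bw; have mB' : measurable (~` B) by exact: measurableC.
have Zfin : \int[mu]_y (g y)%:E \is a fin_num by rewrite ge0_fin_numE// ltW.
have Zr : (0 < fine (\int[mu]_y (g y)%:E))%R by rewrite fine_gt0// Z0 Zoo.
have mlt : measurable [set y | (w < W y)%R].
  by apply: measurable_bool_set; exact: measurable_fun_ltr.
have k1 : full_conditional mu mf f0 x setT = 1 by rewrite prob_kernel.
have kD : full_conditional mu mf f0 x setT =
    full_conditional mu mf f0 x B + full_conditional mu mf f0 x (~` B).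
  by rewrite -measureU ?setICr ?setUv.
have h : full_conditional mu mf f0 x (~` B) <= (2^-1)%:E.
  rewrite (full_conditionalE mf f0 c0 mg g0 fg Z0 Zoo mB').
  apply: (@le_trans _ _ (\int[mu]_(y in [set y | (w < W y)%R])
      ((fine (\int[mu]_y (g y)%:E))^-1%:E * (g y)%:E))).
    under eq_integral do rewrite mulrC EFinM.
    apply: ge0_subset_integral => //.
    - by apply: emeasurable_funM => //; apply: measurable_funTS; exact/measurable_EFinP.
    - by move=> y _; apply: mule_ge0; rewrite lee_fin// invr_ge0; exact: ltW.
  rewrite ge0_integralZl_EFin//; last 3 first.
  - by move=> y _; rewrite lee_fin.
  - by apply: measurable_funTS; exact/measurable_EFinP.
  - by rewrite invr_ge0 ltW.
  have := @tail_bound _ _ _ mu phi g W K C w mphi mg mW g0 K0 gW gC.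
  move=> /(lee_wpmul2l (_ : 0 <= ((fine (\int[mu]_y (g y)%:E))^-1)%:E)).
  rewrite lee_fin invr_ge0 ltW// => /(_ isT) /le_trans; apply.
  rewrite muleCA -[X in _ * X <= _](_ : 1 = _); last first.
    by rewrite -{2}(fineK Zfin) -EFinM mulVf ?gt_eqF.
  by rewrite mule1 lee_fin.
move: kD; rewrite k1 => kD.
have Bfin : full_conditional mu mf f0 x (~` B) \is a fin_num.
  by rewrite ge0_fin_numE// (le_lt_trans h)// ltry.
have -> : full_conditional mu mf f0 x B = 1 - full_conditional mu mf f0 x (~` B).
  by rewrite kD addeK.
rewrite leeBrDr// (_ : 1 = (2^-1)%:E + (2^-1)%:E :> \bar R); first exact: leeD2l.
by rewrite -EFinD; congr EFin; field.
Qed.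

End half_mass.

Section half_probability.
Local Open Scope ereal_scope.
Context d (T : measurableType d) (R : realType) (mu : {measure set T -> \bar R}).

Lemma integral_ge_half (B : set T) (c : R) (h : T -> \bar R) : measurable B ->
  (2^-1)%:E <= mu B -> (0 <= c)%R -> measurable_fun setT h -> (forall y, 0 <= h y) ->
  (forall y, B y -> c%:E <= h y) -> (c / 2)%:E <= \int[mu]_y h y.
Proof.
move=> mB muB c0 mh h0 hc.
apply: (@le_trans _ _ (\int[mu]_(y in B) c%:E)).
  by rewrite integral_cst// EFinM; apply: lee_wpmul2l.
rewrite integral_mkcond; apply: ge0_le_integral => //.
- by move=> y _; rewrite patchE; case: ifPn.
- by apply/(measurable_restrictT _ _).1.
- by move=> y _; rewrite patchE; case: ifPn => //; rewrite inE; exact: hc.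
Qed.

End half_probability.

Section elementary_bounds.
Context {R : realType}.

Lemma exists_expRN_small (c : R) : 0 <= c -> exists w : R, expR (- w) * c <= 2^-1.
Proof.
move=> c0; exists (2 * c); rewrite expRN mulrC ler_pdivrMr ?expR_gt0//.
rewrite mulrC ler_pdivlMr//; apply: le_trans (expR_ge1Dx _); rewrite mulrC.
by rewrite lerDr.
Qed.

(** The explicit value [1 / (1 + sum of the inverses)] replaces a minimum, which an empty index type
    does not have. *)
Lemma exists_lower_bound (I : finType) (a : I -> R) : (forall i, 0 < a i) ->
  exists2 b : R, 0 < b & forall i, b <= a i.
Proof.
move=> a0; have s0 : 0 <= \sum_i (a i)^-1.
  by apply: sumr_ge0 => i _; rewrite invr_ge0 ltW.
exists (1 + \sum_i (a i)^-1)^-1; first by rewrite invr_gt0 ltr_wpDr.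
move=> i; rewrite invf_ple ?posrE ?ltr_wpDr//.
rewrite (bigD1 i)//= addrCA lerDl addr_ge0//.
by apply: sumr_ge0 => j _; rewrite invr_ge0 ltW.
Qed.

(** From [norm2 v <= 2 norm2 (v - w) + 2 norm2 w]: half of the coercivity constant survives the
    shift. *)
Lemma spd_coercive_shift d (P : 'M[R]_d) (w : 'cV[R]_d) : is_spd P ->
  exists2 a : R, 0 < a & exists c : R, forall v, a * norm2 v - c <= qform P (v - w).
Proof.
move=> /spd_coercive[a a0 aP]; exists (a / 2); first by rewrite divr_gt0.
exists (a * norm2 w) => v; apply: le_trans (aP _).
have := norm2D_le (v - w) w; rewrite subrK.
rewrite -(ler_pM2l (_ : 0 < a / 2)) ?divr_gt0// => h.
rewrite lerBlDr; apply: le_trans h _; rewrite le_eqVlt; apply/orP; left; apply/eqP.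
by field.
Qed.

End elementary_bounds.

(** * The posterior and its unnormalized conditionals *)

Section eiv_posterior.
Context {R : realType} {m n p q : nat} (M : eiv_model R m n p q).
Local Notation matA := 'M[R]_(n, p).
Local Notation coef := ('cV[R]_(m * q) * 'cV[R]_(m * p))%type.
Local Notation state := ('M[R]_(n, p) * coef * spd R m)%type.
Local Notation V := (eivV M).
Local Notation K := (eivK M).

Definition residual (A : matA) (b : coef) (i : 'I_n) : 'cV[R]_m :=
  eivy M i - regression_mean M A b i.

Definition misfit (A : matA) (b : coef) (S : 'M[R]_m) : R :=
  \sum_i qform (invmx S) (residual A b i).

Definition prior_coef (b : coef) : R :=
  qform (invmx (eivJ0 M)) (col_mx b.1 b.2 - eivj0 M).

Definition prior_latent (A : matA) : R :=
  \sum_i qform (invmx (V i) + invmx (K i)) (latent A i - shrunk_mean M i).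

Definition coef_norm2 (b : coef) : R := norm2 b.1 + norm2 b.2.

(** This and the next two are [posterior_formula] without the factors constant in the updated block.
    The [n] likelihood terms account for the degrees of freedom [n + a0]; the misfit stays separate
    so that it can be discarded or compared on its own. *)
Definition densS (A : matA) (b : coef) (S : spd R m) : R :=
  inverse_wishart_unnormalized (n + eiva0 M) (eivB0 M) S * expR (- 2^-1 * misfit A b S).

Definition densb (A : matA) (b : coef) (S : spd R m) : R :=
  expR (- 2^-1 * (misfit A b S + prior_coef b)).

Definition densA (A : matA) (b : coef) (S : spd R m) : R :=
  expR (- 2^-1 * (misfit A b S + prior_latent A)).

Lemma spd_VK i : is_spd (invmx (V i) + invmx (K i)).
Proof. by apply: spd_add; apply: spd_invmx; exact: spd_mxP. Qed.

Lemma formula_densS A b S : posterior_formula M (A, b, S) =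
  expR (- 2^-1 * (prior_latent A + prior_coef b)) * densS A b S.
Proof.
rewrite /posterior_formula /densS /inverse_wishart_unnormalized -/(prior_latent A).
rewrite -/(prior_coef b) -/(misfit A b S) mulrC -[in RHS]mulrA -expRD mulrDr !mulNr.
by [].
Qed.

Lemma formula_densb A b S : posterior_formula M (A, b, S) =
  inverse_wishart_unnormalized (n + eiva0 M) (eivB0 M) S * expR (- 2^-1 * prior_latent A) *
  densb A b S.
Proof.
rewrite formula_densS /densS /densb mulrC -!mulrA -!expRD; congr (_ * expR _); ring.
Qed.

Lemma formula_densA A b S : posterior_formula M (A, b, S) =
  inverse_wishart_unnormalized (n + eiva0 M) (eivB0 M) S * expR (- 2^-1 * prior_coef b) *
  densA A b S.
Proof.
rewrite formula_densS /densS /densA mulrC -!mulrA -!expRD; congr (_ * expR _); ring.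
Qed.

Lemma iw_gt0 nu (B : 'M[R]_m) (S : spd R m) : 0 < inverse_wishart_unnormalized nu B S.
Proof. by rewrite mulr_gt0 ?expR_gt0// powR_gt0// spd_det_gt0//; exact: spd_mxP. Qed.

Lemma densS_gt0 A b S : 0 < densS A b S.
Proof. by rewrite mulr_gt0 ?expR_gt0// iw_gt0. Qed.

Lemma densb_gt0 A b S : 0 < densb A b S. Proof. exact: expR_gt0. Qed.

Lemma densA_gt0 A b S : 0 < densA A b S. Proof. exact: expR_gt0. Qed.

Lemma misfit_ge0 A b (S : spd R m) : 0 <= misfit A b S.
Proof.
by apply: sumr_ge0 => i _; apply: spd_qform_ge0; apply: spd_invmx; exact: spd_mxP.
Qed.

Section measurability.
Context d (T : measurableType d).
Variables (A : T -> matA) (b : T -> coef) (S : T -> spd R m).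
Hypotheses (mA : measurable_fun setT A) (mb : measurable_fun setT b)
  (mS : measurable_fun setT S).

Let mS' : measurable_fun setT (fun t => spd_mx (S t)).
Proof. by apply: measurableT_comp => //; exact: measurable_spd_mx. Qed.

Let mb1 : measurable_fun setT (fun t => (b t).1). Proof. exact: measurableT_comp. Qed.

Let mb2 : measurable_fun setT (fun t => (b t).2). Proof. exact: measurableT_comp. Qed.

Lemma measurable_residual i : measurable_fun setT (fun t => residual (A t) (b t) i).
Proof.
apply: measurable_submx => //; apply: measurable_addmx; apply: measurable_mulmx => //.
- by apply: measurable_trmx; exact: measurable_unvec.
- by apply: measurable_trmx; exact: measurable_unvec.
- by apply: measurable_trmx; exact: measurable_row.
Qed.

Lemma measurable_misfit (S' : T -> 'M[R]_m) : measurable_fun setT S' ->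
  measurable_fun setT (fun t => misfit (A t) (b t) (S' t)).
Proof.
move=> mS''; apply: measurable_sum => i; apply: measurable_qform; first exact: measurable_invmx.
exact: measurable_residual.
Qed.

Lemma measurable_prior_coef : measurable_fun setT (fun t => prior_coef (b t)).
Proof.
apply: measurable_qform => //; apply: measurable_submx => //; exact: measurable_col_mx.
Qed.

Lemma measurable_prior_latent : measurable_fun setT (fun t => prior_latent (A t)).
Proof.
apply: measurable_sum => i; apply: measurable_qform => //; apply: measurable_submx => //.
by apply: measurable_trmx; exact: measurable_row.
Qed.

Lemma measurable_trace_inv : measurable_fun setT (fun t => \tr (invmx (S t))).
Proof. by apply: measurable_mxtrace; exact: measurable_invmx. Qed.

Lemma measurable_iw nu (B : 'M[R]_m) (S' : T -> 'M[R]_m) : measurable_fun setT S' ->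
  measurable_fun setT (fun t => inverse_wishart_unnormalized nu B (S' t)).
Proof.
move=> mS''; apply: measurable_funM.
  apply: (@measurableT_comp _ _ _ _ _ _ (@powR R ^~ _)); first exact: measurable_powR.
  exact: measurable_det.
apply: measurableT_comp => //; apply: measurable_funM => //.
apply: measurable_mxtrace; apply: measurable_mulmx => //; exact: measurable_invmx.
Qed.

Lemma measurable_densS : measurable_fun setT (fun t => densS (A t) (b t) (S t)).
Proof.
apply: measurable_funM; first exact: measurable_iw.
apply: measurableT_comp => //; apply: measurable_funM => //; exact: measurable_misfit.
Qed.

Lemma measurable_densb : measurable_fun setT (fun t => densb (A t) (b t) (S t)).
Proof.
apply: measurableT_comp => //; apply: measurable_funM => //; apply: measurable_funD.
  exact: measurable_misfit.
exact: measurable_prior_coef.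
Qed.

Lemma measurable_densA : measurable_fun setT (fun t => densA (A t) (b t) (S t)).
Proof.
apply: measurableT_comp => //; apply: measurable_funM => //; apply: measurable_funD.
  exact: measurable_misfit.
exact: measurable_prior_latent.
Qed.

End measurability.

Lemma prior_coef_coercive : exists2 a : R, 0 < a &
  exists c : R, forall b, a * coef_norm2 b - c <= prior_coef b.
Proof.
have [a a0 [c h]] := spd_coercive_shift (eivj0 M) (spd_invmx (spd_mxP (eivJ0 M))).
by exists a => //; exists c => b; rewrite /coef_norm2 -norm2_col_mx; exact: h.
Qed.

(** Each latent vector has its own slope and offset; a common lower bound of the slopes and the sum
    of the offsets serve for all of them. *)
Lemma prior_latent_coercive : exists2 a : R, 0 < a &
  exists c : R, forall A, a * frob A - c <= prior_latent A.
Proof.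
have h i := spd_coercive_shift (shrunk_mean M i) (spd_VK i).
have a_ (i : 'I_n) : {a : R | 0 < a &
    exists c : R, forall v, a * norm2 v - c <= qform (invmx (V i) + invmx (K i)) (v - shrunk_mean M i)}.
  have /cid2[a a0 ha] := h i; by exists a.
have c_ (i : 'I_n) := cid (s2valP' (a_ i)).
have [a a0 ale] := exists_lower_bound (fun i => s2valP (a_ i)).
exists a => //; exists (\sum_i sval (c_ i)) => A.
rewrite frob_row mulr_sumr -sumrB; apply: ler_sum => i _.
apply: le_trans (svalP (c_ i) (latent A i)).
by rewrite lerB// ler_wpM2r ?norm2_ge0.
Qed.

Lemma coef_gauss_lty (a c : R) : 0 < a ->
  (\int[@lebesgue_coef R m p q]_b (expR (- (a * coef_norm2 b - c)))%:E < +oo)%E.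
Proof.
move=> a0.
have mE (k : nat) : measurable_fun setT (fun v : 'cV[R]_k => (expR (- (a * frob v)))%:E).
  apply: measurable_expR_fun; apply: measurable_funN; apply: measurable_funM => //.
  exact: measurable_frob.
rewrite integral_prod_measure//; last first.
  apply: measurable_expR_fun; apply: measurable_funN; apply: measurable_funB => //.
  apply: measurable_funM => //; apply: measurable_funD.
    by under eq_fun do rewrite -frob_col; apply: measurable_frob; exact: measurable_fst.
  by under eq_fun do rewrite -frob_col; apply: measurable_frob; exact: measurable_snd.
rewrite (eq_integral (fun x : 'cV[R]_(m * q) =>
    ((expR c * Num.sqrt (pi ^+ #|{: 'I_(m * p) * 'I_1}| / a ^+ #|{: 'I_(m * p) * 'I_1}|))%:E *
     (expR (- (a * frob x)))%:E)%E)).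
  rewrite integralZl_nneg//.
  by rewrite integral_gauss_mx// -EFinM ltry.
move=> x _; rewrite [in RHS]EFinM -integral_gauss_mx// -muleA.
rewrite [X in (_ * X)%E]muleC -integralZl_nneg ?expR_ge0//.
rewrite -integralZl_nneg ?expR_ge0//; last first.
  by apply: emeasurable_funM.
apply: eq_integral => y _; rewrite -!EFinM -!expRD /coef_norm2 !frob_col; congr (expR _)%:E.
by ring.
Qed.

Definition massS (A : matA) (b : coef) : \bar R := (\int[lebesgue_spd m]_S (densS A b S)%:E)%E.
Definition massb (A : matA) (S : spd R m) : \bar R := (\int[lebesgue_coef]_b (densb A b S)%:E)%E.
Definition massA (b : coef) (S : spd R m) : \bar R := (\int[lebesgue_mx n p]_A (densA A b S)%:E)%E.

(** Discarding the nonnegative misfit bounds the three normalizing constants by quantities free of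
    the conditioning variables. *)
Definition boundS : \bar R :=
  (\int[lebesgue_spd m]_S (inverse_wishart_unnormalized (n + eiva0 M) (eivB0 M) S)%:E)%E.
Definition boundb : \bar R := (\int[lebesgue_coef]_b (expR (- 2^-1 * prior_coef b))%:E)%E.
Definition boundA : \bar R := (\int[lebesgue_mx n p]_A (expR (- 2^-1 * prior_latent A))%:E)%E.

Lemma massS_le A b : (massS A b <= boundS)%E.
Proof.
apply: le_integral_nneg.
- by apply/measurable_EFinP; exact: measurable_densS.
- by apply/measurable_EFinP; apply: measurable_iw; exact: measurable_spd_mx.
- by move=> S; rewrite lee_fin ltW// densS_gt0.
move=> S; rewrite lee_fin ler_piMr//; first exact/ltW/iw_gt0.
by rewrite -expR0 ler_expR mulNr oppr_le0 mulr_ge0 ?misfit_ge0.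
Qed.

Lemma massb_le A S : (massb A S <= boundb)%E.
Proof.
apply: le_integral_nneg.
- by apply/measurable_EFinP; exact: measurable_densb.
- by apply: measurable_expR_fun; apply: measurable_funM => //; exact: measurable_prior_coef.
- by move=> b; rewrite lee_fin ltW// densb_gt0.
by move=> b; rewrite lee_fin ler_expR !mulNr lerN2 ler_wpM2l// lerDr misfit_ge0.
Qed.

Lemma massA_le b S : (massA b S <= boundA)%E.
Proof.
apply: le_integral_nneg.
- by apply/measurable_EFinP; exact: measurable_densA.
- by apply: measurable_expR_fun; apply: measurable_funM => //; exact: measurable_prior_latent.
- by move=> A; rewrite lee_fin ltW// densA_gt0.
by move=> A; rewrite lee_fin ler_expR !mulNr lerN2 ler_wpM2l// lerDr misfit_ge0.
Qed.

Lemma boundb_lty : (boundb < +oo)%E.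
Proof.
have [a a0 [c h]] := prior_coef_coercive.
apply: le_lt_trans (coef_gauss_lty (c / 2) (_ : 0 < a / 2)); last by rewrite divr_gt0.
apply: le_integral_nneg.
- by apply: measurable_expR_fun; apply: measurable_funM => //; exact: measurable_prior_coef.
- apply: measurable_expR_fun; apply: measurable_funN; apply: measurable_funB => //.
  apply: measurable_funM => //; apply: measurable_funD.
    by under eq_fun do rewrite -frob_col; apply: measurable_frob; exact: measurable_fst.
  by under eq_fun do rewrite -frob_col; apply: measurable_frob; exact: measurable_snd.
- by move=> b; rewrite lee_fin expR_ge0.
move=> b; rewrite lee_fin ler_expR mulNr lerN2.
rewrite (_ : _ - _ = 2^-1 * (a * coef_norm2 b - c)); last by field.
by rewrite ler_wpM2l.
Qed.

Lemma boundA_lty : (boundA < +oo)%E.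
Proof.
have [a a0 [c h]] := prior_latent_coercive.
have a2 : 0 < a / 2 by rewrite divr_gt0.
have mE : measurable_fun setT (fun A : matA => (expR (- (a / 2 * frob A)))%:E).
  apply: measurable_expR_fun; apply: measurable_funN; apply: measurable_funM => //.
  exact: measurable_frob.
apply: (@le_lt_trans _ _ (\int[lebesgue_mx n p]_A
   ((expR (c / 2))%:E * (expR (- (a / 2 * frob A)))%:E))%E).
  apply: le_integral_nneg.
  - by apply: measurable_expR_fun; apply: measurable_funM => //; exact: measurable_prior_latent.
  - exact: emeasurable_funM.
  - by move=> A; rewrite lee_fin expR_ge0.
  move=> A; rewrite -EFinM -expRD lee_fin ler_expR.
  have := h A; rewrite -(ler_pM2l (_ : 0 < 2^-1 :> R))// => hA.
  rewrite -lerN2 mulNr opprK; apply: le_trans hA.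
  by rewrite le_eqVlt; apply/orP; left; apply/eqP; field.
rewrite integralZl_nneg ?expR_ge0// integral_gauss_mx//.
by rewrite -EFinM ltry.
Qed.

Hypothesis a0_ge : (m <= eiva0 M)%N.

Lemma boundS_lty : (boundS < +oo)%E.
Proof. by apply: inverse_wishart_lty; rewrite (leq_trans a0_ge)// leq_addl. Qed.

Lemma lebesgue_coef_neq0 : @lebesgue_coef R m p q setT != 0%E.
Proof. by apply: prod_measure_neq0; exact: lebesgue_mx_neq0. Qed.

Lemma massS_gt0 A b : (0 < massS A b)%E.
Proof.
apply: integral_gt0; [exact: measurable_densS|exact: densS_gt0|exact: lebesgue_spd_neq0].
Qed.

Lemma massb_gt0 A S : (0 < massb A S)%E.
Proof.
apply: integral_gt0; [exact: measurable_densb|by move=> b; exact: densb_gt0|exact: lebesgue_coef_neq0].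
Qed.

Lemma massA_gt0 b S : (0 < massA b S)%E.
Proof.
apply: integral_gt0; [exact: measurable_densA|by move=> A; exact: densA_gt0|exact: lebesgue_mx_neq0].
Qed.

Lemma massS_lty A b : (massS A b < +oo)%E.
Proof. exact: le_lt_trans (massS_le A b) boundS_lty. Qed.

Lemma massb_lty A S : (massb A S < +oo)%E.
Proof. exact: le_lt_trans (massb_le A S) boundb_lty. Qed.

Lemma massA_lty b S : (massA b S < +oo)%E.
Proof. exact: le_lt_trans (massA_le b S) boundA_lty. Qed.

End eiv_posterior.

(** * Uniform tail bounds for the three conditionals *)

Section half_gauss.
Local Open Scope ereal_scope.
Context d d' (X : measurableType d) (Y : measurableType d') (R : realType).
Variables (mu : {sigma_finite_measure set Y -> \bar R}) (f : X * Y -> R).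
Variables (mf : measurable_fun setT f) (f0 : forall z, (0 <= f z)%R).
Variables (x : X) (c : R) (Q : Y -> R) (phi : Y -> Y) (C q0 w : R).

(** The choice [W = Q / 4] gives up half of the exponent [- Q / 2]; the hypothesis on [phi] bounds
    the remaining [- Q / 4] by [q0 / 4 - Q (phi y) / 2]. *)
Lemma full_conditional_half_gauss (B : set Y) : (0 < c)%R -> measurable_fun setT Q ->
  (forall y, f (x, y) = (c * expR (- 2^-1 * Q y))%R) ->
  0 < \int[mu]_y (expR (- 2^-1 * Q y))%:E ->
  \int[mu]_y (expR (- 2^-1 * Q y))%:E < +oo ->
  measurable_fun setT phi ->
  (forall y, (Q (phi y) <= 2^-1 * (Q y + q0))%R) ->
  \int[mu]_y (expR (- 2^-1 * Q (phi y)))%:E = C%:E * \int[mu]_y (expR (- 2^-1 * Q y))%:E ->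
  (expR (- w) * (expR (4^-1 * q0) * C) <= 2^-1)%R ->
  measurable B -> (forall y, ~ B y -> (w < 4^-1 * Q y)%R) ->
  (2^-1)%:E <= full_conditional mu mf f0 x B.
Proof.
move=> c0 mQ fQ Z0 Zoo mphi Qphi gC wK mB Bw.
have mg : measurable_fun setT (fun y => expR (- 2^-1 * Q y)%R).
  by apply: measurableT_comp => //; exact: measurable_funM.
have mW : measurable_fun setT (fun y => 4^-1 * Q y)%R by exact: measurable_funM.
apply: (full_conditional_half mf f0 c0 mg (fun=> expR_ge0 _) fQ Z0 Zoo mphi mW
  (expR_ge0 (4^-1 * q0)) _ gC _ mB Bw) => [y|]; last by rewrite -mulrA.
rewrite -!expRD ler_expR -subr_ge0.
rewrite (_ : (_ - _)%R = (2^-1 * (2^-1 * (Q y + q0) - Q (phi y)))%R); last by field.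
by rewrite mulr_ge0// subr_ge0.
Qed.

End half_gauss.

Lemma measurable_sublevel d (T : measurableType d) (R : realType) (f : T -> R) r :
  measurable_fun setT f -> measurable [set x | f x <= r].
Proof.
by move=> mf; apply: measurable_bool_set; exact: measurable_fun_ler.
Qed.

Section eiv_tails.
Context {R : realType} {m n p q : nat} (M : eiv_model R m n p q).
Local Notation matA := 'M[R]_(n, p).
Local Notation coef := ('cV[R]_(m * q) * 'cV[R]_(m * p))%type.
Local Notation state := ('M[R]_(n, p) * coef * spd R m)%type.
Local Notation V := (eivV M).
Local Notation K := (eivK M).
Hypothesis a0_ge : (m <= eiva0 M)%N.
Variable c : R.
Hypotheses (c0 : 0 < c)
  (posteriorE : forall s, posterior_density M s = c * posterior_formula M s).

(** The residual is affine in the coefficients, so halving them gives the midpoint with the residual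
    at the origin. Midpoint convexity of the forms then applies. *)
Lemma residual_half_coef A (b : coef) i :
  residual M A (2^-1 *: b.1, 2^-1 *: b.2) i = 2^-1 *: (residual M A b i + residual M A (0, 0) i).
Proof.
have uZ a1 a2 (v : 'cV[R]_(a2 * a1)) : (unvec (2^-1 *: v))^T = 2^-1 *: (unvec v)^T.
  by rewrite /unvec !trmxK -[in RHS]linearZ -linearZ.
have u0 a1 a2 : (unvec (0 : 'cV[R]_(a2 * a1)))^T = 0.
  by rewrite /unvec trmxK trmx0 linear0.
rewrite /residual /regression_mean /= !uZ !u0 !mul0mx addr0 subr0 -!scalemxAl -scalerDr.
rewrite addrAC scalerBr; congr (_ - _).
by apply/matrixP => j k; rewrite !mxE; field.
Qed.

Lemma residual_half_latent A (b : coef) i :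
  residual M (2^-1 *: A) b i = 2^-1 *: (residual M A b i + residual M 0 b i).
Proof.
have lZ : latent (2^-1 *: A) i = 2^-1 *: latent A i.
  by apply/matrixP => j k; rewrite !mxE.
have l0 : latent (0 : matA) i = 0 by apply/matrixP => j k; rewrite !mxE.
rewrite /residual /regression_mean lZ l0 mulmx0 addr0 -scalemxAr.
set y := eivy M i; set u := _ *m _; set v := _ *m _.
by apply/matrixP => j k; rewrite !mxE; field.
Qed.

Lemma misfit_half_coef A (b : coef) (S : spd R m) :
  misfit M A (2^-1 *: b.1, 2^-1 *: b.2) S <= 2^-1 * (misfit M A b S + misfit M A (0, 0) S).
Proof.
rewrite /misfit -big_split/= mulr_sumr; apply: ler_sum => i _.
by rewrite residual_half_coef qform_half//; apply: spd_invmx; exact: spd_mxP.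
Qed.

Lemma misfit_half_latent A (b : coef) (S : spd R m) :
  misfit M (2^-1 *: A) b S <= 2^-1 * (misfit M A b S + misfit M 0 b S).
Proof.
rewrite /misfit -big_split/= mulr_sumr; apply: ler_sum => i _.
by rewrite residual_half_latent qform_half//; apply: spd_invmx; exact: spd_mxP.
Qed.

Lemma prior_coef_half (b : coef) :
  prior_coef M (2^-1 *: b.1, 2^-1 *: b.2) <= 2^-1 * (prior_coef M b + prior_coef M (0, 0)).
Proof.
rewrite /prior_coef /= -scale_col_mx.
rewrite (_ : _ - _ = 2^-1 *: (col_mx b.1 b.2 - eivj0 M + (col_mx 0 0 - eivj0 M))).
  by apply: qform_half; apply: spd_invmx; exact: spd_mxP.
rewrite col_mx0; set u := col_mx _ _; set j0 := eivj0 M.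
by apply/matrixP => j k; rewrite !mxE; field.
Qed.

Lemma prior_latent_half A :
  prior_latent M (2^-1 *: A) <= 2^-1 * (prior_latent M A + prior_latent M 0).
Proof.
rewrite /prior_latent -big_split/= mulr_sumr; apply: ler_sum => i _.
rewrite (_ : _ - _ = 2^-1 *: (latent A i - shrunk_mean M i + (latent 0 i - shrunk_mean M i))).
  by apply: qform_half; exact: spd_VK.
by set k := shrunk_mean M i; apply/matrixP => j l; rewrite !mxE; field.
Qed.

(** The factors 2 and 4 come from [norm2 (u + v) <= 2 norm2 u + 2 norm2 v], used on data minus mean
    and then on the two terms of the mean. Here [a] bounds [frob A], and [b] bounds [coef_norm2]. *)
Definition residual_bound (a b : R) : R :=
  \sum_i (2 * norm2 (eivy M i) + 4 * (b * norm2 (eivZ M i)) + 4 * (b * a)).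

Lemma norm2_residual A b i : norm2 (residual M A b i) <=
  2 * norm2 (eivy M i) + 4 * (norm2 b.1 * norm2 (eivZ M i)) +
  4 * (norm2 b.2 * norm2 (latent A i)).
Proof.
apply: le_trans (norm2D_le _ _) _; rewrite norm2N -addrA lerD2l.
rewrite (_ : 4 = 2 * 2 :> R); last by rewrite -natrM.
rewrite -!mulrA -mulrDr ler_pM2l//; apply: le_trans (norm2D_le _ _) _.
by rewrite lerD// ler_pM2l// -frob_unvec norm2_tr_mul.
Qed.

Lemma norm2_latent_le (A : matA) i : norm2 (latent A i) <= frob A.
Proof.
rewrite frob_row (bigD1 i)//= lerDl; apply: sumr_ge0 => j _; exact: norm2_ge0.
Qed.

Lemma misfit_le A b (S : spd R m) ra rb : frob A <= ra -> coef_norm2 b <= rb ->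
  misfit M A b S <= \tr (invmx S) * residual_bound ra rb.
Proof.
move=> Ara brb; rewrite /misfit /residual_bound mulr_sumr; apply: ler_sum => i _.
have sS := spd_invmx (spd_mxP S).
apply: le_trans (qform_le_trace _ sS) _.
apply: ler_wpM2l; first exact: spd_trace_ge0.
have b1 : norm2 b.1 <= rb by apply: le_trans brb; rewrite lerDl norm2_ge0.
have b2 : norm2 b.2 <= rb by apply: le_trans brb; rewrite lerDr norm2_ge0.
apply: le_trans (norm2_residual A b i) _.
rewrite !lerD// ler_pM2l//; first by rewrite ler_wpM2r// norm2_ge0.
by rewrite ler_pM// ?norm2_ge0//; apply: le_trans Ara; exact: norm2_latent_le.
Qed.

(** Put [T = tr (S^-1 B0) + misfit]. Doubling [S] halves the exponent [- T / 2], so the density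
    times [exp (T / 4)] is [D^-1] times the density at [2 S]. The misfit only increases [T], whence
    a threshold independent of [A] and [b]. *)
Lemma tail_Sigma : exists ka : R, forall A b,
  ((2^-1)%:E <= conditional_Sigma M (A, b) [set S | \tr (invmx S) <= ka]%R)%E.
Proof.
have [la la0 Bla] := spd_coercive (spd_mxP (eivB0 M)).
pose e : R := - (n + eiva0 M + m + 1)%:R / 2.
(* The factor by which doubling changes the power of the determinant. *)
pose D : R := (2 ^+ m) `^ e.
have D0 : 0 < D by rewrite powR_gt0// exprn_gt0.
pose C : R := 2 ^- #|{: upper_index m}|.
have [w wK] : exists w : R, expR (- w) * (D^-1 * C) <= 2^-1.
  by apply: exists_expRN_small; rewrite mulr_ge0 ?invr_ge0 ?exprn_ge0// ltW.
(* Beyond this value of [tr (S^-1)], coercivity of [B0] gives [T / 4 > w]. *)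
exists (4 * w / la) => A b.
pose F (S : 'M[R]_m) : R := inverse_wishart_unnormalized (n + eiva0 M) (eivB0 M) S *
  expR (- 2^-1 * misfit M A b S).
pose W (S : spd R m) : R := 4^-1 * (\tr (invmx S *m eivB0 M) + misfit M A b S).
have mF : measurable_fun setT F.
  apply: measurable_funM; first by apply: measurable_iw; exact: measurable_id.
  apply: measurableT_comp => //; apply: measurable_funM => //.
  by apply: measurable_misfit => //; exact: measurable_id.
have F0 S : 0 <= F S by rewrite !mulr_ge0 ?powR_ge0 ?expR_ge0.
have mW : measurable_fun setT W.
  apply: measurable_funM => //; apply: measurable_funD.
    apply: measurable_mxtrace; apply: measurable_mulmx => //; apply: measurable_invmx.
    exact: measurable_spd_mx.
  by apply: measurable_misfit => //; exact: measurable_spd_mx.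
have mg : measurable_fun setT (densS M A b).
  by apply: measurable_densS => //; exact: measurable_id.
have cc : 0 < c * expR (- 2^-1 * (prior_latent M A + prior_coef M b)).
  by rewrite mulr_gt0 ?expR_gt0.
have D0' : 0 <= D^-1 by rewrite invr_ge0 ltW.
rewrite /conditional_Sigma.
eapply full_conditional_half.
- exact: cc.
- exact: mg.
- by move=> S; rewrite ltW// densS_gt0.
- by move=> S; rewrite /= posteriorE formula_densS mulrA.
- exact: massS_gt0.
- exact: (massS_lty a0_ge A b).
- exact: measurable_spd_double.
- exact: mW.
- exact: D0'.
- move=> S; have sS := spd_mxP S; have d0 := spd_det_gt0 sS.
  rewrite /densS /inverse_wishart_unnormalized /= detZ powRM ?exprn_ge0 ?(ltW d0)//.
  rewrite -/e -/D !mulrA mulVf ?gt_eqF// mul1r -!mulrA -!expRD.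
  rewrite ler_wpM2l ?powR_ge0// ler_expR /W.
  have iS : invmx (2 *: spd_mx S) = 2^-1 *: invmx S.
    by rewrite invmxZ//; apply: spd_unit; apply: spd_scale.
  rewrite iS -scalemxAl mxtraceZ /misfit iS.
  under [X in _ <= _ + _ * X]eq_bigr do rewrite qformZ.
  by rewrite -mulr_sumr le_eqVlt; apply/orP; left; apply/eqP; field.
- exact: (integral_spd_double mF F0).
- by rewrite -mulrA; exact: wK.
- by apply: measurable_sublevel; apply: measurable_trace_inv; exact: measurable_id.
move=> S /= /negP; rewrite -ltNge ltr_pdivrMr// mulrC => h.
have := misfit_ge0 M A b S; have := trace_coercive (spd_invmx (spd_mxP S)) Bla.
by rewrite /W; lra.
Qed.

(** At zero coefficients the residuals are the [y_i], free of [A]. So [q0] bounds the exponent at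
    the origin uniformly in [A], once [tr (S^-1)] is controlled. *)
Lemma tail_coef ka : exists rb : R, forall A (S : spd R m), \tr (invmx S) <= ka ->
  ((2^-1)%:E <= conditional_coef M (A, S) [set b | coef_norm2 b <= rb]%R)%E.
Proof.
have [a a0 [c1 h]] := prior_coef_coercive M.
pose q0 := ka * residual_bound 0 0 + prior_coef M (0, 0).
pose N := (#|{: 'I_(m * q) * 'I_1}| + #|{: 'I_(m * p) * 'I_1}|)%N.
pose C : R := ((2^-1) ^+ N)^-1.
have C0 : 0 < (2^-1 : R) ^+ N by rewrite exprn_gt0.
have [w wK] : exists w : R, expR (- w) * (expR (4^-1 * q0) * C) <= 2^-1.
  by apply: exists_expRN_small; rewrite mulr_ge0 ?expR_ge0 ?invr_ge0 ?ltW.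
(* Beyond this squared norm the prior term alone exceeds [4 w], and the misfit is nonnegative. *)
exists ((4 * w + c1) / a) => A S Ska.
pose Q b := misfit M A b S + prior_coef M b.
have mQ : measurable_fun setT Q.
  by apply: measurable_funD; [exact: measurable_misfit|exact: measurable_prior_coef].
have cc : 0 < c * (inverse_wishart_unnormalized (n + eiva0 M) (eivB0 M) S *
    expR (- 2^-1 * prior_latent M A)).
  by rewrite mulr_gt0// mulr_gt0 ?expR_gt0 ?iw_gt0.
have mphi : measurable_fun setT (fun b : coef => (2^-1 *: b.1, 2^-1 *: b.2)).
  by apply: measurable_fun_pair; apply: measurable_scalemx.
have mg : measurable_fun setT (fun b : coef => (expR (- 2^-1 * Q b))%:E).
  by apply: measurable_expR_fun; exact: measurable_funM.
rewrite /conditional_coef.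
eapply full_conditional_half_gauss with (q0 := q0) (C := C).
- exact: cc.
- exact: mQ.
- by move=> b; rewrite /= posteriorE formula_densb mulrA.
- exact: (massb_gt0 M A S).
- exact: (massb_lty M A S).
- exact: mphi.
- move=> b; rewrite /Q.
  have h1 := misfit_half_coef A b S; have h2 := prior_coef_half b.
  have h3 : misfit M A (0, 0) S <= ka * residual_bound 0 0.
    apply: (@le_trans _ _ (\tr (invmx S) * residual_bound 0 0)).
      rewrite /misfit /residual_bound mulr_sumr; apply: ler_sum => i _.
      apply: le_trans (qform_le_trace _ (spd_invmx (spd_mxP S))) _.
      apply: ler_wpM2l; first exact: spd_trace_ge0 (spd_invmx (spd_mxP S)).
      apply: le_trans (norm2_residual _ _ _) _.
      have n0 k : norm2 (0 : 'cV[R]_k) = 0 by apply: big1 => j _; rewrite mxE expr0n.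
      by rewrite /= !n0 !mul0r.
    apply: ler_wpM2r => //; apply: sumr_ge0 => i _.
    by rewrite !mul0r !mulr0 !addr0 mulr_ge0 ?norm2_ge0.
  apply: le_trans (lerD h1 h2) _; rewrite -mulrDr ler_pM2l//.
  by rewrite addrACA lerD2l lerD2r.
- rewrite [in RHS](dilate_lebesgue_prod (_ : 0 < 2^-1) mg)// muleA -EFinM.
  by rewrite /C mulVf ?gt_eqF// mul1e.
- exact: wK.
- apply: measurable_sublevel; apply: measurable_funD.
    by under eq_fun do rewrite -frob_col; apply: measurable_frob; exact: measurable_fst.
  by under eq_fun do rewrite -frob_col; apply: measurable_frob; exact: measurable_snd.
move=> b /= /negP; rewrite -ltNge ltr_pdivrMr// mulrC => hb.
have := misfit_ge0 M A b S; have := h b.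
by rewrite /Q; lra.
Qed.

(** At [A = 0] the residual is [y_i - Theta^T Z_i], which involves the coefficients: hence the
    additional bound [rb]. *)
Lemma tail_latent ka rb : exists ra : R, forall b (S : spd R m),
  coef_norm2 b <= rb -> \tr (invmx S) <= ka ->
  ((2^-1)%:E <= conditional_A M (b, S) [set A | frob A <= ra]%R)%E.
Proof.
have [a a0 [c1 h]] := prior_latent_coercive M.
pose q0 := ka * residual_bound 0 rb + prior_latent M 0.
pose N := #|{: 'I_n * 'I_p}|%N.
pose C : R := ((2^-1) ^+ N)^-1.
have C0 : 0 < (2^-1 : R) ^+ N by rewrite exprn_gt0.
have [w wK] : exists w : R, expR (- w) * (expR (4^-1 * q0) * C) <= 2^-1.
  by apply: exists_expRN_small; rewrite mulr_ge0 ?expR_ge0 ?invr_ge0 ?ltW.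
exists ((4 * w + c1) / a) => b S brb Ska.
have rb0 : 0 <= rb by apply: le_trans brb; rewrite addr_ge0 ?norm2_ge0.
pose Q A := misfit M A b S + prior_latent M A.
have mQ : measurable_fun setT Q.
  apply: measurable_funD; last exact: measurable_prior_latent.
  by apply: measurable_misfit => //; exact: measurable_id.
have cc : 0 < c * (inverse_wishart_unnormalized (n + eiva0 M) (eivB0 M) S *
    expR (- 2^-1 * prior_coef M b)).
  by rewrite mulr_gt0// mulr_gt0 ?expR_gt0 ?iw_gt0.
have mphi : measurable_fun setT (fun A : matA => 2^-1 *: A).
  by apply: measurable_scalemx; exact: measurable_id.
have mg : measurable_fun setT (fun A : matA => (expR (- 2^-1 * Q A))%:E).
  by apply: measurable_expR_fun; exact: measurable_funM.
rewrite /conditional_A.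
eapply full_conditional_half_gauss with (q0 := q0) (C := C).
- exact: cc.
- exact: mQ.
- by move=> A; rewrite /= posteriorE formula_densA mulrA.
- exact: (massA_gt0 M b S).
- exact: (massA_lty M b S).
- exact: mphi.
- move=> A; rewrite /Q.
  have h1 := misfit_half_latent A b S; have h2 := prior_latent_half A.
  have h3 : misfit M 0 b S <= ka * residual_bound 0 rb.
    have f0 : frob (0 : matA) <= 0.
      by rewrite /frob big1// => i _; apply: big1 => j _; rewrite mxE expr0n.
    apply: le_trans (misfit_le S f0 brb) _; apply: ler_wpM2r => //.
    apply: sumr_ge0 => i _.
    by rewrite !mulr0 !addr0 addr_ge0// mulr_ge0 ?norm2_ge0// mulr_ge0 ?norm2_ge0.
  apply: le_trans (lerD h1 h2) _; rewrite -mulrDr ler_pM2l//.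
  by rewrite addrACA lerD2l lerD2r.
- rewrite [in RHS](dilate_lebesgue_mx (_ : 0 < 2^-1) mg)// muleA -EFinM.
  by rewrite /C mulVf ?gt_eqF// mul1e.
- exact: wK.
- by apply: measurable_sublevel; apply: measurable_frob; exact: measurable_id.
move=> A /= /negP; rewrite -ltNge ltr_pdivrMr// mulrC => hA.
have := misfit_ge0 M A b S; have := h A.
by rewrite /Q; lra.
Qed.

End eiv_tails.

(** * Normalization of the posterior *)

Section product_functions.
Local Open Scope ereal_scope.
Context d1 d2 (T1 : measurableType d1) (T2 : measurableType d2) (R : realType).
Variables (mu : {sigma_finite_measure set T1 -> \bar R})
  (nu : {sigma_finite_measure set T2 -> \bar R}).

Lemma integral_prod_mul (f : T1 -> R) (g : T2 -> R) :
  measurable_fun setT f -> measurable_fun setT g ->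
  (forall x, (0 <= f x)%R) -> (forall y, (0 <= g y)%R) ->
  \int[prod_measure mu nu]_z (f z.1 * g z.2)%:E =
  (\int[mu]_x (f x)%:E) * (\int[nu]_y (g y)%:E).
Proof.
move=> mf mg f0 g0.
have J0 : 0 <= \int[nu]_y (g y)%:E by apply: integral_ge0 => y _; rewrite lee_fin.
have mfE : measurable_fun setT (EFin \o f) by exact/measurable_EFinP.
have mgE : measurable_fun setT (EFin \o g) by exact/measurable_EFinP.
rewrite integral_prod_measure; last 2 first.
- by apply/measurable_EFinP; apply: measurable_funM; exact: measurableT_comp.
- by move=> z; rewrite lee_fin mulr_ge0.
rewrite -ge0_integralZr//; last by move=> x _; rewrite lee_fin.
apply: eq_integral => x _ /=.
by rewrite -(integralZl_nneg _ (f0 x)).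
Qed.

End product_functions.

Section posterior_constant.
Context {R : realType} {m n p q : nat} (M : eiv_model R m n p q).
Local Notation matA := 'M[R]_(n, p).
Local Notation coef := ('cV[R]_(m * q) * 'cV[R]_(m * p))%type.
Local Notation state := ('M[R]_(n, p) * coef * spd R m)%type.
Local Notation V := (eivV M).
Local Notation K := (eivK M).
Hypothesis a0_ge : (m <= eiva0 M)%N.

Lemma measurable_posterior_formula : measurable_fun setT (posterior_formula M).
Proof.
rewrite (_ : posterior_formula M = fun s : state =>
  expR (- 2^-1 * (prior_latent M s.1.1 + prior_coef M s.1.2)) * densS M s.1.1 s.1.2 s.2); last first.
  by apply/funext => -[[A b] S]; rewrite formula_densS.
have m1 : measurable_fun [set: state] (fun s => s.1.1) by exact: measurableT_comp.
have m2 : measurable_fun [set: state] (fun s => s.1.2) by exact: measurableT_comp.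
apply: measurable_funM; last exact: measurable_densS.
apply: measurableT_comp => //; apply: measurable_funM => //; apply: measurable_funD.
  exact: measurable_prior_latent.
exact: measurable_prior_coef.
Qed.

Lemma posterior_formula_gt0 s : 0 < posterior_formula M s.
Proof. by case: s => -[A b] S; rewrite formula_densS mulr_gt0 ?expR_gt0 ?densS_gt0. Qed.

Lemma lebesgue_state_neq0 : @lebesgue_state R m n p q setT != 0%E.
Proof.
apply: prod_measure_neq0; last exact: lebesgue_spd_neq0.
by apply: prod_measure_neq0; [exact: lebesgue_mx_neq0|exact: lebesgue_coef_neq0].
Qed.

Lemma integral_formula_gt0 : (0 < \int[@lebesgue_state R m n p q]_s (posterior_formula M s)%:E)%E.
Proof.
apply: integral_gt0; [exact: measurable_posterior_formula| |exact: lebesgue_state_neq0].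
exact: posterior_formula_gt0.
Qed.

(** Without the misfit the formula factors over the three blocks, and each factor has finite
    mass. *)
Lemma integral_formula_lty :
  (\int[@lebesgue_state R m n p q]_s (posterior_formula M s)%:E < +oo)%E.
Proof.
pose fA (A : matA) := expR (- 2^-1 * prior_latent M A).
pose fb (b : coef) := expR (- 2^-1 * prior_coef M b).
pose fS (S : spd R m) := inverse_wishart_unnormalized (n + eiva0 M) (eivB0 M) S.
have mfA : measurable_fun setT fA.
  by apply: measurableT_comp => //; apply: measurable_funM => //; exact: measurable_prior_latent.
have mfb : measurable_fun setT fb.
  by apply: measurableT_comp => //; apply: measurable_funM => //; exact: measurable_prior_coef.
have mfS : measurable_fun setT fS by apply: measurable_iw; exact: measurable_spd_mx.
have fA0 A : 0 <= fA A by exact: expR_ge0.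
have fb0 b : 0 <= fb b by exact: expR_ge0.
have fS0 S : 0 <= fS S by exact/ltW/iw_gt0.
pose fAb (z : matA * coef) := fA z.1 * fb z.2.
have mfAb : measurable_fun setT fAb by apply: measurable_funM; exact: measurableT_comp.
have fAb0 z : 0 <= fAb z by rewrite mulr_ge0.
apply: (@le_lt_trans _ _ (\int[@lebesgue_state R m n p q]_s (fAb s.1 * fS s.2)%:E)%E).
  apply: le_integral_nneg.
  - by apply/measurable_EFinP; exact: measurable_posterior_formula.
  - by apply/measurable_EFinP; apply: measurable_funM; exact: measurableT_comp.
  - by move=> s; rewrite lee_fin ltW// posterior_formula_gt0.
  move=> [[A b] S]; rewrite lee_fin formula_densS /densS /fAb /fA /fb /= -expRD -mulrDr.
  rewrite ler_wpM2l ?expR_ge0// ler_piMr//; first exact/ltW/iw_gt0.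
  by rewrite -expR0 ler_expR mulNr oppr_le0 mulr_ge0 ?misfit_ge0.
have -> : (\int[@lebesgue_state R m n p q]_s (fAb s.1 * fS s.2)%:E)%E =
    ((\int[lebesgue_mx n p]_A (fA A)%:E) * (\int[@lebesgue_coef R m p q]_b (fb b)%:E) *
     (\int[lebesgue_spd m]_S (fS S)%:E))%E.
  rewrite -(integral_prod_mul (lebesgue_mx n p) (@lebesgue_coef R m p q) mfA mfb fA0 fb0).
  exact: (integral_prod_mul _ (lebesgue_spd m) mfAb mfS fAb0 fS0).
have h (x y z : \bar R) : (0 <= x -> 0 <= y -> 0 <= z ->
    x < +oo -> y < +oo -> z < +oo -> x * y * z < +oo)%E.
  move=> x0 y0 z0 xoo yoo zoo.
  by rewrite !lte_mul_pinfty// ?ge0_fin_numE// ?mule_ge0// lte_mul_pinfty// ge0_fin_numE.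
apply: h.
- by apply: integral_ge0 => A _; rewrite lee_fin.
- by apply: integral_ge0 => b _; rewrite lee_fin.
- by apply: integral_ge0 => S _; rewrite lee_fin.
- exact: boundA_lty.
- exact: boundb_lty.
- exact: boundS_lty.
Qed.

Definition gauss_const d (C : 'M[R]_d) : R := (Num.sqrt ((2 * pi) ^+ d * \det C))^-1.

Lemma gauss_const_gt0 d (C : spd R d) : 0 < gauss_const C.
Proof.
rewrite invr_gt0 sqrtr_gt0 mulr_gt0 ?exprn_gt0 ?mulr_gt0 ?pi_gt0//.
exact: spd_det_gt0 (spd_mxP C).
Qed.

Lemma gauss_constE d (C : spd R d) :
  gauss_const C = (Num.sqrt ((2 * pi) ^+ d))^-1 * (\det C) `^ (- 2^-1).
Proof.
have c0 := spd_det_gt0 (spd_mxP C).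
rewrite /gauss_const sqrtrM ?exprn_ge0 ?mulr_ge0 ?pi_ge0// invfM; congr (_ * _).
by rewrite powRN powR12_sqrt// ltW.
Qed.

(** The constant gathers the Gaussian prefactors, the inverse-Wishart normalizer and, for each [i],
    the remainder of the completed square. Each observation contributes [(det S) ^ (- 1/2)], whence
    [n] in the exponent. *)
Lemma joint_densityE : exists2 ka : R, 0 < ka &
  forall s, joint_density M s = ka * posterior_formula M s.
Proof.
pose cst i := qform (invmx (V i)) (eivx M i) + qform (invmx (K i)) (eivk M i) -
  qform (invmx (V i) + invmx (K i)) (shrunk_mean M i).
pose r0 : R := (Num.sqrt ((2 * pi) ^+ m))^-1.
have r00 : 0 < r0 by rewrite invr_gt0 sqrtr_gt0 exprn_gt0// mulr_gt0// pi_gt0.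
pose ki i := r0 * gauss_const (V i) * gauss_const (K i) * expR (- 2^-1 * cst i).
have ki0 i : 0 < ki i by rewrite !mulr_gt0 ?gauss_const_gt0 ?expR_gt0.
pose z : R := fine (\int[@lebesgue_spd R m]_S
  (inverse_wishart_unnormalized (eiva0 M) (eivB0 M) S)%:E)%E.
have z0 : 0 < z by rewrite fine_gt0// inverse_wishart_gt0 inverse_wishart_lty.
exists ((\prod_i ki i) * z^-1 * gauss_const (eivJ0 M)).
  apply: mulr_gt0; last exact: gauss_const_gt0.
  by apply: mulr_gt0; [apply: prodr_gt0 => i _; exact: ki0|rewrite invr_gt0].
case=> -[A b] S; have sS := spd_mxP S; have d0 := spd_det_gt0 sS.
rewrite /joint_density /posterior_formula.
have termE i : gaussian_pdf (regression_mean M A b i) S (eivy M i) *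
    gaussian_pdf (latent A i) (V i) (eivx M i) * gaussian_pdf (eivk M i) (K i) (latent A i) =
    ki i * ((\det S) `^ (- 2^-1) *
    (expR (- 2^-1 * qform (invmx S) (eivy M i - regression_mean M A b i)) *
     expR (- 2^-1 * qform (invmx (V i) + invmx (K i)) (latent A i - shrunk_mean M i)))).
  rewrite /gaussian_pdf -!/(gauss_const _) (gauss_constE S) -/r0 /ki.
  have := complete_square (eivx M i) (eivk M i) (latent A i)
    (spd_invmx (spd_mxP (V i))) (spd_invmx (spd_mxP (K i))).
  rewrite /= -/(shrunk_mean M i) -/(cst i) => sq.
  have : expR (- 2^-1 * qform (invmx (V i)) (eivx M i - latent A i)) *
      expR (- 2^-1 * qform (invmx (K i)) (latent A i - eivk M i)) =
      expR (- 2^-1 * cst i) *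
      expR (- 2^-1 * qform (invmx (V i) + invmx (K i)) (latent A i - shrunk_mean M i)).
    by rewrite -!expRD -!mulrDr sq addrC.
  set e1 := expR (_ * qform (invmx (V i)) _); set e2 := expR (_ * qform (invmx (K i)) _).
  set e3 := expR (_ * cst i); set e4 := expR (_ * qform (_ + _) _).
  set e5 := expR (_ * qform (invmx S) _); set t := _ `^ _ => e12.
  transitivity (r0 * gauss_const (V i) * gauss_const (K i) * t * e5 * (e1 * e2)); first by ring.
  by rewrite e12; ring.
have iwE : inverse_wishart_pdf (eiva0 M) (eivB0 M) S =
    inverse_wishart_unnormalized (eiva0 M) (eivB0 M) S / z by [].
clearbody ki z.
rewrite (eq_bigr _ (fun i _ => termE i)) !big_split/=.
rewrite /gaussian_pdf -/(gauss_const _) iwE.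
rewrite -!expR_sum prodr_const card_ord -!mulr_sumr.
rewrite /inverse_wishart_unnormalized.
have -> : \det S `^ (- (n + eiva0 M + m + 1)%:R / 2) =
    (\det S `^ (- 2^-1)) ^+ n * \det S `^ (- (eiva0 M + m + 1)%:R / 2).
  rewrite -powR_mulrn ?powR_ge0// -powRrM -powRD; last by rewrite (gt_eqF d0) implybT.
  by congr (_ `^ _); rewrite -!addnA natrD; field.
rewrite !expRD; set t := (_ `^ _) ^+ n; set t2 := _ `^ _.
by rewrite -!(mulNr 2^-1); ring.
Qed.

Lemma posterior_constant : exists2 c : R, 0 < c &
  forall s, posterior_density M s = c * posterior_formula M s.
Proof.
have [ka ka0 jE] := joint_densityE.
exists (ka / fine (\int[@lebesgue_state R m n p q]_u (joint_density M u)%:E)%E); last first.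
  by move=> s; rewrite /posterior_density jE mulrAC.
rewrite divr_gt0//; under eq_integral do rewrite jE EFinM.
rewrite integralZl_nneg ?(ltW ka0)//.
- rewrite fine_gt0// mule_gt0 ?lte_fin ?integral_formula_gt0//=.
  rewrite lte_mul_pinfty ?lee_fin ?(ltW ka0)//.
  exact: integral_formula_lty.
- by apply/measurable_EFinP; exact: measurable_posterior_formula.
- by move=> s; rewrite lee_fin ltW// posterior_formula_gt0.
Qed.

Lemma posteriorT : posterior M setT = 1%E.
Proof.
have [ka ka0 jE] := joint_densityE.
set J := (\int[@lebesgue_state R m n p q]_u (joint_density M u)%:E)%E.
have JE : J = (ka%:E * \int[@lebesgue_state R m n p q]_u (posterior_formula M u)%:E)%E.
  rewrite /J; under eq_integral do rewrite jE EFinM.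
  rewrite integralZl_nneg ?(ltW ka0)//.
  - by apply/measurable_EFinP; exact: measurable_posterior_formula.
  - by move=> s; rewrite lee_fin ltW// posterior_formula_gt0.
have J0 : (0 < J)%E by rewrite JE mule_gt0 ?lte_fin// integral_formula_gt0.
have Joo : (J < +oo)%E.
  by rewrite JE lte_mul_pinfty ?lee_fin ?(ltW ka0)// integral_formula_lty.
have Jr : 0 < fine J by rewrite fine_gt0// J0.
rewrite /posterior /posterior_density -/J.
under eq_integral do rewrite mulrC EFinM.
rewrite integralZl_nneg; last 3 first.
- by rewrite invr_ge0 ltW.
- rewrite (_ : (fun _ => _) = fun s => (ka * posterior_formula M s)%:E); last first.
    by apply/funext => s; rewrite jE.
  by apply/measurable_EFinP; apply: measurable_funM => //; exact: measurable_posterior_formula.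
- by move=> s; rewrite jE lee_fin mulr_ge0 ?(ltW ka0)// ltW// posterior_formula_gt0.
by rewrite -/J -{2}(@fineK _ J) ?ge0_fin_numE ?(ltW J0)// -EFinM mulVf ?gt_eqF.
Qed.

End posterior_constant.

Lemma measure_integral_indic d (T : measurableType d) (R : realType)
    (mu : {measure set T -> \bar R}) (B : set T) : measurable B ->
  mu B = (\int[mu]_x (\1_B x)%:E)%E.
Proof. by move=> mB; rewrite integral_indic// setIT. Qed.

(** * Minorization and ergodicity of the sampler *)

Section eiv_ergodic.
Context {R : realType} {m n p q : nat} (M : eiv_model R m n p q).
Local Notation matA := 'M[R]_(n, p).
Local Notation coef := ('cV[R]_(m * q) * 'cV[R]_(m * p))%type.
Local Notation state := ('M[R]_(n, p) * coef * spd R m)%type.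
Hypothesis a0_ge : (m <= eiva0 M)%N.

Let pA (A : matA) (b : coef) (S : spd R m) : R := densA M A b S / fine (massA M b S).
Let pb (A : matA) (b : coef) (S : spd R m) : R := densb M A b S / fine (massb M A S).
Let pS (A : matA) (b : coef) (S : spd R m) : R := densS M A b S / fine (massS M A b).

Let massA_fin b S : massA M b S \is a fin_num.
Proof. by rewrite ge0_fin_numE ?massA_lty// ltW// massA_gt0. Qed.

Let massb_fin A S : massb M A S \is a fin_num.
Proof. by rewrite ge0_fin_numE ?massb_lty// ltW// massb_gt0. Qed.

Let massS_fin A b : massS M A b \is a fin_num.
Proof. by rewrite ge0_fin_numE ?massS_lty// ltW// massS_gt0. Qed.

Let fmassA_gt0 b S : 0 < fine (massA M b S).
Proof. by rewrite fine_gt0// massA_gt0 massA_lty. Qed.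

Let fmassb_gt0 A S : 0 < fine (massb M A S).
Proof. by rewrite fine_gt0// massb_gt0 massb_lty. Qed.

Let fmassS_gt0 A b : 0 < fine (massS M A b).
Proof. by rewrite fine_gt0// massS_gt0 massS_lty. Qed.

Let pA_gt0 A b S : 0 < pA A b S. Proof. by rewrite divr_gt0 ?densA_gt0. Qed.

Let pb_gt0 A b S : 0 < pb A b S. Proof. by rewrite divr_gt0 ?densb_gt0. Qed.

Let pS_gt0 A b S : 0 < pS A b S. Proof. by rewrite divr_gt0 ?densS_gt0. Qed.

Let density1 d (T : measurableType d) (mu : {measure set T -> \bar R}) (g : T -> R) :
  measurable_fun setT g -> (forall x, 0 <= g x) -> 0 < fine (\int[mu]_x (g x)%:E)%E ->
  (\int[mu]_x (g x)%:E)%E \is a fin_num ->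
  (\int[mu]_x (g x / fine (\int[mu]_x (g x)%:E)%E)%:E = 1)%E.
Proof.
move=> mg g0 Z0 Zfin; under eq_integral do rewrite mulrC EFinM.
rewrite integralZl_nneg.
- by rewrite -{2}(fineK Zfin) -EFinM mulVf ?gt_eqF.
- by rewrite invr_ge0 ltW.
- exact/measurable_EFinP.
- by move=> x; rewrite lee_fin.
Qed.

Let m1 : measurable_fun [set: state] (fun s => s.1.1). Proof. exact: measurableT_comp. Qed.

Let m2 : measurable_fun [set: state] (fun s => s.1.2). Proof. exact: measurableT_comp. Qed.

Let mdA : measurable3 (fun A b S => (densA M A b S)%:E).
Proof. by apply/measurable_EFinP; exact: measurable_densA. Qed.

Let mdb : measurable3 (fun A b S => (densb M A b S)%:E).
Proof. by apply/measurable_EFinP; exact: measurable_densb. Qed.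

Let mdS : measurable3 (fun A b S => (densS M A b S)%:E).
Proof. by apply/measurable_EFinP; exact: measurable_densS. Qed.

Let mpA : measurable3 (fun A b S => (pA A b S)%:E).
Proof.
have h : measurable_fun setT (fun s : coef * spd R m => massA M s.1 s.2).
  apply: (@measurable_integral3 _ _ _ _ _ _ _ (lebesgue_mx n p)
    (fun b S A => (densA M A b S)%:E)); last by move=> *; rewrite lee_fin expR_ge0.
  exact (measurable3_23 (measurable3_12 mdA)).
have g : measurable_fun [set: state] (fun s => (s.1.2, s.2)) by exact: measurable_fun_pair.
apply/measurable_EFinP; apply: measurable_funM; first exact: measurable_densA.
apply: measurable_inv; apply: measurableT_comp => //; exact: (measurableT_comp h g).
Qed.

Let mpb : measurable3 (fun A b S => (pb A b S)%:E).
Proof.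
have h : measurable_fun setT (fun s : matA * spd R m => massb M s.1 s.2).
  apply: (@measurable_integral3 _ _ _ _ _ _ _ (@lebesgue_coef R m p q)
    (fun A S b => (densb M A b S)%:E)); last by move=> *; rewrite lee_fin expR_ge0.
  exact (measurable3_23 mdb).
have g : measurable_fun [set: state] (fun s => (s.1.1, s.2)) by exact: measurable_fun_pair.
apply/measurable_EFinP; apply: measurable_funM; first exact: measurable_densb.
apply: measurable_inv; apply: measurableT_comp => //; exact: (measurableT_comp h g).
Qed.

Let mpS : measurable3 (fun A b S => (pS A b S)%:E).
Proof.
have h : measurable_fun setT (fun s : matA * coef => massS M s.1 s.2).
  apply: (@measurable_integral3 _ _ _ _ _ _ _ (lebesgue_spd m)
    (fun A b S => (densS M A b S)%:E)); last by move=> *; rewrite lee_fin ltW ?densS_gt0.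
  exact mdS.
apply/measurable_EFinP; apply: measurable_funM; first exact: measurable_densS.
by apply: measurable_inv; apply: measurableT_comp => //; exact: (measurableT_comp h).
Qed.

(** The small set. It leaves [Sigma] free because the law of a sweep depends on the current state
    through [(A, theta, beta)] only. *)
Let Ct (ra rb : R) : set (matA * coef) := [set z | frob z.1 <= ra /\ coef_norm2 z.2 <= rb].

Let mCt ra rb : measurable (Ct ra rb).
Proof.
have -> : Ct ra rb = [set z | frob z.1 <= ra] `&` [set z | coef_norm2 z.2 <= rb] by [].
apply: measurableI; apply: measurable_sublevel.
  by apply: measurable_frob; exact: measurable_fst.
have h1 : measurable_fun [set: matA * coef] (fun z => z.2.1) by exact: measurableT_comp.
have h2 : measurable_fun [set: matA * coef] (fun z => z.2.2) by exact: measurableT_comp.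
by apply: measurable_funD; under eq_fun do rewrite -frob_col; exact: measurable_frob.
Qed.

(** The transition density with each quantity of the old state replaced by its worst case on
    [Ct ra rb], and each normalizing constant by its upper bound. The numerator of the first factor
    is exact, since [A] is drawn given new values only. *)
Definition minorant ra rb (A : matA) (b : coef) (S : spd R m) : R :=
  (densA M A b S / fine (boundA M)) *
  (expR (- 2^-1 * (\tr (invmx S) * residual_bound M ra (coef_norm2 b) + prior_coef M b)) /
    fine (boundb M)) *
  (inverse_wishart_unnormalized (n + eiva0 M) (eivB0 M) S *
   expR (- 2^-1 * (\tr (invmx S) * residual_bound M ra rb)) / fine (boundS M)).

Let boundS_fin : boundS M \is a fin_num.
Proof. by rewrite ge0_fin_numE ?boundS_lty// integral_ge0// => S _; rewrite lee_fin ltW// iw_gt0. Qed.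

Let boundb_fin : boundb M \is a fin_num.
Proof. by rewrite ge0_fin_numE ?boundb_lty// integral_ge0// => b _; rewrite lee_fin expR_ge0. Qed.

Let boundA_fin : boundA M \is a fin_num.
Proof. by rewrite ge0_fin_numE ?boundA_lty// integral_ge0// => A _; rewrite lee_fin expR_ge0. Qed.

Let fmassA_le b S : fine (massA M b S) <= fine (boundA M).
Proof. by rewrite fine_le// massA_le. Qed.

Let fmassb_le A S : fine (massb M A S) <= fine (boundb M).
Proof. by rewrite fine_le// massb_le. Qed.

Let fmassS_le A b : fine (massS M A b) <= fine (boundS M).
Proof. by rewrite fine_le// massS_le. Qed.

Let boundA_gt0 : 0 < fine (boundA M).
Proof. exact: lt_le_trans (fmassA_gt0 0 (eivB0 M)) (fmassA_le _ _). Qed.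

Let boundb_gt0 : 0 < fine (boundb M).
Proof. exact: lt_le_trans (fmassb_gt0 0 (eivB0 M)) (fmassb_le _ _). Qed.

Let boundS_gt0 : 0 < fine (boundS M).
Proof. exact: lt_le_trans (fmassS_gt0 0 0) (fmassS_le _ _). Qed.

Lemma minorant_gt0 ra rb A b S : 0 < minorant ra rb A b S.
Proof.
rewrite /minorant; apply: mulr_gt0; [apply: mulr_gt0|]; apply: divr_gt0 => //.
- exact: densA_gt0.
- exact: expR_gt0.
- by rewrite mulr_gt0 ?expR_gt0 ?iw_gt0.
Qed.

Lemma measurable_minorant ra rb : measurable3 (fun A b S => (minorant ra rb A b S)%:E).
Proof.
have mn : measurable_fun [set: state] (fun s => coef_norm2 s.1.2).
  have h1 : measurable_fun [set: state] (fun z => z.1.2.1) by exact: measurableT_comp.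
  have h2 : measurable_fun [set: state] (fun z => z.1.2.2) by exact: measurableT_comp.
  by apply: measurable_funD; under eq_fun do rewrite -frob_col; exact: measurable_frob.
have mt : measurable_fun [set: state] (fun s => \tr (invmx s.2)).
  exact: measurable_trace_inv.
have mr : measurable_fun [set: state] (fun s => residual_bound M ra (coef_norm2 s.1.2)).
  apply: measurable_sum => i; apply: measurable_funD; last first.
    by apply: measurable_funM => //; exact: measurable_funM.
  apply: measurable_funD => //; apply: measurable_funM => //; exact: measurable_funM.
apply/measurable_EFinP; apply: measurable_funM; last first.
  apply: measurable_funM => //; apply: measurable_funM.
    by apply: measurable_iw; apply: measurableT_comp => //; exact: measurable_spd_mx.
  apply: measurableT_comp => //; apply: measurable_funM => //; exact: measurable_funM.
apply: measurable_funM; apply: measurable_funM => //; first exact: measurable_densA.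
apply: measurableT_comp => //; apply: measurable_funM => //; apply: measurable_funD.
  exact: measurable_funM.
exact: measurable_prior_coef.
Qed.

Let ratio_le (a b u v : R) : 0 < u -> 0 <= a -> a <= b -> u <= v -> a / v <= b / u.
Proof.
move=> u0 a0 ab uv; apply: ler_pM => //; first by rewrite invr_ge0 (le_trans (ltW u0)).
by rewrite lef_pV2 ?posrE// (lt_le_trans u0).
Qed.

Lemma minorant_le ra rb A b A' b' S' : frob A <= ra -> coef_norm2 b <= rb ->
  minorant ra rb A' b' S' <= pA A' b' S' * pb A b' S' * pS A b S'.
Proof.
move=> Ara brb.
have eb : expR (- 2^-1 * (\tr (invmx S') * residual_bound M ra (coef_norm2 b') + prior_coef M b'))
    <= densb M A b' S'.
  by rewrite ler_expR !mulNr lerN2 ler_wpM2l// lerD2r misfit_le.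
have eS : inverse_wishart_unnormalized (n + eiva0 M) (eivB0 M) S' *
    expR (- 2^-1 * (\tr (invmx S') * residual_bound M ra rb)) <= densS M A b S'.
  by rewrite ler_wpM2l ?(ltW (iw_gt0 _ _ _))// ler_expR !mulNr lerN2 ler_wpM2l// misfit_le.
have iwe0 : 0 <= inverse_wishart_unnormalized (n + eiva0 M) (eivB0 M) S' *
    expR (- 2^-1 * (\tr (invmx S') * residual_bound M ra rb)).
  by rewrite mulr_ge0 ?expR_ge0// ltW// iw_gt0.
rewrite /minorant /pA /pb /pS; apply: ler_pM.
- by rewrite mulr_ge0// divr_ge0 ?expR_ge0// ltW.
- by rewrite divr_ge0// ltW.
- apply: ler_pM.
  + by rewrite divr_ge0 ?expR_ge0// ltW.
  + by rewrite divr_ge0 ?expR_ge0// ltW.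
  + by apply: ratio_le => //; exact: expR_ge0.
  + by apply: ratio_le => //; exact: expR_ge0.
- exact: ratio_le.
Qed.

Variable c : R.
Hypotheses (c0 : 0 < c)
  (posteriorE : forall s, posterior_density M s = c * posterior_formula M s).

Let cS A b : 0 < c * expR (- 2^-1 * (prior_latent M A + prior_coef M b)).
Proof. by rewrite mulr_gt0 ?expR_gt0. Qed.

Let cb A (S : spd R m) : 0 < c * (inverse_wishart_unnormalized (n + eiva0 M) (eivB0 M) S *
  expR (- 2^-1 * prior_latent M A)).
Proof. by rewrite mulr_gt0// mulr_gt0 ?expR_gt0 ?iw_gt0. Qed.

Let cA b (S : spd R m) : 0 < c * (inverse_wishart_unnormalized (n + eiva0 M) (eivB0 M) S *
  expR (- 2^-1 * prior_coef M b)).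
Proof. by rewrite mulr_gt0// mulr_gt0 ?expR_gt0 ?iw_gt0. Qed.

Lemma integral_conditional_Sigma A b (h : spd R m -> \bar R) : measurable_fun setT h ->
  (forall S, (0 <= h S)%E) ->
  (\int[conditional_Sigma M (A, b)]_S h S = \int[lebesgue_spd m]_S (h S * (pS A b S)%:E))%E.
Proof.
move=> mh h0; rewrite /conditional_Sigma; eapply integral_full_conditional.
- exact: (cS A b).
- by apply: measurable_densS => //; exact: measurable_id.
- by move=> S; rewrite ltW// densS_gt0.
- by move=> S; rewrite /= posteriorE formula_densS mulrA.
- exact: massS_gt0.
- exact: massS_lty.
- exact: mh.
- exact: h0.
Qed.

Lemma integral_conditional_coef A S (h : coef -> \bar R) : measurable_fun setT h ->
  (forall b, (0 <= h b)%E) ->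
  (\int[conditional_coef M (A, S)]_b h b = \int[@lebesgue_coef R m p q]_b (h b * (pb A b S)%:E))%E.
Proof.
move=> mh h0; rewrite /conditional_coef; eapply integral_full_conditional.
- exact: (cb A S).
- by apply: measurable_densb => //; exact: measurable_id.
- by move=> b; exact: expR_ge0.
- by move=> b; rewrite /= posteriorE formula_densb mulrA.
- exact: massb_gt0.
- exact: massb_lty.
- exact: mh.
- exact: h0.
Qed.

Lemma integral_conditional_A b S (h : matA -> \bar R) : measurable_fun setT h ->
  (forall A, (0 <= h A)%E) ->
  (\int[conditional_A M (b, S)]_A h A = \int[lebesgue_mx n p]_A (h A * (pA A b S)%:E))%E.
Proof.
move=> mh h0; rewrite /conditional_A; eapply integral_full_conditional.
- exact: (cA b S).
- by apply: measurable_densA => //; exact: measurable_id.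
- by move=> A; exact: expR_ge0.
- by move=> A; rewrite /= posteriorE formula_densA mulrA.
- exact: massA_gt0.
- exact: massA_lty.
- exact: mh.
- exact: h0.
Qed.

Let section_fst d1 d2 (T1 : measurableType d1) (T2 : measurableType d2) (F : T1 -> T2 -> \bar R) y :
  measurable_fun setT (fun s => F s.1 s.2) -> measurable_fun setT (F ^~ y).
Proof.
move=> mF; have mg : measurable_fun setT (fun x : T1 => (x, y)) by exact: measurable_fun_pair.
exact: (measurableT_comp mF mg).
Qed.

Let section_snd d1 d2 (T1 : measurableType d1) (T2 : measurableType d2) (F : T1 -> T2 -> \bar R) x :
  measurable_fun setT (fun s => F s.1 s.2) -> measurable_fun setT (F x).
Proof.
move=> mF; have mg : measurable_fun setT (fun y : T2 => (x, y)) by exact: measurable_fun_pair.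
exact: (measurableT_comp mF mg).
Qed.

Section sweep_of_h.
Variable h : state -> \bar R.
Hypotheses (mh : measurable_fun setT h) (h0 : forall s, (0 <= h s)%E).

Let H (A : matA) (b : coef) (S : spd R m) := h (A, b, S).

Let sX := sweepX (lebesgue_mx n p) pA H.
Let sY := sweepY (lebesgue_mx n p) (@lebesgue_coef R m p q) pA pb H.

Let mH : measurable3 H.
Proof. by rewrite /measurable3 (_ : (fun _ => _) = h)//; apply/funext => -[[]]. Qed.

Let H0 A' b' S' : (0 <= H A' b' S')%E. Proof. exact: h0. Qed.

Let pA0 A b S : 0 <= pA A b S. Proof. exact: ltW. Qed.

Let pb0 A b S : 0 <= pb A b S. Proof. exact: ltW. Qed.

Let sX0 b S : (0 <= sX b S)%E. Proof. exact: sweepX_ge0. Qed.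

Let sY0 A S : (0 <= sY A S)%E. Proof. exact: sweepY_ge0. Qed.

Let mX S : measurable_fun setT (sX ^~ S).
Proof. by apply: section_fst; exact: measurable_sweepX. Qed.

Let mY A : measurable_fun setT (sY A).
Proof. by apply: section_snd; exact: measurable_sweepY. Qed.

Let mhA b S : measurable_fun setT (fun A : matA => h (A, b, S)).
Proof.
have mg : measurable_fun setT (fun A' : matA => (A', b, S)).
  by do 2 (apply: measurable_fun_pair => //).
exact: (measurableT_comp mh mg).
Qed.

Let sXE b S : (\int[conditional_A M (b, S)]_A h (A, b, S) = sX b S)%E.
Proof. by rewrite integral_conditional_A. Qed.

Let sYE A S : (\int[conditional_coef M (A, S)]_b sX b S = sY A S)%E.
Proof. by rewrite integral_conditional_coef. Qed.

Let gibbsE A b S :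
  (\int[gibbs_kernel M (A, b, S)]_s h s = \int[conditional_Sigma M (A, b)]_S' sY A S')%E.
Proof.
rewrite (integral_gibbs_kernel _ _ _ _ mh h0).
under eq_integral do under eq_integral do rewrite sXE.
by under eq_integral do rewrite sYE.
Qed.

Lemma integral_gibbs_sweep A b S :
  (\int[gibbs_kernel M (A, b, S)]_s h s =
   sweepZ (lebesgue_mx n p) (@lebesgue_coef R m p q) (lebesgue_spd m) pA pb pS
     (fun A b S => h (A, b, S)) A b)%E.
Proof. by rewrite gibbsE; apply: integral_conditional_Sigma. Qed.

(** Each of the three draws succeeds with probability at least 1/2 given the success of the previous
    ones, whence 1/8. *)
Lemma integral_gibbs_ge (BS : set (spd R m)) (Bb : set coef) (BA : set matA) A b S :
  measurable BS -> measurable Bb -> measurable BA ->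
  ((2^-1)%:E <= conditional_Sigma M (A, b) BS)%E ->
  (forall S', BS S' -> (2^-1)%:E <= conditional_coef M (A, S') Bb)%E ->
  (forall b' S', Bb b' -> BS S' -> (2^-1)%:E <= conditional_A M (b', S') BA)%E ->
  (forall A' b' S', BA A' -> Bb b' -> (1 <= h (A', b', S'))%E) ->
  ((8^-1)%:E <= \int[gibbs_kernel M (A, b, S)]_s h s)%E.
Proof.
move=> mBS mBb mBA hS hb hA h1; rewrite gibbsE.
rewrite (_ : 8^-1 = 2^-1 / 2 / 2); last by field.
apply: (integral_ge_half mBS hS _ (mY A) (sY0 A)) => [|S' BS']; first by rewrite divr_ge0.
rewrite -sYE; apply: (integral_ge_half mBb (hb _ BS') _ (mX S') (sX0 ^~ S')) => // b' Bb'.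
rewrite -sXE -(mul1r 2^-1).
by apply: (integral_ge_half mBA (hA _ _ Bb' BS') _ (mhA b' S')) => // A' BA'; exact: h1.
Qed.

End sweep_of_h.

(** The thresholds are chosen in the order of the draws: [rb] depends on [ka], and [ra] on both. *)
Lemma gibbs_tail : exists ra rb : R, forall s,
  ((8^-1)%:E <= gibbs_kernel M s (Ct ra rb `*` setT))%E.
Proof.
have [ka hka] := tail_Sigma a0_ge c0 posteriorE.
have [rb hrb] := tail_coef c0 posteriorE ka.
have [ra hra] := tail_latent c0 posteriorE ka rb.
exists ra, rb => -[[A b] S].
have mC : measurable (Ct ra rb `*` [set: spd R m]) by exact: measurableX.
have -> : gibbs_kernel M (A, b, S) (Ct ra rb `*` setT) =
    (\int[gibbs_kernel M (A, b, S)]_s (\1_(Ct ra rb `*` [set: spd R m]) s)%:E)%E.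
  exact: measure_integral_indic.
apply: (@integral_gibbs_ge _ _ _ [set S' : spd R m | \tr (invmx S') <= ka]
  [set b' : coef | coef_norm2 b' <= rb] [set A' : matA | frob A' <= ra]).
- by apply/measurable_EFinP; exact: measurable_indic.
- by [].
- by apply: measurable_sublevel; apply: measurable_trace_inv; exact: measurable_id.
- apply: measurable_sublevel; apply: measurable_funD.
    by under eq_fun do rewrite -frob_col; apply: measurable_frob; exact: measurable_fst.
  by under eq_fun do rewrite -frob_col; apply: measurable_frob; exact: measurable_snd.
- by apply: measurable_sublevel; apply: measurable_frob; exact: measurable_id.
- exact: hka.
- by move=> S' kS'; exact: hrb.
- by move=> b' S' kb' kS'; exact: hra.
move=> A' b' S' rA' rb'; rewrite indicE mem_set//.
Qed.

Lemma gibbs_geometric : geometrically_ergodic (gibbs_kernel M) (posterior M).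
Proof.
have [ra [rb tail]] := gibbs_tail.
have mpd : measurable_fun setT (fun z : unit * state => posterior_density M z.2).
  by apply: (measurableT_comp (measurable_posterior_density M)); exact: measurable_snd.
(* [posterior] as a bundled measure, again through a kernel from the one-point type. *)
pose Pi := mdensity_kernel (@lebesgue_state R m n p q) mpd (fun=> posterior_density_ge0 _ _) tt.
have iw0 (S : spd R m) : 0 <= inverse_wishart_unnormalized (n + eiva0 M) (eivB0 M) S.
  exact/ltW/iw_gt0.
(* The roles are [X] for the latent matrix, drawn last, [Y] for the coefficients and [Z] for
   [Sigma]. The three functions supplied are the marginal densities of the remaining two blocks,
   read off the factorizations of [posterior_formula]. *)
apply: (@three_block_geometric _ _ _ _ _ _ R (lebesgue_mx n p) (@lebesgue_coef R m p q)
  (lebesgue_spd m) (fun A b S => posterior_density M (A, b, S)) pA pb pS _ mpA mpb mpS _ _ _ _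
  (fun b S => c * (inverse_wishart_unnormalized (n + eiva0 M) (eivB0 M) S *
    expR (- 2^-1 * prior_coef M b)) * fine (massA M b S))
  (fun A S => c * (inverse_wishart_unnormalized (n + eiva0 M) (eivB0 M) S *
    expR (- 2^-1 * prior_latent M A)) * fine (massb M A S))
  (fun A b => c * expR (- 2^-1 * (prior_latent M A + prior_coef M b)) * fine (massS M A b))
  _ _ _ _ _ _ _ _ _ (gibbs_kernel M) _ _ _ Pi _ _ (Ct ra rb) (8^-1) (minorant ra rb)
  (mCt ra rb) _ tail (measurable_minorant ra rb)).
- rewrite /measurable3 (_ : (fun _ => _) = EFin \o posterior_density M).
    by apply/measurable_EFinP; exact: measurable_posterior_density.
  by apply/funext => -[[A b] S].
- by move=> A b S; exact: posterior_density_ge0.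
- by move=> A b S; exact/ltW/pA_gt0.
- by move=> A b S; exact/ltW/pb_gt0.
- by move=> A b S; exact/ltW/pS_gt0.
- by move=> b S; rewrite mulr_ge0 ?(ltW (cA _ _)) ?(ltW (fmassA_gt0 _ _)).
- by move=> A S; rewrite mulr_ge0 ?(ltW (cb _ _)) ?(ltW (fmassb_gt0 _ _)).
- by move=> A b; rewrite mulr_ge0 ?(ltW (cS _ _)) ?(ltW (fmassS_gt0 _ _)).
- move=> A b S; rewrite posteriorE formula_densA /pA -[in RHS]mulrA.
  by rewrite (mulrC (fine _)) divfK ?gt_eqF// mulrA.
- move=> A b S; rewrite posteriorE formula_densb /pb -[in RHS]mulrA.
  by rewrite (mulrC (fine _)) divfK ?gt_eqF// mulrA.
- move=> A b S; rewrite posteriorE formula_densS /pS -[in RHS]mulrA.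
  by rewrite (mulrC (fine _)) divfK ?gt_eqF// mulrA.
- move=> b S; apply: density1.
  + by apply: measurable_densA => //; exact: measurable_id.
  + by move=> A; exact: expR_ge0.
  + exact: fmassA_gt0.
  + exact: massA_fin.
- move=> A S; apply: density1.
  + by apply: measurable_densb => //; exact: measurable_id.
  + by move=> b; exact: expR_ge0.
  + exact: fmassb_gt0.
  + exact: massb_fin.
- move=> A b; apply: density1.
  + by apply: measurable_densS => //; exact: measurable_id.
  + by move=> S; exact/ltW/densS_gt0.
  + exact: fmassS_gt0.
  + exact: massS_fin.
- by move=> g mg g0; exact: measurable_integral_gibbs_kernel.
- exact: gibbs_kernelT.
- by move=> h A b S mh h0; exact: integral_gibbs_sweep.
- move=> B mB; rewrite /Pi /mdensity_kernel /= /density_kernel.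
  by apply: eq_integral => -[[A b] S] _.
- exact: posteriorT.
- by rewrite invr_gt0.
- by move=> A b S; exact/ltW/minorant_gt0.
- by move=> A b [/= Ara brb] A' b' S'; exact: minorant_le.
apply: integral_gt0; last exact: lebesgue_state_neq0.
- by apply/measurable_EFinP; exact: measurable_minorant.
- by move=> s; exact: minorant_gt0.
Qed.

End eiv_ergodic.

Theorem corollary2 (R : realType) (m n p q : nat)
    (m_gt0 : (0 < m)%N) (n_gt0 : (0 < n)%N) (p_gt0 : (0 < p)%N) (q_gt0 : (0 < q)%N)
    (Z : 'I_n -> 'cV[R]_q) (V : 'I_n -> spd R p)
    (k : 'I_n -> 'cV[R]_p) (K : 'I_n -> spd R p)
    (a0 : nat) (a0_ge : (m <= a0)%N) (B0 : spd R m)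
    (j0 : 'cV[R]_(m * q + m * p)) (J0 : spd R (m * q + m * p))
    (y : 'I_n -> 'cV[R]_m) (x : 'I_n -> 'cV[R]_p) :
  let M := EIVModel Z V k K a0 B0 j0 J0 y x in
  (exists2 c : R, 0 < c &
     forall s, posterior_density M s = c * posterior_formula M s) /\
  geometrically_ergodic (gibbs_kernel M) (posterior M).
Proof.
move=> M; have [c c0 posteriorE] := @posterior_constant R m n p q M a0_ge.
by split; [exists c|exact: (@gibbs_geometric R m n p q M a0_ge c c0 posteriorE)].
Qed.
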